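(* Let $M^2$ be a closed homothetic soliton for the inverse mean curvature flow in $\mathbb{R}^4$. If the Gauss curvature $K$ of $M$ is constant or non-negative, then $M$ is, up to dilations and linear isometries of $\mathbb{R}^4$, the sphere $\mathbb{S}^2\subset\mathbb{R}^3\subset\mathbb{R}^4$ or the Clifford torus $\mathbb{S}^1 \times \mathbb{S}^1\subset\mathbb{R}^2\times\mathbb{R}^2=\mathbb{R}^4$ (product of two unit circles centered at the origin).
   Context: Let $\phi : M^n \to \mathbb{R}^m$ be an isometric immersion of a (connected) $n$-dimensional Riemannian manifold, with second fundamental form $\sigma$ and mean curvature vector $H=\mathrm{trace}\,\sigma$ (not divided by $n$), assumed nowhere vanishing. $\phi$ (or $M$) is called a homothetic soliton for the inverse mean curvature flow if there is a real constant $a\neq 0$ with $-\frac{H}{|H|^2}=a\,\phi^\bot$, where $\phi^\bot$ is the projection of the position vector $\phi$ onto the normal bundle. This condition is invariant under dilations $\phi\mapsto\rho\phi$, $\rho>0$, and under linear isometries. Closed means compact without boundary. The conclusion ''$M$ is ...'' is understood at the level of immersed submanifolds, i.e. of the image of the immersion. *)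

(* Defs.v *)
From HB Require Import structures.
From mathcomp Require Import all_boot all_order all_algebra.
From mathcomp Require Import all_classical all_reals all_analysis.
Set Implicit Arguments.
Unset Strict Implicit.
Unset Printing Implicit Defensive.
Import Order.TTheory GRing.Theory Num.Theory.
Import numFieldNormedType.Exports.
Local Open Scope classical_set_scope.
Local Open Scope ring_scope.

Section Smoothness.
Context {R : realType} {V W : normedModType R}.

Fixpoint Ck_on (k : nat) (U : set V) (f : V -> W) : Prop :=
  if k is k'.+1 then
    (forall x, U x -> differentiable f x) /\ (forall v, Ck_on k' U ('D_v f))
  else forall x, U x -> {for x, continuous f}.

(* Only meant for open U: 'D_v f and the continuity at points of U then do not
   depend on the values of f outside U. *)
Definition smooth_on (U : set V) (f : V -> W) : Prop := forall k, Ck_on k U f.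

End Smoothness.

Section Euclidean.
Context {R : realType} {m : nat}.

Definition dot (u v : 'rV[R]_m) : R := (u *m v^T) 0 0.

(* The library norm `|u| on 'rV_m is the sup norm. *)
Definition enorm (u : 'rV[R]_m) : R := Num.sqrt (dot u u).

Definition partial {W : normedModType R} (i : 'I_m) (f : 'rV[R]_m -> W) :
  'rV[R]_m -> W := 'D_(delta_mx 0 i) f.

(* Projection of v onto the orthogonal complement of the row space of J, for J
   of full row rank. *)
Definition normal_proj {n : nat} (J : 'M[R]_(n, m)) (v : 'rV[R]_m) : 'rV[R]_m :=
  v - v *m J^T *m invmx (J *m J^T) *m J.

End Euclidean.

Definition linear_isometry {R : realType} {m : nat}
    (L : {linear 'rV[R]_m -> 'rV[R]_m}) : Prop :=
  forall u, enorm (L u) = enorm u.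

(* chart_map and chart_inv are total functions, but only their restrictions to
   chart_dom and chart_cod are meaningful. *)
Record chart (R : realType) (n : nat) (M : topologicalType) := Chart {
  chart_dom : set M;
  chart_cod : set 'rV[R]_n;
  chart_map : M -> 'rV[R]_n;
  chart_inv : 'rV[R]_n -> M;
  chart_dom_open : open chart_dom;
  chart_cod_open : open chart_cod;
  chart_map_fun : forall p, chart_dom p -> chart_cod (chart_map p);
  chart_inv_fun : forall x, chart_cod x -> chart_dom (chart_inv x);
  chart_mapK : forall p, chart_dom p -> chart_inv (chart_map p) = p;
  chart_invK : forall x, chart_cod x -> chart_map (chart_inv x) = x;
  chart_map_continuous : forall p, chart_dom p -> {for p, continuous chart_map};
  chart_inv_continuous : forall x, chart_cod x -> {for x, continuous chart_inv}
}.

Section Transition.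
Context {R : realType} {n : nat} {M : topologicalType}.

Definition transition (c d : chart R n M) : 'rV[R]_n -> 'rV[R]_n :=
  chart_map d \o chart_inv c.

Definition overlap (c d : chart R n M) : set 'rV[R]_n :=
  chart_cod c `&` chart_inv c @^-1` chart_dom d.

End Transition.

Record smooth_manifold (R : realType) (n : nat) (M : topologicalType) :=
  SmoothManifold {
  atlas : set (chart R n M);
  manifold_hausdorff : hausdorff_space M;
  manifold_second_countable : @second_countable M;
  atlas_cover : forall p, exists2 c, atlas c & chart_dom c p;
  atlas_smooth : forall c d, atlas c -> atlas d ->
    smooth_on (overlap c d) (transition c d)
}.

(* metric_mx c x is the Gram matrix, in the chart c and at the point of
   coordinates x, of the coordinate vector fields; 'J f x has the partial
   derivatives of f as its rows. *)
Record riemannian_metric (R : realType) (n : nat) (M : topologicalType)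
    (S : smooth_manifold R n M) := RiemannianMetric {
  metric_mx : chart R n M -> 'rV[R]_n -> 'M[R]_n;
  metric_smooth : forall c, atlas S c -> smooth_on (chart_cod c) (metric_mx c);
  metric_sym : forall c x, atlas S c -> chart_cod c x ->
    (metric_mx c x)^T = metric_mx c x;
  metric_pos : forall c x, atlas S c -> chart_cod c x ->
    forall v : 'rV[R]_n, v != 0 -> 0 < (v *m metric_mx c x *m v^T) 0 0;
  metric_change : forall c d x, atlas S c -> atlas S d -> overlap c d x ->
    metric_mx c x = 'J (transition c d) x *m metric_mx d (transition c d x)
                      *m ('J (transition c d) x)^T
}.

Section Curvature.
Context {R : realType} {n : nat}.
Implicit Types (g : 'rV[R]_n -> 'M[R]_n) (x : 'rV[R]_n).

Definition christoffel g (k i j : 'I_n) x : R :=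
  2^-1 * \sum_(l < n) invmx (g x) k l *
    (partial i (fun y => g y j l) x + partial j (fun y => g y i l) x
     - partial l (fun y => g y i j) x).

(* The component along the l-th coordinate field of R(d_i, d_j) d_k, where
   R(X, Y) = [nabla_X, nabla_Y] - nabla_[X, Y]. *)
Definition riemann_tensor g (l i j k : 'I_n) x : R :=
  partial i (christoffel g l j k) x - partial j (christoffel g l i k) x
  + \sum_(s < n) (christoffel g l i s x * christoffel g s j k x
                  - christoffel g l j s x * christoffel g s i k x).

End Curvature.

(* <R(d_0, d_1) d_1, d_0> / det g *)
Definition gauss_curvature_coord {R : realType} (g : 'rV[R]_2 -> 'M[R]_2)
    (x : 'rV[R]_2) : R :=
  (\sum_(l < 2) riemann_tensor g l 0 1 1 x * g x l 0) / \det (g x).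

Section Surface.
Context {R : realType} {M : topologicalType} {S : smooth_manifold R 2 M}.
Variable g : riemannian_metric S.

Definition gauss_curvature (c : chart R 2 M) (x : 'rV[R]_2) : R :=
  gauss_curvature_coord (metric_mx g c) x.

Definition constant_gauss_curvature : Prop :=
  exists k : R, forall c x, atlas S c -> chart_cod c x -> gauss_curvature c x = k.

Definition nonneg_gauss_curvature : Prop :=
  forall c x, atlas S c -> chart_cod c x -> 0 <= gauss_curvature c x.

End Surface.

Section Immersions.
Context {R : realType} {n m : nat} {M : topologicalType}.
Context {S : smooth_manifold R n M}.
Variables (g : riemannian_metric S) (phi : M -> 'rV[R]_m).

Definition param (c : chart R n M) : 'rV[R]_n -> 'rV[R]_m := phi \o chart_inv c.

Definition isometric_immersion : Prop :=
  forall c, atlas S c ->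
    smooth_on (chart_cod c) (param c) /\
    forall x, chart_cod c x ->
      row_free ('J (param c) x) /\
      metric_mx g c x = 'J (param c) x *m ('J (param c) x)^T.

(* sigma(d_i, d_j) is the normal part of the flat derivative of d_j phi in the
   direction d_i. *)
Definition second_fundamental_form (c : chart R n M) (i j : 'I_n)
    (x : 'rV[R]_n) : 'rV[R]_m :=
  normal_proj ('J (param c) x) (partial i (partial j (param c)) x).

Definition mean_curvature (c : chart R n M) (x : 'rV[R]_n) : 'rV[R]_m :=
  \sum_(i < n) \sum_(j < n)
    invmx (metric_mx g c x) i j *: second_fundamental_form c i j x.

Definition homothetic_soliton : Prop :=
  (forall c x, atlas S c -> chart_cod c x -> mean_curvature c x != 0) /\
  exists2 a : R, a != 0 &
    forall c x, atlas S c -> chart_cod c x ->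
      - ((enorm (mean_curvature c x) ^+ 2)^-1 *: mean_curvature c x)
      = a *: normal_proj ('J (param c) x) (param c x).

End Immersions.

Definition unit_sphere2 {R : realType} : set 'rV[R]_4 :=
  [set y | enorm y = 1 /\ y 0 (inord 3) = 0].

Definition clifford_torus {R : realType} : set 'rV[R]_4 :=
  [set y | y 0 (inord 0) ^+ 2 + y 0 (inord 1) ^+ 2 = 1 /\
           y 0 (inord 2) ^+ 2 + y 0 (inord 3) ^+ 2 = 1].

(* Main.v *)
(* Pairing the soliton equation with H shows that <H, phi> is constant, so |phi|^2 has
   constant Laplacian 4 + 2 <H, phi> and, by the strong maximum principle on the compact
   connected M, is constant; then phi is normal, H is a multiple of phi, and M is minimal
   in a sphere of curvature k^2.  With u half the squared norm of the shape operator, the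
   Gauss equation is K = k^2 - u and Simons' identity reads
   Lap u = 4 (x^2 + y^2) + 4 K u, so in both cases of the hypothesis u is constant.  If
   u = 0 the normal nu of M in the sphere is constant up to sign and M lies in a great
   sphere.  Otherwise K = 0, the shape operator is parallel, and so is the symmetric
   tensor T = psi nu^T + nu psi^T - II / k on R^4 along M; T has eigenvalues 1, 1, -1, -1
   and its quadratic form vanishes on M, which is the equation of a Clifford torus.  The
   image is the whole sphere or torus: at a maximum point of the height function in the
   direction of a unit vector z one has z = A psi + B nu, and the second order condition
   together with the constraints on z forces z = psi. *)

Require Import Defs.
From HB Require Import structures.
From mathcomp Require Import all_boot all_order all_algebra.
From mathcomp Require Import ring lra.
From mathcomp Require Import all_classical all_reals all_analysis.
Set Implicit Arguments.
Unset Strict Implicit.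
Unset Printing Implicit Defensive.
Import Order.TTheory GRing.Theory Num.Theory.
Import numFieldNormedType.Exports.
Local Open Scope classical_set_scope.
Local Open Scope ring_scope.

(** * Smooth functions on an open set *)

(** Local computations take place in the ring [smf U] of smooth functions on the image of a chart,
    on which an orthonormal frame acts by derivations; the structure equations and Simons' identity
    then become polynomial identities modulo a few relations. The obstacle is global: frames exist
    only chart by chart, and M is not assumed orientable, so the normal nu has no consistent sign. A
    global function is therefore a family over charts and frames, and new ones are built by ring
    operations and by inner products of gradients ([Gam]), which do not see the frame. The normal
    enters only through expressions even in nu: nu nu^T, T (x) nu, and products of two entries of T.
    The tensor T itself comes from the wish nu = T psi with T constant: differentiating along a
    tangent vector t forces T t = (D_t nu) / k, where D_t is the derivative of psi / k normalised to
    t, so T is - II / k on the tangent plane, and T nu = psi completes it to a symmetric map. *)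

Section SmoothClosure.
Context {R : realType} {V : normedModType R}.

Lemma near_eq_differentiable {W : normedModType R} (f g : V -> W) (x : V) :
  (\forall y \near x, f y = g y) -> differentiable f x -> differentiable g x.
Proof.
move=> fg df; have [dfc fE] := (diff_locallyP x f).1 df.
have gE : g \o shift x = cst (g x) + 'd f x +o_ 0 id.
  apply/eqaddoP => e e0; move: fE => /eqaddoP /(_ e e0) fE.
  have fg0 : \forall h \near (0 : V), f (h + x) = g (h + x).
    rewrite (near_shift x 0)/= sub0r; near=> z.
    by rewrite /= subrK; near: z; exact: fg.
  have fgx : f x = g x := nbhs_singleton fg.
  near=> h.
  have -> : (g \o shift x - (cst (g x) + 'd f x)) h
          = (f \o shift x - (cst (f x) + 'd f x)) h.
    change (g (h + x) - (g x + 'd f x h) = f (h + x) - (f x + 'd f x h)).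
    by rewrite fgx (near fg0 h).
  by near: h.
have dE := diff_unique dfc gE.
by apply/diff_locallyP; rewrite dE.
Unshelve. all: by end_near. Qed.

(** The differentiation rules hold only at points of [U], not as equalities of total functions;
    since [U] is open, each derivative may be replaced by its formula on [U] in the inductions
    below. *)
Lemma Ck_on_ext {W : normedModType R} k (U : set V) (f g : V -> W) :
  open U -> (forall x, U x -> f x = g x) -> Ck_on k U f -> Ck_on k U g.
Proof.
move=> oU; elim: k f g => [|k IH] f g fg.
  move=> cf x Ux; have cfx : f @ x --> f x := cf x Ux.
  change (g @ x --> g x); rewrite -(fg x Ux); apply: cvg_trans cfx.
  apply: near_eq_cvg; near=> y; apply: fg; near: y.
  exact: open_nbhs_nbhs.
move=> [df Df]; split.
  move=> x Ux; apply: near_eq_differentiable (df x Ux).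
  by near=> y; apply: fg; near: y; exact: open_nbhs_nbhs.
move=> v; apply: IH (Df v) => x Ux; apply: near_eq_derive.
by near=> y; apply: fg; near: y; exact: open_nbhs_nbhs.
Unshelve. all: by end_near. Qed.

Lemma Ck_onW {W : normedModType R} k (U : set V) (f : V -> W) :
  Ck_on k.+1 U f -> Ck_on k U f.
Proof.
elim: k f => [|k IH] f [df Df].
  by move=> x Ux; exact: differentiable_continuous (df x Ux).
by split => // v; apply: IH.
Qed.

Lemma Ck_on_cst {W : normedModType R} k (U : set V) (a : W) :
  Ck_on k U (fun=> a).
Proof.
elim: k a => [|k IH] a; first by move=> x _; exact: cst_continuous.
split => [x _|v]; first exact: differentiable_cst.
have -> : 'D_v (fun=> a) = fun=> (0 : W) by apply/funext => x; exact: derive_cst.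
exact: IH.
Qed.

Lemma Ck_onD {W : normedModType R} k (U : set V) (f g : V -> W) : open U ->
  Ck_on k U f -> Ck_on k U g -> Ck_on k U (fun x => f x + g x).
Proof.
move=> oU; elim: k f g => [|k IH] f g.
  by move=> cf cg x Ux; apply: continuousD; [exact: cf|exact: cg].
move=> [df Df] [dg Dg]; split.
  by move=> x Ux; apply: differentiableD; [exact: df|exact: dg].
move=> v; apply: Ck_on_ext oU _ (IH _ _ (Df v) (Dg v)) => x Ux.
by rewrite -deriveD//; apply: diff_derivable; [exact: df|exact: dg].
Qed.

Lemma Ck_onM k (U : set V) (f g : V -> R) : open U ->
  Ck_on k U f -> Ck_on k U g -> Ck_on k U (fun x => f x * g x).
Proof.
move=> oU; elim: k f g => [|k IH] f g.
  by move=> cf cg x Ux; apply: continuousM; [exact: cf|exact: cg].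
move=> fk gk; have := Ck_onW fk; have := Ck_onW gk; move: fk gk.
move=> [df Df] [dg Dg] gk fk; split.
  by move=> x Ux; apply: differentiableM; [exact: df|exact: dg].
move=> v; apply: Ck_on_ext oU _ (Ck_onD oU (IH _ _ fk (Dg v)) (IH _ _ gk (Df v))).
move=> x Ux; symmetry; apply: (@deriveM _ _ f g x v).
  by apply: diff_derivable; exact: df.
by apply: diff_derivable; exact: dg.
Qed.

Lemma Ck_on_coord k n (U : set V) (f : V -> 'rV[R]_n) j : open U ->
  Ck_on k U f -> Ck_on k U (fun x => f x 0 j).
Proof.
move=> oU; elim: k f => [|k IH] f.
  move=> cf x Ux.
  apply: (@continuous_comp _ _ _ f (fun M : 'rV[R]_n => M 0 j) x (cf x Ux)).
  exact: coord_continuous.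
move=> [df Df]; split.
  move=> x Ux; apply: (@differentiable_comp _ _ _ _ f (fun M : 'rV[R]_n => M 0 j)).
    exact: df.
  exact: differentiable_coord.
move=> v; apply: Ck_on_ext oU _ (IH _ (Df v)) => x Ux.
by rewrite derive_mx ?mxE//; apply: diff_derivable; exact: df.
Qed.

Lemma is_derive_rsqrt (t : R) : 0 < t ->
  is_derive t 1 (fun s => (Num.sqrt s)^-1) (- 2^-1 * (Num.sqrt t)^-1 ^+ 3).
Proof.
move=> t0; have s0 : Num.sqrt t != 0 by rewrite gt_eqF ?sqrtr_gt0.
have [ds Ds] := is_derive1_sqrt t0; split; first exact: derivableV.
rewrite deriveV// Ds /GRing.scale /=; field.
by rewrite s0.
Qed.

(** With r = f^(-1/2), the derivative is - r^3 / 2 times that of f, a polynomial in r and the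
    derivative of f, so the induction on k closes. Gram-Schmidt needs no other non-polynomial
    operation. *)
Lemma Ck_on_rsqrt k (U : set V) (f : V -> R) : open U ->
  (forall x, U x -> 0 < f x) ->
  Ck_on k U f -> Ck_on k U (fun x => (Num.sqrt (f x))^-1).
Proof.
move=> oU f0; elim: k => [|k IH].
  move=> cf x Ux; apply: (@continuousV _ _ (fun y => Num.sqrt (f y))).
    by rewrite gt_eqF ?sqrtr_gt0 ?f0//.
  by apply: continuous_comp; [exact: cf|exact: sqrt_continuous].
move=> fk; have hk := IH (Ck_onW fk); have [df Df] := fk; split.
  move=> x Ux; apply: (@differentiable_comp _ _ _ _ f (fun s => (Num.sqrt s)^-1)).
    exact: df.
  by apply/derivable1_diffP; have [] := is_derive_rsqrt (f0 x Ux).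
move=> v; have hv := Ck_onM oU (Ck_onM oU
  (Ck_on_cst k U (- 2^-1 : R)) (Df v)) (Ck_onM oU hk (Ck_onM oU hk hk)).
apply: Ck_on_ext oU _ hv => x Ux /=; have [dr Dr] := is_derive_rsqrt (f0 x Ux).
have dc : differentiable (fun s : R => (Num.sqrt s)^-1) (f x).
  exact/derivable1_diffP.
rewrite (deriveE v (differentiable_comp (df x Ux) dc)) diff_comp//; last exact: df.
rewrite /= -(deriveE v (df x Ux)) -[X in 'd _ _ X]mulr1 [RHS]linearZ /=.
rewrite -(@deriveE R R R _ (f x) 1 dc) Dr /GRing.scale /=; ring.
Qed.

End SmoothClosure.

Lemma eq_of_dist_lt (R : realFieldType) (a b : R) :
  (forall d, 0 < d -> `|a - b| < d + d) -> a = b.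
Proof.
move=> h; apply/eqP; rewrite -subr_eq0 -normr_eq0 eq_le normr_ge0 andbT leNgt.
apply/negP => d0; have := h (`|a - b| / 2); rewrite divr_gt0// => /(_ isT).
by rewrite -splitr ltxx.
Qed.

Lemma near_dist_lt2 (R : realType) (V : normedModType R) (x : V) (U : set V)
    (F G : V -> R) d : nbhs x U -> F @ x --> F x -> G @ x --> G x -> 0 < d ->
  \forall y \near x, [/\ U y, `|F x - F y| < d & `|G x - G y| < d].
Proof.
move=> nU cF cG d0; near=> y; split; near: y => //.
  by move/cvgrPdist_lt : cF; apply.
by move/cvgrPdist_lt : cG; apply.
Unshelve. all: by end_near. Qed.

Lemma near_gt0 (R : realType) (V : normedModType R) (x : V) (U P : set V)
    (F : V -> R) : nbhs x U -> nbhs x P -> F @ x --> F x -> 0 < F x ->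
  \forall y \near x, [/\ U y, P y & 0 < F y].
Proof.
move=> nU nP cF F0; near=> y; split; near: y => //.
exact: (cvgr_gt _ cF).
Unshelve. all: by end_near. Qed.

(** * Calculus along lines: mean values, mixed derivatives, local maxima *)

Section LineCalculus.
Context {R : realType} {V : normedModType R}.
Implicit Types (f : V -> R) (x u v : V).

Lemma is_derive_line f x v (t : R) : differentiable f (x + t *: v) ->
  is_derive t 1 (fun s : R => f (x + s *: v)) ('D_v f (x + t *: v)).
Proof.
move=> df; have dv := diff_derivable (v := v) df.
have E : (fun h : R => h^-1 *: (f (x + (h *: (1 : R) + t) *: v) - f (x + t *: v)))
   = (fun h : R => h^-1 *: (f (h *: v + (x + t *: v)) - f (x + t *: v))).
  apply/funext => h; congr (_ *: (f _ - _)).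
  by rewrite scalerDl addrCA [_ *: 1]mulr1.
by split; rewrite /derivable /derive E.
Qed.

Lemma derive_translate f w u x : 'D_u (fun y => f (y + w)) x = 'D_u f (x + w).
Proof.
rewrite /derive; set F := (X in lim (X @ _)); set G := (X in _ = lim (X @ _)).
suff -> : F = G by [].
by apply/funext => h; rewrite /F /G /= addrA.
Qed.

Lemma MVT_line f x v :
  (forall t : R, 0 <= t <= 1 -> differentiable f (x + t *: v)) ->
  exists2 t : R, 0 < t < 1 & f (x + v) - f x = 'D_v f (x + t *: v).
Proof.
move=> df.
have cf : {within `[0, 1], continuous (fun s : R => f (x + s *: v))}.
  apply: continuous_in_subspaceT => t; rewrite inE/= in_itv/= => t01.
  have [dt _] := is_derive_line (df t t01).
  exact/differentiable_continuous/derivable1_diffP.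
have dl (t : R) : t \in `]0, 1[%R ->
    is_derive t (1 : R) (fun s : R => f (x + s *: v)) ('D_v f (x + t *: v)).
  rewrite in_itv/= => /andP[t0 t1].
  by apply: is_derive_line; apply: df; rewrite !ltW.
have [t + E] := MVT ltr01 dl cf; rewrite in_itv/= => t01.
by exists t => //; move: E; rewrite scale1r scale0r addr0 subr0 mulr1.
Qed.

Lemma deriveZv f x v (s : R) : differentiable f x ->
  'D_(s *: v) f x = s * 'D_v f x.
Proof. by move=> df; rewrite !deriveE// linearZ. Qed.

(** Besides the parallelograms of [derive_comm], the pairs v, - v and v, 0 give the segments used at
    a local maximum. The [+ 1] in [m] covers the case u = v = 0. *)
Lemma nbhs_parallelogram x u v (A : set V) : nbhs x A ->
  exists2 s : R, 0 < s & forall a b : R, 0 <= a <= 1 -> 0 <= b <= 1 ->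
    A (x + a *: (s *: u) + b *: (s *: v)).
Proof.
move=> /nbhs_ballP[r /= r0 rA]; pose m := `|u| + `|v| + 1.
have m0 : 0 < m by rewrite /m ltr_wpDl// addr_ge0.
exists (r / m); first by rewrite divr_gt0.
move=> a b /andP[a0 a1] /andP[b0 b1]; apply: rA.
rewrite -ball_normE /ball_ /= -addrA opprD addrA subrr sub0r normrN.
apply: le_lt_trans (ler_normD _ _) _.
have q0 : 0 < r / m by rewrite divr_gt0.
have nZ (c : R) (w : V) : 0 <= c -> `|c *: w| = c * `|w|.
  by move=> c0; rewrite normrZ ger0_norm.
rewrite !nZ ?(ltW q0)//.
have ru : 0 <= r / m * `|u| by rewrite mulr_ge0// ltW.
have rv : 0 <= r / m * `|v| by rewrite mulr_ge0// ltW.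
have : r / m * (`|u| + `|v| + 1) = r by rewrite -/m divfK// gt_eqF.
have ha : a * (r / m * `|u|) <= r / m * `|u| by rewrite ler_piMl.
have hb : b * (r / m * `|v|) <= r / m * `|v| by rewrite ler_piMl.
rewrite !mulrDr mulr1; lra.
Qed.

(** The mean value theorem is applied along u to the difference f (y + v) - f y, then along v to the
    derivative of f in the direction u. *)
Lemma second_difference (U : set V) f x u v : Ck_on 2 U f ->
  (forall a b : R, 0 <= a <= 1 -> 0 <= b <= 1 -> U (x + a *: u + b *: v)) ->
  exists a b : R, [/\ 0 <= a <= 1, 0 <= b <= 1 &
    f (x + u + v) - f (x + u) - (f (x + v) - f x) =
    'D_v ('D_u f) (x + a *: u + b *: v)].
Proof.
move=> [df Df] UU.
have U0 (a : R) : 0 <= a <= 1 -> U (x + a *: u).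
  by move=> a01; have := UU a 0 a01; rewrite scale0r addr0; apply; rewrite lexx ler01.
have U1 (a : R) : 0 <= a <= 1 -> U (x + a *: u + v).
  by move=> a01; have := UU a 1 a01; rewrite scale1r; apply; rewrite lexx ler01.
pose g y := f (y + v) - f y.
have ds y : differentiable (fun z : V => z + v) y.
  by apply: differentiableD => //; exact: differentiable_cst.
have dfv (a : R) : 0 <= a <= 1 ->
    differentiable (fun y => f (y + v)) (x + a *: u).
  by move=> a01; apply: differentiable_comp; [exact: ds|exact/df/U1].
have [a a01 Ea] : exists2 t : R, 0 < t < 1 & g (x + u) - g x = 'D_u g (x + t *: u).
  apply: MVT_line => t t01; apply: differentiableB; first exact: dfv.
  exact/df/U0.
have a01' : 0 <= a <= 1 by case/andP: a01 => ? ?; rewrite !ltW.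
have [b b01 Eb] : exists2 t : R, 0 < t < 1 &
    'D_u f (x + a *: u + v) - 'D_u f (x + a *: u)
    = 'D_v ('D_u f) (x + a *: u + t *: v).
  by apply: (@MVT_line ('D_u f) _ v) => t t01; apply: (Df u).1; exact: UU.
exists a, b; split => //; first by case/andP: b01 => ? ?; rewrite !ltW.
rewrite -Eb -/(g (x + u)) -/(g x) Ea deriveB; last 2 first.
- by apply: diff_derivable; exact: dfv.
- by apply: diff_derivable; exact/df/U0.
by rewrite derive_translate.
Qed.

(** The second difference over the parallelogram on s u and s v is symmetric in u and v, so the two
    mixed derivatives agree at two nearby points once s^2 is cancelled; continuity moves both points
    to x. *)
Theorem derive_comm (U : set V) f x u v : open U -> Ck_on 2 U f -> U x ->
  'D_u ('D_v f) x = 'D_v ('D_u f) x.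
Proof.
move=> oU f2 Ux; have [df Df] := f2; apply: eq_of_dist_lt => d d0.
have cuv : 'D_u ('D_v f) @ x --> 'D_u ('D_v f) x := (Df v).2 u x Ux.
have cvu : 'D_v ('D_u f) @ x --> 'D_v ('D_u f) x := (Df u).2 v x Ux.
have nA : \forall y \near x, [/\ U y, `|'D_u ('D_v f) x - 'D_u ('D_v f) y| < d &
    `|'D_v ('D_u f) x - 'D_v ('D_u f) y| < d].
  exact: (near_dist_lt2 (open_nbhs_nbhs (conj oU Ux)) cuv cvu d0).
have [s s0 sA] := nbhs_parallelogram u v nA.
have [a [b [a01 b01 E1]]] := second_difference f2 (fun a b a01 b01 =>
  let: And3 p _ _ := sA a b a01 b01 in p).
have [a' [b' [a01' b01' E2]]] : exists a b : R, [/\ 0 <= a <= 1, 0 <= b <= 1 &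
    f (x + s *: u + s *: v) - f (x + s *: v) - (f (x + s *: u) - f x) =
    'D_(s *: u) ('D_(s *: v) f) (x + a *: (s *: v) + b *: (s *: u))].
  rewrite [x + s *: u + _]addrAC.
  apply: (second_difference f2) => a' b' a01' b01'; rewrite addrAC.
  by have [] := sA b' a' b01' a01'.
have scal w w' y : U y -> 'D_(s *: w) ('D_(s *: w') f) y = s ^+ 2 * 'D_w ('D_w' f) y.
  move=> Uy; rewrite (_ : 'D_(s *: w) _ y = 'D_(s *: w) (s \*: 'D_w' f) y); last first.
    apply: near_eq_derive; near=> z; rewrite deriveZv//; apply: df; near: z.
    exact: open_nbhs_nbhs.
  have dw : differentiable ('D_w' f) y by exact: (Df w').1.
  rewrite deriveZ; last exact: diff_derivable.
  by rewrite deriveZv// /GRing.scale/= mulrA expr2.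
have [U1 _ h1] := sA _ _ a01 b01.
have E2' : x + a' *: (s *: v) + b' *: (s *: u) = x + b' *: (s *: u) + a' *: (s *: v).
  by rewrite addrAC.
rewrite {}E2' in E2.
have [U2 h2 _] := sA _ _ b01' a01'.
rewrite scal// in E1; rewrite scal// in E2.
have EE : 'D_v ('D_u f) (x + a *: (s *: u) + b *: (s *: v)) =
    'D_u ('D_v f) (x + b' *: (s *: u) + a' *: (s *: v)).
  have s2 : s ^+ 2 != 0 by rewrite expf_neq0// gt_eqF.
  apply: (mulfI s2); apply: etrans (esym E1) (etrans _ E2).
  move: (f (_ + _ + _)) (f (x + s *: u)) (f (x + s *: v)) (f x) => b1 b2 b3 b4.
  ring.
rewrite EE in h1.
move: h1 h2; set p := 'D_u ('D_v f) x; set q := 'D_v ('D_u f) x.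
set w := 'D_u ('D_v f) _ => h1 h2.
rewrite (_ : p - q = (p - w) - (q - w)); last by ring.
exact: le_lt_trans (ler_normB _ _) (ltrD h2 h1).
Unshelve. all: by end_near. Qed.

Lemma derive_max_eq0 (U : set V) f x v : open U -> Ck_on 1 U f -> U x ->
  (\forall y \near x, f y <= f x) -> 'D_v f x = 0.
Proof.
move=> oU [df _] Ux fx.
have nA : \forall y \near x, U y /\ f y <= f x.
  by near=> y; split; near: y => //; exact: open_nbhs_nbhs.
(* The directions v and - v make x an interior point of a segment, as the one-variable criterion
   requires. *)
have [s s0 sA] := nbhs_parallelogram v (- v) nA.
have mem (t : R) : - s <= t <= s -> U (x + t *: v) /\ f (x + t *: v) <= f x.
  move=> /andP[t1 t2].
  have [t0|t0] := lerP 0 t.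
    have := sA (t / s) 0; rewrite scale0r addr0 scalerA divfK ?gt_eqF//.
    by apply; rewrite ?lexx ?ler01// divr_ge0 ?(ltW s0)//= ler_pdivrMr// mul1r.
  have := sA 0 (- t / s); rewrite scale0r addr0 scalerA divfK ?gt_eqF//.
  rewrite scalerN scaleNr opprK.
  apply; rewrite ?lexx ?ler01// divr_ge0 ?(ltW s0) ?oppr_ge0 ?(ltW t0)//=.
  by rewrite ler_pdivrMr// mul1r; lra.
have D0 : 'D_1 (fun t : R => f (x + t *: v)) 0 = 0.
  have [] := @derive1_at_max R (fun t : R => f (x + t *: v)) (- s) s 0.
  - lra.
  - move=> t; rewrite in_itv/= => /andP[t1 t2].
    have [Ut _] : U (x + t *: v) /\ f (x + t *: v) <= f x.
      by apply: mem; rewrite !ltW.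
    by have [] := is_derive_line (df _ Ut).
  - by rewrite in_itv/=; apply/andP; split; lra.
  - move=> t; rewrite in_itv/= scale0r addr0 => /andP[t1 t2].
    by apply: (mem t _).2; rewrite !ltW.
  by [].
have [_ D0'] := @is_derive_line f x v 0 (df (x + 0 *: v) ltac:(by rewrite scale0r addr0)).
by rewrite D0 scale0r addr0 in D0'.
Unshelve. all: by end_near. Qed.

(** A positive second derivative would stay positive near x; as the first derivative vanishes at x,
    two mean value steps would give f (x + s v) > f x. *)
Lemma derive2_max_le0 (U : set V) f x v : open U -> Ck_on 2 U f -> U x ->
  (\forall y \near x, f y <= f x) -> 'D_v ('D_v f) x <= 0.
Proof.
move=> oU f2 Ux fx; have [df Df] := f2.
rewrite leNgt; apply/negP => D2.
have D1 := derive_max_eq0 v oU (Ck_onW f2) Ux fx.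
have c2 : 'D_v ('D_v f) @ x --> 'D_v ('D_v f) x := (Df v).2 v x Ux.
have nA : \forall y \near x, [/\ U y, f y <= f x & 0 < 'D_v ('D_v f) y].
  exact: (near_gt0 (open_nbhs_nbhs (conj oU Ux)) fx c2 D2).
have [s s0 sA] := nbhs_parallelogram v 0 nA.
have mem (t : R) : 0 <= t <= 1 ->
    [/\ U (x + t *: (s *: v)), f (x + t *: (s *: v)) <= f x
      & 0 < 'D_v ('D_v f) (x + t *: (s *: v))].
  by move=> t01; have := sA t 0 t01; rewrite scale0r addr0; apply; rewrite lexx ler01.
have [t t01 Et] : exists2 t : R, 0 < t < 1 &
    f (x + s *: v) - f x = 'D_(s *: v) f (x + t *: (s *: v)).
  by apply: (@MVT_line f x (s *: v)) => t /mem[Ut _ _]; exact: df.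
have tle : 0 <= t <= 1 by case/andP: t01 => ? ?; rewrite !ltW.
have [Ut _ _] := mem t tle.
rewrite deriveZv in Et; last exact: df.
have [t' t01' Et'] : exists2 t' : R, 0 < t' < 1 &
    'D_v f (x + t *: (s *: v)) - 'D_v f x
    = 'D_(t *: (s *: v)) ('D_v f) (x + t' *: (t *: (s *: v))).
  apply: (@MVT_line ('D_v f) _ (t *: (s *: v))) => t' /andP[t0' t1'].
  apply: (Df v).1; rewrite scalerA.
  case/andP: tle => t0 t1.
  by have [] := mem (t' * t) ltac:(by rewrite mulr_ge0//= mulr_ile1).
case/andP: t01 => t0 t1; case/andP: t01' => t0' t1'.
have [U'' _ P2] := mem (t' * t) ltac:(by rewrite mulr_ge0 ?ltW//= mulr_ilt1// ltW).
have E3 : t' *: (t *: (s *: v)) = (t' * t) *: (s *: v) by rewrite scalerA.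
have d2 := (Df v).1 _ U''.
rewrite D1 subr0 E3 !(deriveZv _ _ d2) in Et'.
rewrite Et' in Et.
have [_ + _] := mem 1 ltac:(by rewrite lexx ler01).
rewrite scale1r -subr_le0 Et leNgt => /negP; apply.
by rewrite !mulr_gt0.
Unshelve. all: by end_near. Qed.

End LineCalculus.

(** * The ring of smooth functions and its derivations *)

Record oset (V : topologicalType) := OSet {
  oset_set :> V -> Prop;
  oset_open : open oset_set
}.

(* The elements vanish outside U, so that equality is equality on U. *)
Record smf (R : realType) (V : normedModType R) (U : oset V) := SFun {
  smf_val :> V -> R;
  smf_smooth : smooth_on U smf_val;
  smf_out : forall x, ~ oset_set U x -> smf_val x = 0
}.

Section SmoothRing1.
Context {R : realType} {V : normedModType R} {U : oset V}.
Local Notation A := (smf U).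
Implicit Types f g h : A.

Lemma smf_eq f g : (forall x, U x -> f x = g x) -> f = g.
Proof.
case: f g => [f sf f0] [g sg g0] /= fg.
have E : f = g.
  apply/funext => x; have [/fg//|nU] := pselect (U x).
  by rewrite f0 ?g0.
move: sf f0; rewrite E => sf f0.
by rewrite (Prop_irrelevance sf sg) (Prop_irrelevance f0 g0).
Qed.

Definition restr0 (f : V -> R) : V -> R := fun x => if `[< U x >] then f x else 0.

Lemma restr0_out (f : V -> R) x : ~ U x -> restr0 f x = 0.
Proof. by move=> Ux; rewrite /restr0 asboolF. Qed.

Lemma restr0_smooth (f : V -> R) : smooth_on U f -> smooth_on U (restr0 f).
Proof.
move=> sf k; apply: Ck_on_ext (oset_open U) _ (sf k) => x Ux.
by rewrite /restr0 asboolT.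
Qed.

Definition mk_smf (f : V -> R) (sf : smooth_on U f) : A :=
  SFun (restr0_smooth sf) (@restr0_out f).

Lemma mk_smfE (f : V -> R) (sf : smooth_on U f) x : U x -> mk_smf sf x = f x.
Proof. by move=> Ux; rewrite /= /restr0 asboolT. Qed.

Lemma smf_diff f x : U x -> differentiable f x.
Proof. by move=> Ux; exact: (smf_smooth f 1).1. Qed.

Lemma smf_continuous f x : U x -> {for x, continuous f}.
Proof. by move=> Ux; apply: differentiable_continuous; exact: smf_diff. Qed.

Lemma smooth_cst (c : R) : smooth_on U (fun _ : V => c).
Proof. by move=> k; exact: Ck_on_cst. Qed.

Lemma smf_add_smooth f g : smooth_on U (fun x => f x + g x).
Proof. by move=> k; apply: Ck_onD; [exact: oset_open|exact: smf_smooth..]. Qed.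

Lemma smf_add_out f g x : ~ U x -> f x + g x = 0.
Proof. by move=> nU; rewrite !smf_out// addr0. Qed.

Lemma smf_mul_smooth f g : smooth_on U (fun x => f x * g x).
Proof. by move=> k; apply: Ck_onM; [exact: oset_open|exact: smf_smooth..]. Qed.

Lemma smf_mul_out f g x : ~ U x -> f x * g x = 0.
Proof. by move=> nU; rewrite !smf_out// mulr0. Qed.

End SmoothRing1.

(* Locking keeps unification from comparing the underlying functions. *)
HB.lock Definition smf_cst (R : realType) (V : normedModType R) (U : oset V)
  (c : R) : smf U := mk_smf (smooth_cst c).
Arguments smf_cst {R V} U c.
HB.lock Definition smf_add (R : realType) (V : normedModType R) (U : oset V)
  (f g : smf U) : smf U := SFun (smf_add_smooth f g) (@smf_add_out _ _ _ f g).
Arguments smf_add {R V U} f g.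
HB.lock Definition smf_mul (R : realType) (V : normedModType R) (U : oset V)
  (f g : smf U) : smf U := SFun (smf_mul_smooth f g) (@smf_mul_out _ _ _ f g).
Arguments smf_mul {R V U} f g.
HB.lock Definition smf_opp (R : realType) (V : normedModType R) (U : oset V)
  (f : smf U) : smf U := smf_mul (smf_cst U (-1)) f.
Arguments smf_opp {R V U} f.

Section SmoothRing2.
Context {R : realType} {V : normedModType R} {U : oset V}.
Local Notation A := (smf U).
Implicit Types f g h : A.

Lemma smf_cstE (c : R) x : U x -> smf_cst U c x = c.
Proof. by move=> Ux; rewrite unlock mk_smfE. Qed.
Fact smf_addE f g x : smf_add f g x = f x + g x.
Proof. by rewrite unlock. Qed.
Fact smf_mulE f g x : smf_mul f g x = f x * g x.
Proof. by rewrite unlock. Qed.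

HB.instance Definition _ := gen_eqMixin A.
HB.instance Definition _ := gen_choiceMixin A.

Fact smf_addA : associative (@smf_add R V U).
Proof. by move=> f g h; apply: smf_eq => x _; rewrite !smf_addE addrA. Qed.
Fact smf_addC : commutative (@smf_add R V U).
Proof. by move=> f g; apply: smf_eq => x _; rewrite !smf_addE addrC. Qed.
Fact smf_add0 : left_id (smf_cst U 0) (@smf_add R V U).
Proof. by move=> f; apply: smf_eq => x Ux; rewrite smf_addE smf_cstE// add0r. Qed.
Fact smf_addN : left_inverse (smf_cst U 0) (@smf_opp R V U) (@smf_add R V U).
Proof.
move=> f; apply: smf_eq => x Ux; rewrite smf_addE smf_opp.unlock smf_mulE.
by rewrite !smf_cstE// mulN1r addNr.
Qed.

HB.instance Definition _ :=
  GRing.isZmodule.Build A smf_addA smf_addC smf_add0 smf_addN.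

Fact smf_mulA : associative (@smf_mul R V U).
Proof. by move=> f g h; apply: smf_eq => x _; rewrite !smf_mulE mulrA. Qed.
Fact smf_mulC : commutative (@smf_mul R V U).
Proof. by move=> f g; apply: smf_eq => x _; rewrite !smf_mulE mulrC. Qed.
Fact smf_mul1 : left_id (smf_cst U 1) (@smf_mul R V U).
Proof. by move=> f; apply: smf_eq => x Ux; rewrite smf_mulE smf_cstE// mul1r. Qed.
Fact smf_mulDl : left_distributive (@smf_mul R V U) (@smf_add R V U).
Proof.
by move=> f g h; apply: smf_eq => x _; rewrite !(smf_addE, smf_mulE) mulrDl.
Qed.

HB.instance Definition _ :=
  GRing.Zmodule_isComPzRing.Build A smf_mulA smf_mulC smf_mul1 smf_mulDl.

Lemma smfD f g x : (f + g) x = f x + g x. Proof. exact: smf_addE. Qed.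
Lemma smfM f g x : (f * g) x = f x * g x. Proof. exact: smf_mulE. Qed.
Lemma smf0 x : (0 : A) x = 0.
Proof.
have [Ux|nU] := pselect (U x); first exact: smf_cstE.
exact: smf_out.
Qed.
Lemma smf1 x : U x -> (1 : A) x = 1. Proof. exact: smf_cstE. Qed.
Lemma smfN f x : (- f) x = - f x.
Proof. by apply: (addrI (f x)); rewrite -smfD !subrr smf0. Qed.
Lemma smfB f g x : (f - g) x = f x - g x.
Proof. by rewrite smfD smfN. Qed.
Lemma smfMn f n x : (f *+ n) x = f x *+ n.
Proof. by elim: n => [|n IH]; rewrite ?mulr0n ?smf0// !mulrS smfD IH. Qed.
Lemma smfX f n x : U x -> (f ^+ n) x = f x ^+ n.
Proof. by move=> Ux; elim: n => [|n IH]; rewrite ?expr0 ?smf1// !exprS smfM IH. Qed.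
Lemma smf_sum (I : Type) (r : seq I) (P : pred I) (F : I -> A) x :
  (\sum_(i <- r | P i) F i) x = \sum_(i <- r | P i) F i x.
Proof.
elim/big_rec2: _ => [|i a b _ <-]; first exact: smf0.
by rewrite smfD.
Qed.

Lemma derive_smooth v f : smooth_on U ('D_v f).
Proof. by move=> k; have [_] := smf_smooth f k.+1; apply. Qed.

End SmoothRing2.

HB.lock Definition sderive (R : realType) (V : normedModType R) (U : oset V)
  (v : V) (f : smf U) : smf U := mk_smf (derive_smooth v f).
Arguments sderive {R V U} v f.

Section SmoothRing3.
Context {R : realType} {V : normedModType R} {U : oset V}.
Local Notation A := (smf U).
Implicit Types f g h : A.

Lemma sderiveE v f x : U x -> sderive v f x = 'D_v f x.
Proof. by move=> Ux; rewrite unlock mk_smfE. Qed.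

Lemma sderiveD v f g : sderive v (f + g) = sderive v f + sderive v g.
Proof.
apply: smf_eq => x Ux; rewrite smfD !sderiveE//.
have -> : smf_val (f + g) = smf_val f + smf_val g by apply/funext => y; exact: smfD.
by rewrite -deriveD//; apply: diff_derivable; exact: smf_diff.
Qed.

Lemma sderiveM v f g : sderive v (f * g) = sderive v f * g + f * sderive v g.
Proof.
apply: smf_eq => x Ux; rewrite smfD !smfM !sderiveE//.
have -> : smf_val (f * g) = smf_val f * smf_val g by apply/funext => y; exact: smfM.
have [df dg] : derivable f x v /\ derivable g x v.
  by split; apply: diff_derivable; exact: smf_diff.
rewrite [LHS](@deriveM _ _ f g x v df dg) addrC mulrC.
by rewrite /GRing.scale/= mulrC [X in _ + X]mulrC.
Qed.

Lemma sderive_cst v c : sderive v (smf_cst U c) = 0.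
Proof.
apply: smf_eq => x Ux; rewrite smf0 sderiveE// -[RHS](derive_cst c x v).
apply: near_eq_derive; near=> y; rewrite smf_cstE//; near: y.
by apply: open_nbhs_nbhs; split => //; exact: oset_open.
Unshelve. all: by end_near. Qed.

Lemma sderive2E u v f x : U x -> sderive u (sderive v f) x = 'D_u ('D_v f) x.
Proof.
move=> Ux; rewrite sderiveE//; apply: near_eq_derive; near=> y.
rewrite sderiveE//; near: y.
by apply: open_nbhs_nbhs; split => //; exact: oset_open.
Unshelve. all: by end_near. Qed.

Lemma sderiveC u v f : sderive u (sderive v f) = sderive v (sderive u f).
Proof.
apply: smf_eq => x Ux; apply: (etrans (sderive2E u v f Ux)).
apply: (etrans (derive_comm u v (oset_open U) (smf_smooth f 2) Ux)).
exact: (esym (sderive2E v u f Ux)).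
Qed.

Lemma sderive_lin (a b : R) u v f x : U x ->
  sderive (a *: u + b *: v) f x = a * sderive u f x + b * sderive v f x.
Proof.
move=> Ux; have df := smf_diff f Ux.
by rewrite !sderiveE// !deriveE// linearD !linearZ.
Qed.

Lemma rsqrt_smooth f : (forall x, U x -> 0 < f x) ->
  smooth_on U (fun x => (Num.sqrt (f x))^-1).
Proof.
by move=> f0 k; apply: Ck_on_rsqrt => //; [exact: oset_open|exact: smf_smooth].
Qed.

Lemma rsqrt_exists f : (forall x, U x -> 0 < f x) ->
  exists2 r : A, r * r * f = 1 & forall x, U x -> 0 < r x.
Proof.
move=> f0; exists (mk_smf (rsqrt_smooth f0)); last first.
  by move=> x Ux; rewrite mk_smfE// invr_gt0 sqrtr_gt0 f0.
apply: smf_eq => x Ux; rewrite !smfM mk_smfE// smf1// -invfM -expr2.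
by rewrite sqr_sqrtr ?(ltW (f0 x Ux))// mulVf// gt_eqF// f0.
Qed.

End SmoothRing3.

(** * Moving frames *)

(* With these, an identity modulo the relation a = b is closed by ring, given the
   cofactor m. *)
Lemma eq_comb1 (A : comPzRingType) (m a b c d : A) :
  a = b -> c - d = m * (a - b) -> c = d.
Proof. by move=> -> /eqP; rewrite subrr mulr0 subr_eq0 => /eqP. Qed.

Lemma eq_comb2 (A : comPzRingType) (m n a b a' b' c d : A) :
  a = b -> a' = b' -> c - d = m * (a - b) + n * (a' - b') -> c = d.
Proof. by move=> -> -> /eqP; rewrite !subrr !mulr0 addr0 subr_eq0 => /eqP. Qed.

Section Derivations.
Context {A : comPzRingType}.

Definition derivation (D : A -> A) :=
  (forall f g, D (f + g) = D f + D g) /\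
  (forall f g, D (f * g) = D f * g + f * D g).

Variables (D : A -> A) (dD : derivation D).

Lemma derD f g : D (f + g) = D f + D g. Proof. exact: dD.1. Qed.
Lemma derM f g : D (f * g) = D f * g + f * D g. Proof. exact: dD.2. Qed.
Lemma der0 : D 0 = 0.
Proof. by apply: (addrI (D 0)); rewrite -derD !addr0. Qed.
Lemma derN f : D (- f) = - D f.
Proof. by apply: (addrI (D f)); rewrite -derD !subrr der0. Qed.
Lemma derB f g : D (f - g) = D f - D g.
Proof. by rewrite derD derN. Qed.
Lemma der1 : D 1 = 0.
Proof. by apply: (addrI (D 1)); rewrite addr0 -{3}[1]mulr1 derM mulr1 mul1r. Qed.
Lemma derMn f n : D (f *+ n) = D f *+ n.
Proof. by elim: n => [|n IH]; rewrite ?mulr0n ?der0// !mulrS derD IH. Qed.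
Lemma der_nat n : D n%:R = 0.
Proof. by rewrite derMn der1 mul0rn. Qed.
Lemma der_sum I r (P : pred I) F :
  D (\sum_(i <- r | P i) F i) = \sum_(i <- r | P i) D (F i).
Proof. exact: (big_morph D derD der0). Qed.

Lemma der_mulmx m n p (X : 'M[A]_(m, n)) (Y : 'M[A]_(n, p)) :
  map_mx D (X *m Y) = map_mx D X *m Y + X *m map_mx D Y.
Proof.
apply/matrixP => i j; rewrite !mxE der_sum -big_split; apply: eq_bigr => k _ /=.
by rewrite derM !mxE.
Qed.

Lemma der_mx1 n : map_mx D (1%:M : 'M[A]_n) = 0.
Proof. by apply/matrixP => i j; rewrite !mxE; case: eqP => _; rewrite (der1, der0). Qed.

Lemma der_trmx m n (X : 'M[A]_(m, n)) : map_mx D X^T = (map_mx D X)^T.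
Proof. by apply/matrixP => i j; rewrite !mxE. Qed.

End Derivations.

Lemma derivation_comb (A : comPzRingType) (D1 D2 : A -> A) (a b : A) :
  derivation D1 -> derivation D2 -> derivation (fun f => a * D1 f + b * D2 f).
Proof.
move=> d1 d2; split=> f g; first by rewrite (derD d1) (derD d2); ring.
by rewrite (derM d1) (derM d2); ring.
Qed.

Section Frame.
Context {A : comPzRingType}.
Variables (E1 E2 : A -> A) (dE1 : derivation E1) (dE2 : derivation E2).
Variables (n : nat) (F : 'M[A]_n).
Hypothesis orthF : F *m F^T = 1%:M.
Hypothesis orthF' : F^T *m F = 1%:M.

(** The Maurer-Cartan form dF F^T of the frame, evaluated on the field [E]. *)
Definition connection (E : A -> A) : 'M[A]_n := map_mx E F *m F^T.

Lemma connectionE E : map_mx E F = connection E *m F.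
Proof. by rewrite /connection -mulmxA orthF' mulmx1. Qed.

Lemma connection_skew E : derivation E -> (connection E)^T = - connection E.
Proof.
move=> dE; apply/eqP; rewrite -addr_eq0; apply/eqP.
rewrite /connection trmx_mul trmxK -der_trmx addrC -(der_mulmx dE) orthF.
exact: der_mx1.
Qed.

(** The structure equation of flat space. Multiplied by F, both sides are the commutator of E1 and
    E2 on F; the quadratic term comes from differentiating [connectionE] once more. *)
Lemma connection_curvature c1 c2 :
  (forall f, E1 (E2 f) - E2 (E1 f) = c1 * E1 f + c2 * E2 f) ->
  map_mx E1 (connection E2) - map_mx E2 (connection E1)
    + (connection E2 *m connection E1 - connection E1 *m connection E2)
  = c1 *: connection E1 + c2 *: connection E2.
Proof.
move=> comm.
suff : (map_mx E1 (connection E2) - map_mx E2 (connection E1)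
    + (connection E2 *m connection E1 - connection E1 *m connection E2)) *m F
  = (c1 *: connection E1 + c2 *: connection E2) *m F.
  by move=> /(congr1 (mulmx^~ F^T)); rewrite /= -!mulmxA orthF !mulmx1.
have C1 := connectionE E1; have C2 := connectionE E2.
rewrite !mulmxDl !mulNmx -!scalemxAl -C1 -C2.
rewrite -(mulmxA (connection E2)) -(mulmxA (connection E1)) -C1 -C2.
have -> : c1 *: map_mx E1 F + c2 *: map_mx E2 F
    = map_mx E1 (map_mx E2 F) - map_mx E2 (map_mx E1 F).
  by apply/matrixP => i j; rewrite !mxE comm.
rewrite [in RHS]C1 [in RHS]C2 (der_mulmx dE1) (der_mulmx dE2).
by rewrite opprD addrACA.
Qed.

End Frame.

Definition mx4 (T : pzRingType) (s : seq (seq T)) : 'M[T]_4 :=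
  \matrix_(i, j) nth 0 (nth [::] s i) j.

(* The rows of F are psi, t1, t2, nu, for a minimal surface psi in the sphere of
   curvature k ^+ 2; t1 and t2 are the images of psi / k under E1 and E2, p and q are the
   connection coefficients of (t1, t2), and al, be the entries of the traceless second
   fundamental form. *)
Section MinimalSurface.
Context {A : comPzRingType}.
Variables (E1 E2 : A -> A) (dE1 : derivation E1) (dE2 : derivation E2).
Variables (k k' c1 c2 p q al be be' : A) (F : 'M[A]_4).
Hypothesis orthF : F *m F^T = 1%:M.
Hypothesis orthF' : F^T *m F = 1%:M.
Hypothesis comm : forall f, E1 (E2 f) - E2 (E1 f) = c1 * E1 f + c2 * E2 f.
Hypothesis kk' : k * k' = 1.
Hypothesis (E1k : E1 k = 0) (E2k : E2 k = 0).
Hypothesis conn1 : connection F E1 =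
  mx4 [:: [:: 0; k; 0; 0]; [:: - k; 0; p; al]; [:: 0; - p; 0; be];
          [:: 0; - al; - be; 0]].
Hypothesis conn2 : connection F E2 =
  mx4 [:: [:: 0; 0; k; 0]; [:: 0; 0; q; be']; [:: - k; - q; 0; - al];
          [:: 0; - be'; al; 0]].

Let curv := connection_curvature dE1 dE2 orthF orthF' comm.

Let entry (i j : 'I_4) := congr1 (fun X : 'M[A]_4 => X i j) curv.

Let k_inj a b : k * a = k * b -> a = b.
Proof. by move=> kab; rewrite -[a]mul1r -[b]mul1r -kk' mulrAC kab mulrAC. Qed.

(** The row of psi in the structure equation: its tangential entries express that the connection is
    torsion free, its normal entry that the second fundamental form is symmetric. *)
Lemma frame_bracket : [/\ c1 = - p, c2 = - q & be' = be].
Proof.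
have := entry 0 (inord 1); have := entry 0 (inord 2); have := entry 0 (inord 3).
rewrite conn1 conn2 !mxE !big_ord_recl !big_ord0 !mxE !inordK//=.
rewrite !(der0 dE1) !(der0 dE2) E1k E2k => e3 e2 e1; split; apply: k_inj.
- by apply: (eq_comb1 (m := -1) e1); ring.
- by apply: (eq_comb1 (m := -1) e2); ring.
- by apply: (eq_comb1 (m := -1) e3); ring.
Qed.

(** The (1, 2) entry of the structure equation is the Gauss equation, with curvature k^2 - (al^2 +
    be^2); the entries (1, 3) and (2, 3) are the Codazzi equations. *)
Lemma gauss_codazzi :
  [/\ E1 q - E2 p = - (p ^+ 2 + q ^+ 2) - (k ^+ 2 - (al ^+ 2 + be ^+ 2)),
      E2 al = E1 be + 2 * p * al + 2 * q * be &
      E2 be = - (E1 al - 2 * p * be) - 2 * q * al].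
Proof.
have [c1E c2E beE] := frame_bracket.
have := entry (inord 1) (inord 2); have := entry (inord 1) (inord 3).
have := entry (inord 2) (inord 3).
rewrite conn1 conn2 !mxE !big_ord_recl !big_ord0 !mxE !inordK//=.
rewrite !(derN dE1) c1E c2E beE => e3 e2 e1; split.
- by apply: (eq_comb1 (m := 1) e1); ring.
- by apply: (eq_comb1 (m := -1) e2); ring.
- by apply: (eq_comb1 (m := -1) e3); ring.
Qed.

Let u := al ^+ 2 + be ^+ 2.
(** x and y are the components of the covariant derivative of the second fundamental form along
    [E1]; by Codazzi those along [E2] are y and - x. *)
Let x := E1 al - 2 * p * be.
Let y := E1 be + 2 * p * al.

Lemma simons :
  [/\ E1 u = 2 * (al * x + be * y), E2 u = 2 * (al * y - be * x) &
     E1 (E1 u) + E2 (E2 u) - p * E2 u + q * E1 u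
     = 4 * (x ^+ 2 + y ^+ 2) + 4 * (k ^+ 2 - u) * u].
Proof.
have [G E2a E2b] := gauss_codazzi; have [c1E c2E _] := frame_bracket.
rewrite -/u in G.
have E1a : E1 al = x + 2 * p * be by rewrite /x; ring.
have E1b : E1 be = y - 2 * p * al by rewrite /y; ring.
rewrite -/x in E2b; rewrite -/y in E2a.
have ca := comm al; have cb := comm be.
move: E1a E1b E2a E2b ca cb; move: x y => X Y E1a E1b E2a E2b ca cb.
rewrite E2a E1a E2b E1b c1E c2E in ca cb.
have nat1 n : E1 n%:R = 0 by exact: der_nat.
have nat2 n : E2 n%:R = 0 by exact: der_nat.
have R1 := (derD dE1, derB dE1, derN dE1, derM dE1, nat1, E1a, E1b).
have R2 := (derD dE2, derB dE2, derN dE2, derM dE2, nat2, E2a, E2b).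
rewrite !R1 !R2 in ca cb.
have u1 : E1 u = 2 * (al * X + be * Y) by rewrite /u !expr2 !R1; ring.
have u2 : E2 u = 2 * (al * Y - be * X) by rewrite /u !expr2 !R2; ring.
split; [exact: u1|exact: u2|rewrite u1 u2 !R1 !R2].
have G1 : E1 q = E2 p + (- (p ^+ 2 + q ^+ 2) - (k ^+ 2 - u)).
  by rewrite -G addrC subrK.
rewrite G1 in ca cb.
(* Second derivatives of al and be enter only through al (E1 X + E2 Y) + be (E1 Y - E2 X); the
   bracket relations for be and al evaluate exactly these two sums, whence the cofactors. *)
apply: (eq_comb2 (m := 2 * be) (n := - 2 * al) ca cb).
rewrite /u; ring.
Qed.

(* For k' = 1 / k, the matrix in the basis (psi, t1, t2, nu) of
   psi nu^T + nu psi^T - k' II; it is parallel when u = k ^+ 2. *)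
Definition torus_mx : 'M[A]_4 :=
  mx4 [:: [:: 0; 0; 0; 1]; [:: 0; - (k' * al); - (k' * be); 0];
          [:: 0; - (k' * be); k' * al; 0]; [:: 1; 0; 0; 0]].

Local Ltac lin kk' uk :=
  first [by apply: (eq_comb1 (m := al) kk'); ring
        | by apply: (eq_comb1 (m := - al) kk'); ring
        | by apply: (eq_comb1 (m := be) kk'); ring
        | by apply: (eq_comb1 (m := - be) kk'); ring
        | by apply: (eq_comb1 (m := 1) uk); ring
        | by apply: (eq_comb1 (m := -1) uk); ring].

(** The connection matrix w is skew, so differentiating F^T B F gives F^T (E B - w B + B w) F. The
    middle factor vanishes entry by entry modulo k k' = 1 and k' (al^2 + be^2) = k. *)
Lemma torus_tensor_parallel :
  E1 k' = 0 -> E2 k' = 0 -> u = k ^+ 2 -> x = 0 -> y = 0 ->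
  map_mx E1 (F^T *m torus_mx *m F) = 0 /\ map_mx E2 (F^T *m torus_mx *m F) = 0.
Proof.
move=> E1k' E2k' uE x0 y0; have [c1E c2E beE] := frame_bracket.
have [_ E2a E2b] := gauss_codazzi.
have E1a : E1 al = 2 * p * be by rewrite -[RHS]add0r -x0 /x; ring.
have E1b : E1 be = - (2 * p * al) by rewrite -[RHS]add0r -y0 /y; ring.
rewrite E1b in E2a; rewrite E1a in E2b.
set B := torus_mx; set T := F^T *m B *m F.
have mapT E : derivation E ->
    map_mx E T = F^T *m (map_mx E B - connection F E *m B + B *m connection F E) *m F.
  move=> dE; rewrite /T !(der_mulmx dE) (der_trmx E) (connectionE orthF') trmx_mul.
  rewrite (connection_skew orthF dE) mulmxN !mulNmx.
  rewrite !(mulmxDl, mulmxDr, mulNmx, mulmxN) !mulmxA.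
  by rewrite [X in X + _]addrC.
have kb t : k * (k' * t) = t by rewrite mulrA kk' mul1r.
have uk : k' * al * al + k' * be * be = k.
  by rewrite -!mulrA -mulrDr -!expr2 -/u uE expr2 mulrA [k' * k]mulrC kk' mul1r.
have B0 E : derivation E -> map_mx E B - connection F E *m B + B *m connection F E = 0 ->
    map_mx E T = 0.
  by move=> dE B0; rewrite mapT// B0 mulmx0 mul0mx.
have R1 := (derM dE1, derN dE1, E1k', E1a, E1b, der0 dE1, der1 dE1).
have R2 := (derM dE2, derN dE2, E2k', E2a, E2b, der0 dE2, der1 dE2).
split; [apply: B0 => //|apply: B0 => //]; apply/matrixP => i j.
  rewrite conn1 /B /torus_mx !mxE !big_ord_recl !big_ord0 !mxE.
  case: i => [[|[|[|[|i]]]] //= i4]; case: j => [[|[|[|[|j]]]] //= j4];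
    rewrite ?R1 //; first [ring | lin kk' uk].
rewrite conn2 beE /B /torus_mx !mxE !big_ord_recl !big_ord0 !mxE.
case: i => [[|[|[|[|i]]]] //= i4]; case: j => [[|[|[|[|j]]]] //= j4];
  rewrite ?R2 //; first [ring | lin kk' uk].
Qed.

End MinimalSurface.

(** * Second order operators and the Hopf lemma *)

Section Elliptic.
Context {R : realType} {V : normedModType R} {U : oset V}.
Local Notation A := (smf U).

Lemma derivation_sderive v : derivation (sderive v : A -> A).
Proof. by split => f g; [exact: sderiveD|exact: sderiveM]. Qed.

Lemma sderive_comb (a b : R) u v (f : A) :
  sderive (a *: u + b *: v) f = smf_cst U a * sderive u f + smf_cst U b * sderive v f.
Proof.
apply: smf_eq => x Ux.
by rewrite (sderive_lin _ _ _ _ _ Ux) smfD !smfM !(smf_cstE _ Ux).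
Qed.

Variables (e0 e1 : V) (a b c a' c' f1 f2 : A).
Hypothesis (aa' : a * a' = 1) (cc' : c * c' = 1).

(** Gram-Schmidt makes the coefficients triangular; the zero term keeps the shape of [field2], so
    that [derivation_comb] covers both fields. *)
Definition field1 (f : A) := a * sderive e0 f + 0 * sderive e1 f.
Definition field2 (f : A) := b * sderive e0 f + c * sderive e1 f.
Local Notation E1 := field1.
Local Notation E2 := field2.

Definition elliptic (f : A) := E1 (E1 f) + E2 (E2 f) + f1 * E1 f + f2 * E2 f.

Let dd0 : derivation (sderive e0) := derivation_sderive _.
Let dd1 : derivation (sderive e1) := derivation_sderive _.

Lemma derivation_field1 : derivation E1. Proof. exact: derivation_comb. Qed.
Lemma derivation_field2 : derivation E2. Proof. exact: derivation_comb. Qed.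
Let dE1 := derivation_field1.
Let dE2 := derivation_field2.

Lemma field1_cst t : E1 (smf_cst U t) = 0.
Proof. by rewrite /field1 !sderive_cst !mulr0 addr0. Qed.

Lemma field2_cst t : E2 (smf_cst U t) = 0.
Proof. by rewrite /field2 !sderive_cst !mulr0 addr0. Qed.

Lemma field_eq0 (f : A) x : U x -> E1 f x = 0 -> E2 f x = 0 ->
  sderive e0 f x = 0 /\ sderive e1 f x = 0.
Proof.
move=> Ux; rewrite /field1 /field2 !smfD !smfM smf0 mul0r addr0 => h1 h2.
have ax : a x * a' x = 1 by rewrite -smfM aa' smf1.
have cx : c x * c' x = 1 by rewrite -smfM cc' smf1.
have f0 : sderive e0 f x = 0 by rewrite -[LHS]mul1r -ax mulrAC h1 mul0r.
split=> //; move: h2; rewrite f0 mulr0 add0r => h2.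
by rewrite -[LHS]mul1r -cx mulrAC h2 mul0r.
Qed.

Lemma field_bracket : exists c1 c2 : A, forall f,
  E1 (E2 f) - E2 (E1 f) = c1 * E1 f + c2 * E2 f.
Proof.
(* X and Y are the components of the bracket along the commuting directions e0 and e1. The witnesses
   come from substituting e0 = a' E1 and e1 = c' (E2 - b a' E1). *)
pose X := a * sderive e0 b - b * sderive e0 a - c * sderive e1 a.
pose Y := a * sderive e0 c.
exists ((X - Y * c' * b) * a'), (Y * c') => f.
rewrite /field1 /field2 !(derD dd0, derD dd1, derM dd0, derM dd1) (der0 dd0) (der0 dd1).
rewrite (sderiveC e1 e0) /X /Y.
move: (sderive e0 (sderive e0 f)) (sderive e0 (sderive e1 f)) => F00 F01.
move: (sderive e1 (sderive e1 f)) (sderive e0 f) (sderive e1 f) => F11 F0 F1.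
move: (sderive e0 a) (sderive e1 a) (sderive e0 b) (sderive e0 c) => A0 A1 B0 C0.
apply: (eq_comb2 (m := - F0 * (a * B0 - b * A0 - c * A1 - a * C0 * c' * b))
  (n := - a * C0 * F1) aa' cc').
ring.
Qed.

Section LocalMax.
Variables (h : A) (x : V) (Ux : U x) (hx : \forall y \near x, h y <= h x).

Let crit v : sderive v h x = 0.
Proof.
rewrite sderiveE//.
exact: (derive_max_eq0 v (oset_open U) (smf_smooth h 1) Ux hx).
Qed.

Lemma field_max_eq0 : E1 h x = 0 /\ E2 h x = 0.
Proof. by rewrite /field1 /field2 !smfD !smfM !crit !mulr0 addr0. Qed.

Lemma hessian_max_le0 (s t : R) :
  s ^+ 2 * E1 (E1 h) x + s * t * (E1 (E2 h) x + E2 (E1 h) x)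
    + t ^+ 2 * E2 (E2 h) x <= 0.
Proof.
(* The constant vector that agrees with s E1 + t E2 at x. At a critical point the derivatives of a,
   b, c only multiply vanishing first derivatives, so the iterated fields give the Hessian on v. *)
pose v : V := (s * a x + t * b x) *: e0 + (t * c x) *: e1.
have : sderive v (sderive v h) x <= 0.
  rewrite (sderive2E _ _ _ Ux).
  exact: (derive2_max_le0 v (oset_open U) (smf_smooth h 2) Ux hx).
rewrite /v !sderive_comb /field1 /field2 !(derD dd0, derD dd1, derM dd0, derM dd1).
rewrite !(der0 dd0, der0 dd1, sderive_cst).
rewrite (sderiveC e1 e0) !(smfD, smfM, smf0, smf_cstE _ Ux) !crit.
by apply: le_trans; rewrite le_eqVlt; apply/orP; left; apply/eqP; ring.
Qed.

Lemma elliptic_max_le0 : elliptic h x <= 0.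
Proof.
have [z1 z2] := field_max_eq0.
have := hessian_max_le0 1 0; have := hessian_max_le0 0 1.
by rewrite /elliptic !(smfD _ _ x) (smfM f1) (smfM f2) z1 z2; lra.
Qed.

End LocalMax.

Lemma ellipticD f g : elliptic (f + g) = elliptic f + elliptic g.
Proof.
rewrite /elliptic; move: E1 E2 dE1 dE2 => F1 F2 dF1 dF2.
by rewrite !(derD dF1, derD dF2); ring.
Qed.

Lemma elliptic_cstM t f : elliptic (smf_cst U t * f) = smf_cst U t * elliptic f.
Proof.
rewrite /elliptic; have := field1_cst t; have := field2_cst t.
move: E1 E2 dE1 dE2 => F1 F2 dF1 dF2 F1t F2t.
rewrite !(derD dF1, derD dF2, derM dF1, derM dF2) !(F1t, F2t).
by rewrite !(der0 dF1, der0 dF2); ring.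
Qed.

(** Where s vanishes but its gradient does not, the last term dominates for large t, so the operator
    is positive on the barrier there. *)
Lemma elliptic_barrier t s :
  elliptic (s * (1 + smf_cst U t * s)) =
  (1 + 2 * smf_cst U t * s) * elliptic s
    + 2 * smf_cst U t * (E1 s * E1 s + E2 s * E2 s).
Proof.
rewrite /elliptic; have := field1_cst t; have := field2_cst t.
move: E1 E2 dE1 dE2 => F1 F2 dF1 dF2 F1t F2t.
rewrite !(derD dF1, derD dF2, derM dF1, derM dF2, der1 dF1, der1 dF2).
rewrite !(F1t, F2t, der0 dF1, der0 dF2, derD dF1, derD dF2, derM dF1, derM dF2).
ring.
Qed.

End Elliptic.

Lemma closed_preimageI (T Y : topologicalType) (K : set T) (P : set Y) (f : T -> Y) :
  closed K -> closed P -> (forall z, K z -> {for z, continuous f}) ->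
  closed (K `&` f @^-1` P).
Proof.
move=> cK cP cf z clz; have Kz : K z.
  by apply: cK => B /clz [w [[Kw _] Bw]]; exists w.
split=> //; apply: cP => B nB.
have /clz [w [[_ Pw] Bw]] := cf z Kz B nB.
by exists (f w).
Qed.

(** * The strong maximum principle near a maximum point *)

Section Hopf.
Context {R : realType} {V : normedModType R} {U : oset V}.
Local Notation A := (smf U).
Variables (e0 e1 : V) (X0 X1 : V -> R) (x0 x1 : A).
Hypothesis X0B : forall y z, X0 (y - z) = X0 y - X0 z.
Hypothesis X1B : forall y z, X1 (y - z) = X1 y - X1 z.
Hypothesis cX0 : continuous X0.
Hypothesis cX1 : continuous X1.
Hypothesis normX : forall v, `|v| = Num.max `|X0 v| `|X1 v|.
Hypothesis x0E : forall z, U z -> x0 z = X0 z.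
Hypothesis x1E : forall z, U z -> x1 z = X1 z.
Hypothesis d0x0 : sderive e0 x0 = 1.
Hypothesis d1x0 : sderive e1 x0 = 0.
Hypothesis d0x1 : sderive e0 x1 = 0.
Hypothesis d1x1 : sderive e1 x1 = 1.
Hypothesis compact_ball : forall (x : V) r, 0 < r -> compact (closed_ball x r).

Variables (a b c a' c' f1 f2 : A).
Hypothesis (aa' : a * a' = 1) (cc' : c * c' = 1).
Local Notation E1 := (field1 e0 e1 a).
Local Notation E2 := (field2 e0 e1 b c).
Local Notation L := (elliptic e0 e1 a b c f1 f2).

(** Squared Euclidean distance: by [normX] the norm is a sup norm, whose balls have corners, while
    the barrier needs round balls. *)
Let d2 (y z : V) : R := (X0 y - X0 z) ^+ 2 + (X1 y - X1 z) ^+ 2.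

Let continuous_d2 q : continuous (d2 ^~ q).
Proof.
move=> z; have h (X : V -> R) : continuous X ->
    {for z, continuous (fun y => (X y - X q) ^+ 2)}.
  move=> cX; have E : (fun y => (X y - X q) ^+ 2)
      = (fun y => (X y - X q) * (X y - X q)) by apply/funext => y; rewrite expr2.
  have cB : {for z, continuous (fun y => X y - X q)}.
    by apply: continuousB; [exact: cX|exact: cst_continuous].
  by rewrite E; apply: continuousM.
exact: (continuousD (h X0 cX0) (h X1 cX1)).
Qed.

Let d2_gt0 y z : y <> z -> 0 < d2 y z.
Proof.
move=> yz; rewrite lt_neqAle addr_ge0 ?sqr_ge0// andbT eq_sym.
apply/negP; rewrite paddr_eq0 ?sqr_ge0// !sqrf_eq0 => /andP[/eqP h0 /eqP h1].
apply: yz; apply/eqP; rewrite -subr_eq0 -normr_eq0 normX X0B X1B h0 h1.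
by rewrite normr0 maxxx.
Qed.

Let closed_ballP (x z : V) r : 0 < r -> closed_ball x r z <-> `|x - z| <= r.
Proof. by move=> r0; rewrite closed_ballE. Qed.

Let nbhs_closed_ball (x : V) (P : set V) : nbhs x P ->
  exists2 r, 0 < r & closed_ball x r `<=` P.
Proof.
move=> /nbhs_ballP[r /= r0 rP]; exists (r / 2); first by rewrite divr_gt0.
move=> z /(closed_ballP _ _ (divr_gt0 r0 (ltr0Sn _ 1))) xz; apply: rP.
by rewrite -ball_normE /ball_ /=; apply: (le_lt_trans xz); lra.
Qed.

Let sqr_le_lt (r s : R) : 0 < s -> r ^+ 2 < s ^+ 2 -> `|r| < s.
Proof. by move=> s0; rewrite -[r ^+ 2]real_normK ?num_real// ltr_pXn2r// nnegrE ltW. Qed.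

Let mid_eq (t u : R) : - (t - (u + t) / 2 + (t - (u + t) / 2)) = 0 -> t = u.
Proof. lra. Qed.

(* An interior ball in {f < m} touches {f = m} first at y; s > 0 is a ball inside it
   that touches {f = m} only at y, and s + k s^2 is the barrier. *)
Lemma hopf_local (f : A) (m : R) (x : V) : U x ->
  (forall z, U z -> f z <= m) -> f x = m -> (forall z, U z -> 0 <= L f z) ->
  \forall z \near x, f z = m.
Proof.
move=> Ux fm fx Lf; apply: contrapT => nn.
have nU : nbhs x U by apply: open_nbhs_nbhs; split => //; exact: oset_open.
have [r r0 rU] := nbhs_closed_ball nU.
(* The bound r / 4 ensures that every point at most as far from q as y lies in [K] ([nearq]), so
   that y is nearest to q among all contact points of U, not only among those in [K]. *)
have [q [xq fq]] : exists q, `|x - q| < r / 4 /\ f q <> m.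
  apply: contrapT => nq; apply: nn; apply/nbhs_ballP; exists (r / 4).
    by rewrite /= divr_gt0.
  move=> z; rewrite -ball_normE /ball_ /= => xz; apply: contrapT => fz.
  by apply: nq; exists z.
pose K := closed_ball x r.
have cK : closed K by exact: closed_ball_closed.
pose Z := K `&` f @^-1` [set m].
have cZ : closed Z.
  apply: (closed_preimageI cK (@closed_eq R m)).
  by move=> z /rU; exact: smf_continuous.
have ZK : Z `<=` closed_ball x r by move=> z [].
have kZ : compact Z := subclosed_compact cZ (compact_ball r0) ZK.
have Kx : K x by apply/closed_ballP => //; rewrite subrr normr0 ltW.
have [y yZ ymin] : exists2 y, y \in Z & forall z, z \in Z -> d2 y q <= d2 z q.
  apply: compact_EVT_min => //; first by exists x.
  by apply: continuous_subspaceT; exact: continuous_d2.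
have {yZ}[Ky fy] : Z y by rewrite inE in yZ.
have Uy := rU _ Ky.
have dyx : d2 y q <= d2 x q by apply: ymin; rewrite inE.
have dxq : d2 x q < (r / 2) ^+ 2.
  have : Num.max `|X0 x - X0 q| `|X1 x - X1 q| < r / 4 by rewrite -X0B -X1B -normX.
  rewrite gt_max => /andP[h0 h1].
  have k0 : (X0 x - X0 q) ^+ 2 < (r / 4) ^+ 2.
    by rewrite -[X in X < _]real_normK ?num_real// ltr_pXn2r// nnegrE; lra.
  have k1 : (X1 x - X1 q) ^+ 2 < (r / 4) ^+ 2.
    by rewrite -[X in X < _]real_normK ?num_real// ltr_pXn2r// nnegrE; lra.
  rewrite /d2; apply: lt_le_trans (ltrD k0 k1) _.
  have := sqr_ge0 r; rewrite !exprMn; lra.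
have nearq z : d2 z q <= d2 y q -> K z.
  move=> dz; apply/closed_ballP => //.
  have dz' := le_lt_trans (le_trans dz dyx) dxq.
  have h0 : `|X0 z - X0 q| < r / 2.
    apply: sqr_le_lt; first by rewrite divr_gt0.
    by apply: le_lt_trans dz'; rewrite lerDl sqr_ge0.
  have h1 : `|X1 z - X1 q| < r / 2.
    apply: sqr_le_lt; first by rewrite divr_gt0.
    by apply: le_lt_trans dz'; rewrite lerDr sqr_ge0.
  have hq : `|z - q| < r / 2 by rewrite normX X0B X1B gt_max h0 h1.
  rewrite (_ : x - z = (x - q) - (z - q)); last by rewrite opprB addrA subrK.
  by apply: le_trans (ler_normB _ _) _; lra.
(* The centre of the ball with diameter qy, which lies in the ball about q through y and meets its
   boundary only at y. *)
pose m0 := (X0 q + X0 y) / 2; pose m1 := (X1 q + X1 y) / 2.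
pose rho := (X0 y - m0) ^+ 2 + (X1 y - m1) ^+ 2.
pose s : A := smf_cst U rho - ((x0 - smf_cst U m0) * (x0 - smf_cst U m0)
   + (x1 - smf_cst U m1) * (x1 - smf_cst U m1)).
have sE z : U z -> s z = rho - ((X0 z - m0) ^+ 2 + (X1 z - m1) ^+ 2).
  move=> Uz; rewrite /s !(smfB, smfD, smfM, smf_cstE _ Uz) (x0E Uz) (x1E Uz).
  by rewrite !expr2.
have d0s : sderive e0 s = - 2 * (x0 - smf_cst U m0).
  rewrite /s !(derB (derivation_sderive e0), derD (derivation_sderive e0),
    derM (derivation_sderive e0), sderive_cst) d0x0 d0x1; ring.
have d1s : sderive e1 s = - 2 * (x1 - smf_cst U m1).
  rewrite /s !(derB (derivation_sderive e1), derD (derivation_sderive e1),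
    derM (derivation_sderive e1), sderive_cst) d1x0 d1x1; ring.
clearbody s.
have fs z : U z -> z <> y -> 0 <= s z -> f z < m.
  move=> Uz zy; rewrite sE// => sz.
  have dzy := d2_gt0 zy.
  have dlt : d2 z q < d2 y q.
    by move: sz dzy; rewrite /rho /m0 /m1 /d2; lra.
  have Kz := nearq z (ltW dlt).
  rewrite lt_neqAle fm// andbT; apply/eqP => fz.
  have Zz : z \in Z by rewrite inE.
  by have := ymin z Zz; rewrite leNgt dlt.
have sy : s y = 0 by rewrite sE// subrr.
have yq : y <> q by move=> yq; apply: fq; rewrite -yq.
pose S := E1 s * E1 s + E2 s * E2 s.
have S0 : 0 < S y.
  rewrite /S smfD smfM (smfM (E2 s)) -!expr2 lt_neqAle addr_ge0 ?sqr_ge0// andbT eq_sym.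
  apply/negP; rewrite paddr_eq0 ?sqr_ge0// !sqrf_eq0 => /andP[/eqP h0 /eqP h1].
  have [] := field_eq0 aa' cc' Uy h0 h1; rewrite d0s d1s.
  rewrite !(mulNr, smfN) (mulrDl 1 1) (mulrDl 1 1) !mul1r !(smfD, smfN).
  rewrite (x0E Uy) (x1E Uy) !(smf_cstE _ Uy) /m0 /m1 => g0 g1.
  apply: yq; apply/eqP; rewrite -subr_eq0 -normr_eq0 normX X0B X1B.
  by rewrite (mid_eq g0) (mid_eq g1) !subrr normr0 maxxx.
(* Chosen so that [L v y] equals [L s y] + |[L s y]| + 1. *)
pose k := (`|L s y| + 1) / (2 * S y).
pose v := s * (1 + smf_cst U k * s).
have Lvy : 0 < L v y.
  have -> : L v y = L s y + (k + k) * S y.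
    rewrite /v elliptic_barrier -/S; move: (k) (L s) (S) => t Ls T.
    rewrite mulrDl mul1r (mulrDl 1 1 (smf_cst U t)) mul1r.
    by rewrite !(smfD, smfM, smf_cstE _ Uy) sy !(mulr0, mul0r, addr0).
  have -> : (k + k) * S y = `|L s y| + 1 by rewrite /k; field; rewrite gt_eqF.
  by have := ler_norm (- L s y); rewrite normrN; lra.
have vE z : U z -> v z = s z * (1 + k * s z).
  by move=> Uz; rewrite /v !(smfD, smfM, smf_cstE _ Uz) ?(smf1 Uz).
have nP : \forall z \near y, [/\ U z, 0 < L v z, 0 < (1 + smf_cst U k * s) z & v z < 1].
  have cA (g : A) : g @ y --> g y by exact: smf_continuous.
  near=> z; split; near: z.
  - by apply: open_nbhs_nbhs; split => //; exact: oset_open.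
  - exact: (cvgr_gt _ (cA (L v))).
  - apply: (cvgr_gt _ (cA _)).
    by rewrite !(smfD, smfM, smf_cstE _ Uy) ?(smf1 Uy) sy mulr0 addr0.
  - by apply: (cvgr_lt _ (cA _)); rewrite vE// sy mul0r.
have [de de0 deP] := nbhs_closed_ball nP.
pose B := closed_ball y de.
have kB : compact B by exact: compact_ball.
have cB : closed B by exact: closed_ball_closed.
have BU z : B z -> U z by move=> /deP[].
(* The part of the boundary of [B] where s >= 0. There f < m, by a uniform margin [ep] thanks to
   compactness; on the rest of the boundary s < 0, hence v < 0. *)
pose C := (B `&` s @^-1` [set t | 0 <= t])
   `&` (fun z => `|y - z|) @^-1` [set t | de <= t].
have cC : closed C.
  apply: (closed_preimageI _ (@closed_ge R de)).
    apply: (closed_preimageI cB (@closed_ge R 0)).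
    by move=> z /BU; exact: smf_continuous.
  - move=> z _; apply: (@continuous_comp _ _ _ (fun w => y - w) (fun w => `|w|)).
      by apply: continuousB; [exact: cst_continuous|exact: cvg_id].
    exact: norm_continuous.
have CB : C `<=` B by move=> z [[]].
have kC : compact C := subclosed_compact cC kB CB.
have fC z : C z -> f z < m.
  move=> [[Bz sz] yz]; apply: fs => //; first exact: BU.
  by move=> zy; move: yz; rewrite /= zy subrr normr0 leNgt de0.
have [ep ep0 epC] : exists2 ep, 0 < ep & forall z, C z -> f z + ep <= m.
  have [C0|C0] := pselect (C !=set0); last first.
    by exists 1 => // z Cz; case: C0; exists z.
  have [z zC zmax] : exists2 z, z \in C & forall w, w \in C -> f w <= f z.
    apply: compact_EVT_max => //; apply: continuous_in_subspaceT => w.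
    by rewrite inE => -[[/BU Uw _] _]; exact: smf_continuous.
  exists (m - f z); first by rewrite subr_gt0 fC//; rewrite inE in zC.
  by move=> w Cw; rewrite addrCA gerDl subr_le0; apply: zmax; rewrite inE.
(* On the boundary of [B] this perturbation is below m, while w y = m; so its maximum over [B] is
   interior, against L w > 0. *)
pose w := f + smf_cst U ep * v.
have wE z : U z -> w z = f z + ep * v z.
  by move=> Uz; rewrite /w !(smfD, smfM, smf_cstE _ Uz).
have By : B y by apply/closed_ballP => //; rewrite subrr normr0 ltW.
have [z zB zmax] : exists2 z, z \in B & forall t, t \in B -> w t <= w z.
  apply: compact_EVT_max => //; first by exists y.
  apply: continuous_in_subspaceT => t; rewrite inE => /BU Ut.
  exact: smf_continuous.
have {zB}Bz : B z by rewrite inE in zB.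
have wz : m <= w z.
  have : w y <= w z by apply: zmax; rewrite inE.
  by rewrite wE// vE// sy mul0r mulr0 addr0 fy.
have Uz := BU _ Bz; have [_ Lvz sz1 vz1] := deP _ Bz.
have [yz|yz] := ltP `|y - z| de.
  have zm : \forall t \near z, w t <= w z.
    near=> t; apply: zmax; rewrite inE; apply: subset_closed_ball; near: t.
    by apply: open_nbhs_nbhs; split; [exact: ball_open|rewrite -ball_normE].
  have := elliptic_max_le0 e0 e1 a b c f1 f2 Uz zm.
  rewrite /w ellipticD elliptic_cstM smfD smfM (smf_cstE _ Uz) leNgt.
  by rewrite ltr_wpDl ?mulr_gt0// Lf.
move: wz; rewrite leNgt => /negP; apply; rewrite wE//.
have [s0|s0] := lerP 0 (s z).
  have Cz : C z by [].
  by apply: lt_le_trans (epC z Cz); rewrite ltrD2l gtr_pMr.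
apply: lt_le_trans (fm z Uz); rewrite gtrDl pmulr_rlt0// vE// nmulr_rlt0//.
by move: sz1; rewrite !(smfD, smfM, smf_cstE _ Uz) ?(smf1 Uz).
Unshelve. all: by end_near. Qed.

End Hopf.

(** * Surfaces in R^4 *)

Section InnerProduct.
Context {A : comPzRingType}.
Implicit Types u v w : 'rV[A]_4.

(** Defined over any commutative ring, unlike [dot], so as to apply to vectors of smooth functions;
    [eval_ip] passes to their values. *)
Definition ip u v : A := \sum_i u 0 i * v 0 i.

Lemma ipC u v : ip u v = ip v u.
Proof. by apply: eq_bigr => i _; rewrite mulrC. Qed.

Lemma ipDl u v w : ip (u + v) w = ip u w + ip v w.
Proof. by rewrite -big_split; apply: eq_bigr => i _; rewrite mxE mulrDl. Qed.

Lemma ipZl a u v : ip (a *: u) v = a * ip u v.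
Proof. by rewrite mulr_sumr; apply: eq_bigr => i _; rewrite mxE mulrA. Qed.

Lemma ipDr u v w : ip u (v + w) = ip u v + ip u w.
Proof. by rewrite ipC ipDl ![ip _ u]ipC. Qed.

Lemma ipZr a u v : ip u (a *: v) = a * ip u v.
Proof. by rewrite ipC ipZl ipC. Qed.

Lemma ip_mulmx u v : ip u v = (u *m v^T) 0 0.
Proof. by rewrite mxE; apply: eq_bigr => i _; rewrite mxE. Qed.

Lemma der_ip (E : A -> A) u v : derivation E ->
  E (ip u v) = ip (map_mx E u) v + ip u (map_mx E v).
Proof.
move=> dE; rewrite (der_sum dE) -big_split; apply: eq_bigr => i _.
by rewrite (derM dE) !mxE.
Qed.

Lemma der_mxZ (E : A -> A) a u : derivation E ->
  map_mx E (a *: u) = E a *: u + a *: map_mx E u.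
Proof. by move=> dE; apply/rowP => i; rewrite !mxE (derM dE). Qed.

Lemma der_mxD (E : A -> A) u v : derivation E ->
  map_mx E (u + v) = map_mx E u + map_mx E v.
Proof. by move=> dE; apply/rowP => i; rewrite !mxE (derD dE). Qed.

Let i0 : 'I_4 := inord 0.
Let i1 : 'I_4 := inord 1.
Let i2 : 'I_4 := inord 2.
Let i3 : 'I_4 := inord 3.

Definition det3 (a b c d e f g h i : A) :=
  a * (e * i - f * h) - b * (d * i - f * g) + c * (d * h - e * g).

Definition minor3 u v w (i j k : 'I_4) := det3 (u 0 i) (u 0 j) (u 0 k)
  (v 0 i) (v 0 j) (v 0 k) (w 0 i) (w 0 j) (w 0 k).

(** The vector product of three vectors of a four-dimensional space, by cofactors: it yields the
    unit normal as a polynomial in psi, t1, t2. *)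
Definition cross u v w : 'rV[A]_4 :=
  \row_j nth 0 [:: minor3 u v w i1 i2 i3; - minor3 u v w i0 i2 i3;
                   minor3 u v w i0 i1 i3; - minor3 u v w i0 i1 i2] j.

Lemma ip4E u v : ip u v = u 0 i0 * v 0 i0 + u 0 i1 * v 0 i1
  + u 0 i2 * v 0 i2 + u 0 i3 * v 0 i3.
Proof.
rewrite /ip !big_ord_recl big_ord0 addr0 !addrA.
have -> : ord0 = i0 by apply/val_inj; rewrite /= inordK.
have -> : lift i0 (ord0 : 'I_3) = i1 by apply/val_inj; rewrite /= !inordK.
have -> : lift i0 (lift ord0 (ord0 : 'I_2)) = i2 by apply/val_inj; rewrite /= !inordK.
have -> // : lift i0 (lift ord0 (lift ord0 (ord0 : 'I_1))) = i3.
by apply/val_inj; rewrite /= !inordK.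
Qed.

Lemma cross_ip u v w : [/\ ip (cross u v w) u = 0, ip (cross u v w) v = 0
  & ip (cross u v w) w = 0].
Proof.
rewrite !ip4E !mxE !inordK//= /minor3 /det3.
by split; ring.
Qed.

(** The Cauchy-Binet formula: the right side is the Gram determinant, which is 1 for an orthonormal
    triple. *)
Lemma cross_norm u v w : ip (cross u v w) (cross u v w) =
  det3 (ip u u) (ip u v) (ip u w) (ip v u) (ip v v) (ip v w)
       (ip w u) (ip w v) (ip w w).
Proof.
rewrite !ip4E !mxE !inordK//= /minor3 /det3.
ring.
Qed.

Definition frame_mx u v w n : 'M[A]_4 :=
  \matrix_(i, j) (nth 0 [:: u; v; w; n] i) 0 j.

Lemma frame_mx_mul u v w n u' v' w' n' :
  frame_mx u v w n *m (frame_mx u' v' w' n')^T =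
  mx4 [:: [:: ip u u'; ip u v'; ip u w'; ip u n'];
          [:: ip v u'; ip v v'; ip v w'; ip v n'];
          [:: ip w u'; ip w v'; ip w w'; ip w n'];
          [:: ip n u'; ip n v'; ip n w'; ip n n']].
Proof.
apply/matrixP => i j; rewrite !mxE.
transitivity (ip (nth 0 [:: u; v; w; n] i) (nth 0 [:: u'; v'; w'; n'] j)).
  by apply: eq_bigr => k _; rewrite !mxE.
by case: i => [[|[|[|[|i]]]] //= i4]; case: j => [[|[|[|[|j]]]] //= j4].
Qed.

Lemma map_frame_mx (E : A -> A) u v w n :
  map_mx E (frame_mx u v w n) =
  frame_mx (map_mx E u) (map_mx E v) (map_mx E w) (map_mx E n).
Proof.
apply/matrixP => i j; rewrite !mxE.
by case: i => [[|[|[|[|i]]]] //= i4]; rewrite mxE.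
Qed.

Lemma mx4_1 : mx4 [:: [:: 1; 0; 0; 0]; [:: 0; 1; 0; 0]; [:: 0; 0; 1; 0];
  [:: 0; 0; 0; 1]] = 1%:M :> 'M[A]_4.
Proof.
apply/matrixP => i j; rewrite !mxE.
by case: i => [[|[|[|[|i]]]] //= i4]; case: j => [[|[|[|[|j]]]] //= j4].
Qed.

End InnerProduct.

Section Surface.
Context {R : realType} {V : normedModType R} {U : oset V}.
Local Notation A := (smf U).
Variables (e0 e1 : V) (phi : 'rV[A]_4).

Lemma smf_double_eq0 (f : A) : f + f = 0 -> f = 0.
Proof.
move=> ff; apply: smf_eq => x Ux; rewrite smf0.
by have := congr1 (fun h : A => h x) ff; rewrite /= smfD smf0; lra.
Qed.

Local Notation phi0 := (map_mx (sderive e0) phi).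
Local Notation phi1 := (map_mx (sderive e1) phi).
Local Notation g00 := (ip phi0 phi0).
Local Notation g01 := (ip phi0 phi1).
Local Notation g11 := (ip phi1 phi1).

(** The coefficients of an orthonormal frame in the coordinate fields; the inverses of the diagonal
    ones are data, so that division stays in the ring. The signs of [fa] and [fc] are free, hence so
    is the orientation. *)
Record frame := Frame {
  fa : A; fb : A; fc : A; fa' : A; fc' : A;
  fa_inv : fa * fa' = 1;
  fc_inv : fc * fc' = 1;
  frame11 : fa * fa * g00 = 1;
  frame12 : fa * (fb * g00 + fc * g01) = 0;
  frame22 : fb * fb * g00 + 2 * fb * fc * g01 + fc * fc * g11 = 1
}.

(* Gram-Schmidt on (phi0, phi1). *)
Lemma frame_exists : (forall x, U x -> 0 < g00 x) ->
  (forall x, U x -> 0 < (g00 * g11 - g01 * g01) x) -> inhabited frame.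
Proof.
move=> p0 p1; have [a a2 _] := rsqrt_exists p0.
have [c c2 _] : exists2 r : A, r * r * (g11 - a * a * g01 * g01) = 1
    & forall x, U x -> 0 < r x.
  apply: rsqrt_exists => x Ux; have := p1 x Ux; have := p0 x Ux.
  have := congr1 (fun h : A => h x) a2; rewrite /= (smf1 Ux).
  rewrite !(smfB, smfM) => ax h0 h1.
  have a0 : 0 < a x * a x.
    by rewrite -(pmulr_lgt0 _ h0) ax.
  have -> : g11 x - a x * a x * g01 x * g01 x
      = a x * a x * (g00 x * g11 x - g01 x * g01 x).
    by rewrite mulrBr !mulrA ax mul1r.
  by rewrite mulr_gt0.
constructor; apply: (@Frame a (- c * a * a * g01) c (a * g00)
  (c * (g11 - a * a * g01 * g01))).
- by rewrite mulrA.
- by rewrite mulrA.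
- by [].
- by apply: (eq_comb1 (m := - a * c * g01) a2); ring.
- apply: (eq_comb2 (m := c * c * a * a * g01 * g01) (n := 1) a2 c2); ring.
Qed.

Variable fr : frame.
Definition F1 := field1 e0 e1 (fa fr).
Definition F2 := field2 e0 e1 (fb fr) (fc fr).
Lemma derivation_F1 : derivation F1. Proof. exact: derivation_field1. Qed.
Lemma derivation_F2 : derivation F2. Proof. exact: derivation_field2. Qed.
Let dF1 := derivation_F1.
Let dF2 := derivation_F2.

Definition t1 : 'rV[A]_4 := map_mx F1 phi.
Definition t2 : 'rV[A]_4 := map_mx F2 phi.

Lemma t1E : t1 = fa fr *: phi0.
Proof. by apply/rowP => i; rewrite !mxE /F1 /field1 mul0r addr0. Qed.

Lemma t2E : t2 = fb fr *: phi0 + fc fr *: phi1.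
Proof. by apply/rowP => i; rewrite !mxE. Qed.

Lemma ip11 : ip t1 t1 = 1.
Proof. by rewrite t1E ipZl ipZr mulrA frame11. Qed.

Lemma ip12 : ip t1 t2 = 0.
Proof. by rewrite t1E t2E ipZl ipDr !ipZr frame12. Qed.

Lemma ip22 : ip t2 t2 = 1.
Proof.
rewrite t2E ipDl !ipZl !ipDr !ipZr (ipC phi1 phi0) -[RHS](frame22 fr); ring.
Qed.

Lemma frame_det : fa fr * fa fr * (fc fr * fc fr) * (g00 * g11 - g01 * g01) = 1.
Proof.
have h1 := frame11 fr; have h2 := frame12 fr; have h3 := frame22 fr.
move: (fa fr) (fb fr) (fc fr) h1 h2 h3 => a b c h1 h2 h3.
have h4 : (a * a * g00) * (b * b * g00 + 2 * b * c * g01 + c * c * g11)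
   - (a * (b * g00 + c * g01)) * (a * (b * g00 + c * g01)) = 1.
  by rewrite h1 h2 h3; ring.
by rewrite -[RHS]h4; ring.
Qed.

Definition pp : A := ip (map_mx F1 t1) t2.
Definition qq : A := ip (map_mx F2 t1) t2.

Lemma der_unit (E : A -> A) (u : 'rV[A]_4) : derivation E -> E (ip u u) = 0 ->
  ip (map_mx E u) u = 0.
Proof. by move=> dE; rewrite (der_ip _ _ dE) (ipC u) => /smf_double_eq0. Qed.

Lemma der_ip_swap (E : A -> A) (u v : 'rV[A]_4) : derivation E -> E (ip u v) = 0 ->
  ip (map_mx E u) v = - ip (map_mx E v) u.
Proof.
move=> dE; rewrite (der_ip _ _ dE) => /eqP; rewrite addr_eq0 => /eqP ->.
by rewrite ipC.
Qed.

(** The Laplace-Beltrami operator in the frame: the covariant derivative of F1 along F1 is pp F2,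
    that of F2 along F2 is - qq F1. *)
Definition lap : A -> A := elliptic e0 e1 (fa fr) (fb fr) (fc fr) qq (- pp).

Lemma lapE f : lap f = F1 (F1 f) + F2 (F2 f) - pp * F2 f + qq * F1 f.
Proof. by rewrite /lap /elliptic mulNr addrAC. Qed.

Lemma map_lapE : map_mx lap phi =
  map_mx F1 t1 + map_mx F2 t2 + (- pp) *: t2 + qq *: t1.
Proof. by apply/rowP => i; rewrite !mxE lapE mulNr. Qed.

(** The constant is 2 (|t1|^2 + |t2|^2). *)
Lemma lap_sqnorm : lap (ip phi phi) = 4 + 2 * ip (map_mx lap phi) phi.
Proof.
have f1 : F1 (ip phi phi) = 2 * ip t1 phi.
  by rewrite (der_ip _ _ dF1) (ipC phi) mulrDl !mul1r.
have f2 : F2 (ip phi phi) = 2 * ip t2 phi.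
  by rewrite (der_ip _ _ dF2) (ipC phi) mulrDl !mul1r.
rewrite lapE f1 f2 (derM dF1) (derM dF2) (der_nat dF1) (der_nat dF2).
rewrite (der_ip _ _ dF1) (der_ip _ _ dF2) -/t1 -/t2 ip11 ip22.
rewrite map_lapE !ipDl !ipZl; ring.
Qed.

(** The first order terms of [lap] cancel the tangential parts of F1 t1 + F2 t2; the Laplacian of
    the position is thus normal, which makes it the mean curvature vector. *)
Lemma lap_phi_ip : ip (map_mx lap phi) t1 = 0 /\ ip (map_mx lap phi) t2 = 0.
Proof.
have u1 : ip (map_mx F1 t1) t1 = 0 by apply: der_unit; rewrite // ip11 (der1 dF1).
have u2 : ip (map_mx F2 t2) t2 = 0 by apply: der_unit; rewrite // ip22 (der1 dF2).
have u3 : ip (map_mx F2 t2) t1 = - qq.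
  by rewrite /qq -der_ip_swap// ipC ip12 (der0 dF2).
rewrite map_lapE !ipDl !ipZl u1 u2 u3 -/pp (ipC t2 t1) ip11 ip12 ip22.
by split; ring.
Qed.

(** * Minimal surfaces of a round three-sphere *)

Section Sphere.
Variables (kap rad : R).
Hypothesis kr : kap * rad = 1.
Let k := smf_cst U kap.
Let k' := smf_cst U rad.
Hypothesis sphere : k * k * ip phi phi = 1.
Hypothesis minimal : map_mx lap phi = (- 2 * (k * k)) *: phi.

Let kk' : k * k' = 1.
Proof. by apply: smf_eq => x Ux; rewrite smfM !(smf_cstE _ Ux). Qed.

Definition psi : 'rV[A]_4 := smf_cst U kap *: phi.
Definition nu : 'rV[A]_4 := cross psi t1 t2.
Definition FF : 'M[A]_4 := frame_mx psi t1 t2 nu.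
Definition al : A := ip (map_mx F1 t1) nu.
Definition be : A := ip (map_mx F1 t2) nu.
Definition be' : A := ip (map_mx F2 t1) nu.
Definition uu : A := al ^+ 2 + be ^+ 2.

Let F1k : F1 k = 0. Proof. exact: field1_cst. Qed.
Let F2k : F2 k = 0. Proof. exact: field2_cst. Qed.
Let F1k' : F1 k' = 0. Proof. exact: field1_cst. Qed.
Let F2k' : F2 k' = 0. Proof. exact: field2_cst. Qed.

Let F1psi : map_mx F1 psi = k *: t1.
Proof. by rewrite /psi (der_mxZ _ _ dF1) F1k scale0r add0r. Qed.
Let F2psi : map_mx F2 psi = k *: t2.
Proof. by rewrite /psi (der_mxZ _ _ dF2) F2k scale0r add0r. Qed.

Lemma psi_psi : ip psi psi = 1.
Proof. by rewrite /psi ipZl ipZr mulrA. Qed.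

Lemma kap_inj x : k * x = 0 -> x = 0.
Proof. by move=> kx; rewrite -[x]mul1r -kk' mulrAC kx mul0r. Qed.

Lemma psi_t1 : ip psi t1 = 0.
Proof.
apply: kap_inj; rewrite -ipZr -F1psi ipC; apply: der_unit => //.
by rewrite psi_psi (der1 dF1).
Qed.

Lemma psi_t2 : ip psi t2 = 0.
Proof.
apply: kap_inj; rewrite -ipZr -F2psi ipC; apply: der_unit => //.
by rewrite psi_psi (der1 dF2).
Qed.

Lemma nu_psi : ip nu psi = 0. Proof. by have [] := cross_ip psi t1 t2. Qed.
Lemma nu_t1 : ip nu t1 = 0. Proof. by have [] := cross_ip psi t1 t2. Qed.
Lemma nu_t2 : ip nu t2 = 0. Proof. by have [] := cross_ip psi t1 t2. Qed.
Lemma nu_nu : ip nu nu = 1.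
Proof.
rewrite cross_norm psi_psi psi_t1 psi_t2 ip11 ip12 ip22 (ipC t1) (ipC t2 psi) (ipC t2 t1).
by rewrite psi_t1 psi_t2 ip12 /det3; ring.
Qed.

Lemma FF_orth : FF *m FF^T = 1%:M.
Proof.
rewrite frame_mx_mul psi_psi psi_t1 psi_t2 ip11 ip12 ip22 nu_nu nu_psi nu_t1 nu_t2.
rewrite (ipC t1 psi) (ipC t2 psi) (ipC t2 t1) (ipC psi nu) (ipC t1 nu) (ipC t2 nu).
by rewrite psi_t1 psi_t2 ip12 nu_psi nu_t1 nu_t2 mx4_1.
Qed.

Lemma FF_orth' : FF^T *m FF = 1%:M.
Proof. exact/mulmx1C/FF_orth. Qed.

Lemma conn1E : connection FF F1 =
  mx4 [:: [:: 0; k; 0; 0]; [:: - k; 0; pp; al]; [:: 0; - pp; 0; be];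
          [:: 0; - al; - be; 0]].
Proof.
rewrite /connection map_frame_mx frame_mx_mul F1psi !ipZl.
rewrite (ipC t1 psi) psi_t1 ip11 ip12 (ipC t1 nu) nu_t1.
have u1 : ip (map_mx F1 t1) t1 = 0 by apply: der_unit; rewrite // ip11 (der1 dF1).
have u2 : ip (map_mx F1 t2) t2 = 0 by apply: der_unit; rewrite // ip22 (der1 dF1).
have un : ip (map_mx F1 nu) nu = 0 by apply: der_unit; rewrite // nu_nu (der1 dF1).
rewrite u1 u2 un.
rewrite (der_ip_swap (u := t1) (v := psi)) ?(ipC t1 psi) ?psi_t1 ?(der0 dF1)//.
rewrite (der_ip_swap (u := t2) (v := psi)) ?(ipC t2 psi) ?psi_t2 ?(der0 dF1)//.
rewrite (der_ip_swap (u := t2) (v := t1)) ?(ipC t2 t1) ?ip12 ?(der0 dF1)//.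
rewrite (der_ip_swap (u := nu) (v := psi)) ?nu_psi ?(der0 dF1)//.
rewrite (der_ip_swap (u := nu) (v := t1)) ?nu_t1 ?(der0 dF1)//.
rewrite (der_ip_swap (u := nu) (v := t2)) ?nu_t2 ?(der0 dF1)//.
by rewrite F1psi !ipZl ip11 ip12 (ipC t1 nu) nu_t1 !mulr0 mulr1 oppr0.
Qed.

(** The nu component of minimality: phi is orthogonal to nu, so the second fundamental form has
    trace zero. *)
Lemma F2t2_nu : ip (map_mx F2 t2) nu = - al.
Proof.
have := congr1 (ip^~ nu) minimal; rewrite /= map_lapE !ipDl !ipZl.
rewrite (ipC t2 nu) nu_t2 (ipC t1 nu) nu_t1 !mulr0 !addr0 -/al.
have -> : ip phi nu = 0.
  by apply: kap_inj; rewrite -ipZl -/psi ipC nu_psi.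
by rewrite mulr0 addrC => /eqP; rewrite addr_eq0 => /eqP.
Qed.

Lemma conn2E : connection FF F2 =
  mx4 [:: [:: 0; 0; k; 0]; [:: 0; 0; qq; be']; [:: - k; - qq; 0; - al];
          [:: 0; - be'; al; 0]].
Proof.
rewrite /connection map_frame_mx frame_mx_mul F2psi !ipZl F2t2_nu.
rewrite (ipC t2 psi) (ipC t2 t1) psi_t2 ip12 ip22 (ipC t2 nu) nu_t2.
have u1 : ip (map_mx F2 t1) t1 = 0 by apply: der_unit; rewrite // ip11 (der1 dF2).
have u2 : ip (map_mx F2 t2) t2 = 0 by apply: der_unit; rewrite // ip22 (der1 dF2).
have un : ip (map_mx F2 nu) nu = 0 by apply: der_unit; rewrite // nu_nu (der1 dF2).
rewrite u1 u2 un.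
rewrite (der_ip_swap (u := t1) (v := psi)) ?(ipC t1 psi) ?psi_t1 ?(der0 dF2)//.
rewrite (der_ip_swap (u := t2) (v := psi)) ?(ipC t2 psi) ?psi_t2 ?(der0 dF2)//.
rewrite (der_ip_swap (u := t2) (v := t1)) ?(ipC t2 t1) ?ip12 ?(der0 dF2)//.
rewrite (der_ip_swap (u := nu) (v := psi)) ?nu_psi ?(der0 dF2)//.
rewrite (der_ip_swap (u := nu) (v := t1)) ?nu_t1 ?(der0 dF2)//.
rewrite (der_ip_swap (u := nu) (v := t2)) ?nu_t2 ?(der0 dF2)//.
rewrite F2t2_nu F2psi !ipZl (ipC t2 t1) ip22 ip12 (ipC t2 nu) nu_t2.
by rewrite !mulr0 mulr1 oppr0 opprK.
Qed.

Let brk : exists c1 c2 : A, forall f, F1 (F2 f) - F2 (F1 f) = c1 * F1 f + c2 * F2 f.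
Proof. exact: (field_bracket e0 e1 (fb fr) (fa_inv fr) (fc_inv fr)). Qed.

Lemma betaE : be' = be.
Proof.
have [c1 [c2 comm]] := brk.
by have [] := frame_bracket dF1 dF2 FF_orth FF_orth' comm kk' F1k F2k conn1E conn2E.
Qed.

Let x := F1 al - 2 * pp * be.
Let y := F1 be + 2 * pp * al.

Lemma simons_sphere :
  [/\ F1 uu = 2 * (al * x + be * y), F2 uu = 2 * (al * y - be * x) &
     lap uu = 4 * (x ^+ 2 + y ^+ 2) + 4 * (k ^+ 2 - uu) * uu].
Proof.
have [c1 [c2 comm]] := brk; rewrite lapE.
exact: (simons dF1 dF2 FF_orth FF_orth' comm kk' F1k F2k conn1E conn2E).
Qed.

Definition torus_tensor : 'M[A]_4 :=
  FF^T *m torus_mx (smf_cst U rad) al be *m FF.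

Lemma torus_tensor_cst : uu = k ^+ 2 -> x = 0 -> y = 0 ->
  map_mx F1 torus_tensor = 0 /\ map_mx F2 torus_tensor = 0.
Proof.
have [c1 [c2 comm]] := brk => uE x0 y0.
exact: (torus_tensor_parallel dF1 dF2 FF_orth FF_orth' comm kk' F1k F2k conn1E conn2E
  F1k' F2k').
Qed.

End Sphere.
End Surface.

Lemma ord2_ind (P : 'I_2 -> Prop) : P 0 -> P 1 -> forall i, P i.
Proof.
move=> P0 P1 [[|[|i]]] //= i2.
  by rewrite (_ : Ordinal i2 = 0)//; exact/val_inj.
by rewrite (_ : Ordinal i2 = 1)//; exact/val_inj.
Qed.

Lemma sum_ord2 (A : nmodType) (F : 'I_2 -> A) : \sum_i F i = F 0 + F 1.
Proof.
rewrite !big_ord_recl big_ord0 addr0; congr (F _ + F _); exact/val_inj.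
Qed.

Lemma eval_mulmx (R : realType) (V : normedModType R) (U : oset V) m n p
    (X : 'M[smf U]_(m, n)) (Y : 'M[smf U]_(n, p)) (x : V) :
  map_mx (fun f : smf U => f x) (X *m Y) =
  map_mx (fun f : smf U => f x) X *m map_mx (fun f : smf U => f x) Y.
Proof.
apply/matrixP => i j; rewrite !mxE smf_sum; apply: eq_bigr => k _.
by rewrite smfM !mxE.
Qed.

Lemma eval_mx1 (R : realType) (V : normedModType R) (U : oset V) n (x : V) : U x ->
  map_mx (fun f : smf U => f x) (1%:M : 'M[smf U]_n) = 1%:M.
Proof.
move=> Ux; apply/matrixP => i j; rewrite !mxE.
by case: (i == j); rewrite ?mulr1n ?mulr0n ?(smf1 Ux)// smf0.
Qed.

(** * The Gauss equation in coordinates *)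

Section GaussEquation.
Context {R : realType} {V : normedModType R} {U : oset V}.
Local Notation A := (smf U).
Variables (e : 'I_2 -> V) (phi : 'rV[A]_4) (fr : frame (e 0) (e 1) phi).

Local Notation D i := (@sderive R V U (e i)).
Definition dphi (i : 'I_2) : 'rV[A]_4 := map_mx (D i) phi.
Definition ddphi (i j : 'I_2) : 'rV[A]_4 := map_mx (D i) (dphi j).
Definition gram (i j : 'I_2) : A := ip (dphi i) (dphi j).
Definition frame2 (i j : 'I_2) : A :=
  nth 0 (nth [::] [:: [:: fa fr; 0]; [:: fb fr; fc fr]] i) j.
(** If C G C^T = 1 then G^-1 = C^T C: the frame provides the inverse metric inside the ring of
    smooth functions. *)
Definition gram_inv (i j : 'I_2) : A := \sum_m frame2 m i * frame2 m j.
(* The Christoffel symbols, as the tangential part of the second derivatives. *)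
Definition gamma (k i j : 'I_2) : A :=
  \sum_m gram_inv k m * ip (ddphi i j) (dphi m).

Let dD i : derivation (D i) := derivation_sderive _.

Lemma gramC i j : gram i j = gram j i. Proof. exact: ipC. Qed.

Lemma ddphiC i j : ddphi i j = ddphi j i.
Proof. by apply/rowP => l; rewrite !mxE sderiveC. Qed.

Lemma frame2_orth :
  (\matrix_(i, j) frame2 i j) *m (\matrix_(i, j) gram i j)
     *m (\matrix_(i, j) frame2 i j)^T = 1%:M.
Proof.
have h1 := frame11 fr; have h2 := frame12 fr; have h3 := frame22 fr.
apply/matrixP => i j; rewrite !mxE sum_ord2 !mxE !sum_ord2 !mxE (gramC 1 0).
rewrite -/(gram 0 0) -/(gram 0 1) -/(gram 1 1) in h1 h2 h3.
case: i => [[|[|i]]] //= i2; case: j => [[|[|j]]] //= j2; rewrite /frame2 /=.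
- by rewrite -[RHS]h1; ring.
- by rewrite -[RHS]h2; ring.
- by rewrite -[RHS]h2; ring.
- by rewrite -[RHS]h3; ring.
Qed.

Lemma gram_mul_inv :
  (\matrix_(i, j) gram i j) *m (\matrix_(i, j) gram_inv i j) = 1%:M.
Proof.
have -> : \matrix_(i, j) gram_inv i j =
    (\matrix_(i, j) frame2 i j)^T *m \matrix_(i, j) frame2 i j.
  by apply/matrixP => i j; rewrite !mxE; apply: eq_bigr => m _; rewrite !mxE.
by rewrite mulmxA; apply: mulmx1C; rewrite mulmxA frame2_orth.
Qed.

Lemma gram_inv_mul i j : \sum_l gram_inv i l * gram l j = (i == j)%:R.
Proof.
have /mulmx1C /matrixP /(_ i j) := gram_mul_inv; rewrite !mxE => <-.
by apply: eq_bigr => l _; rewrite !mxE.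
Qed.

Lemma der_gram i j k : D i (gram j k) = ip (ddphi i j) (dphi k) + ip (ddphi i k) (dphi j).
Proof. by rewrite (der_ip _ _ (dD i)) (ipC (dphi j)). Qed.

Lemma gram_invC i j : gram_inv i j = gram_inv j i.
Proof. by apply: eq_bigr => m _; rewrite mulrC. Qed.

Lemma gamma_low i j m : \sum_k gamma k i j * gram k m = ip (ddphi i j) (dphi m).
Proof.
have h0 := gram_inv_mul 0 m; have h1 := gram_inv_mul 1 m.
rewrite !sum_ord2 in h0 h1; rewrite sum_ord2 /gamma !sum_ord2.
rewrite (gram_invC 1 0) in h1 *.
transitivity (ip (ddphi i j) (dphi 0) * (0 == m)%:R + ip (ddphi i j) (dphi 1) * (1 == m)%:R).
  by rewrite -h0 -h1; ring.
case: m {h0 h1} => [[|[|m]]] //= m2; rewrite ?mulr1 ?mulr0 ?addr0 ?add0r.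
  by congr ip; congr dphi; exact/val_inj.
by congr ip; congr dphi; exact/val_inj.
Qed.

(** The numerator of [gauss_curvature_coord], with the Christoffel symbols in the form [gamma]. *)
Definition curv_lower : A :=
  \sum_l (D 0 (gamma l 1 1) - D 1 (gamma l 0 1)
    + \sum_s (gamma l 0 s * gamma s 1 1 - gamma l 1 s * gamma s 0 1)) * gram l 0.

(** The inner product of the normal parts of v and w. *)
Definition nip (v w : 'rV[A]_4) : A :=
  ip v w - \sum_i \sum_j gram_inv i j * (ip v (dphi i) * ip w (dphi j)).

(** Differentiating the lowered symbols [gamma_low] brings out third derivatives of phi, which are
    the same in both terms and cancel; what remains are products of second derivatives minus their
    tangential parts. *)
Lemma gauss_equation :
  curv_lower = nip (ddphi 1 1) (ddphi 0 0) - nip (ddphi 0 1) (ddphi 1 0).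
Proof.
have eqA : D 0 (\sum_k gamma k 1 1 * gram k 0) = D 0 (ip (ddphi 1 1) (dphi 0)).
  by rewrite gamma_low.
have eqB : D 1 (\sum_k gamma k 0 1 * gram k 0) = D 1 (ip (ddphi 0 1) (dphi 0)).
  by rewrite gamma_low.
have third : map_mx (D 0) (ddphi 1 1) = map_mx (D 1) (ddphi 0 1).
  by apply/rowP => l; rewrite !mxE sderiveC.
move: eqA eqB; rewrite (der_ip _ _ (dD 0)) (der_ip _ _ (dD 1)) third.
move: (ip (map_mx (D 1) (ddphi 0 1)) (dphi 0)) => T.
rewrite -/(ddphi 0 0) -/(ddphi 1 0) !sum_ord2.
rewrite !(derD (dD 0), derD (dD 1), derM (dD 0), derM (dD 1)) !der_gram.
have l (i j m : 'I_2) := gamma_low i j m; move: l.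
rewrite (ddphiC 1 0) => l.
have g (i j k : 'I_2) : gamma k i j = \sum_m gram_inv k m * ip (ddphi i j) (dphi m) by [].
rewrite /curv_lower /nip !sum_ord2.
have l000 := l 0 0 0; have l001 := l 0 0 1; have l010 := l 0 1 0; have l011 := l 0 1 1.
have l110 := l 1 1 0; have l111 := l 1 1 1.
have g0 := g 1 1 0; have g1 := g 1 1 1; have g2 := g 0 1 0; have g3 := g 0 1 1.
have gs k : gamma k 1 0 = gamma k 0 1 by rewrite /gamma ddphiC.
rewrite !sum_ord2 in l000 l001 l010 l011 l110 l111 g0 g1 g2 g3.
rewrite !gs (gramC 1 0) (gram_invC 1 0) in l000 l001 l010 l011 l110 l111 g1 g3 *.
move: (D 0 (gamma 0 1 1)) (D 0 (gamma 1 1 1)) (D 1 (gamma 0 0 1)) (D 1 (gamma 1 0 1)).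
move=> z0 z1 z2 z3 eqA eqB.
pose n1 := gamma 0 1 1 * ip (ddphi 0 0) (dphi 0) + gamma 1 1 1 * ip (ddphi 0 0) (dphi 1).
pose n2 := gamma 0 0 1 * ip (ddphi 0 1) (dphi 0) + gamma 1 0 1 * ip (ddphi 0 1) (dphi 1).
transitivity ((ip (ddphi 1 1) (ddphi 0 0) - n1) - (ip (ddphi 0 1) (ddphi 0 1) - n2)).
  rewrite /n1 /n2; move: eqA eqB; rewrite -l000 -l001 -l010 -l011 -l110 => eqA eqB.
  by apply: (eq_comb2 (m := 1) (n := -1) eqA eqB); ring.
by rewrite /n1 /n2 g0 g1 g2 g3; ring.
Qed.

Lemma t1_dphi : t1 fr = fa fr *: dphi 0. Proof. exact: t1E. Qed.
Lemma t2_dphi : t2 fr = fb fr *: dphi 0 + fc fr *: dphi 1. Proof. exact: t2E. Qed.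

Lemma nipE v w : nip v w = ip v w - ip v (t1 fr) * ip w (t1 fr) - ip v (t2 fr) * ip w (t2 fr).
Proof.
rewrite t1_dphi t2_dphi !(ipDr, ipZr) /nip !sum_ord2 /gram_inv !sum_ord2 /frame2 /=.
ring.
Qed.

Section GaussSphere.
Variables (kap rad : R).
Hypothesis kr : kap * rad = 1.
Let k := smf_cst U kap.
Hypothesis sphere : k * k * ip phi phi = 1.
Hypothesis minimal : map_mx (lap fr) phi = (- 2 * (k * k)) *: phi.

Local Notation psi := (psi phi kap).
Local Notation nu := (nu fr kap).

Lemma frame_complete v w : ip v w = ip v psi * ip w psi
  + ip v (t1 fr) * ip w (t1 fr) + ip v (t2 fr) * ip w (t2 fr) + ip v nu * ip w nu.
Proof.
have E (z : 'rV[A]_4) (i : 'I_4) : (z *m (FF fr kap)^T) 0 i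
    = nth 0 [:: ip z psi; ip z (t1 fr); ip z (t2 fr); ip z nu] i.
  transitivity (ip z (nth 0 [:: psi; t1 fr; t2 fr; nu] i)).
    by rewrite mxE; apply: eq_bigr => l _; rewrite !mxE.
  by case: i => [[|[|[|[|i]]]] //= i4].
transitivity (ip (v *m (FF fr kap)^T) (w *m (FF fr kap)^T)).
  rewrite [RHS]ip_mulmx trmx_mul trmxK mulmxA -(mulmxA v).
  by rewrite (FF_orth' fr kr sphere) mulmx1 ip_mulmx.
by rewrite ip4E !E !inordK.
Qed.

Lemma nip_frame v w : nip v w = ip v psi * ip w psi + ip v nu * ip w nu.
Proof. by rewrite nipE [ip v w]frame_complete; ring. Qed.

Let dphi_phi i : ip (dphi i) phi = 0.
Proof.
have := congr1 (D i) sphere; rewrite !(derM (dD i)) !sderive_cst.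
rewrite (der_ip _ _ (dD i)) (ipC phi) !(mulr0, mul0r, add0r, addr0) -mulrA.
by move=> /(kap_inj kr) /(kap_inj kr) /smf_double_eq0.
Qed.

Lemma dphi_psi i : ip (dphi i) psi = 0.
Proof. by rewrite /psi ipZr dphi_phi mulr0. Qed.

Lemma ddphi_psi i j : ip (ddphi i j) psi = - (k * gram i j).
Proof.
have := congr1 (D i) (dphi_psi j); rewrite (der_ip _ _ (dD i)) (der0 (dD i)).
rewrite /psi (der_mxZ _ _ (dD i)) sderive_cst scale0r add0r !ipZr.
by move/eqP; rewrite addr_eq0 -/(dphi i) (ipC (dphi j)) => /eqP ->.
Qed.

Lemma dphi_nu i : ip (dphi i) nu = 0.
Proof.
have h1 := nu_t1 fr kap; have h2 := nu_t2 fr kap.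
have d0 : ip (dphi 0) nu = 0.
  rewrite t1_dphi ipC ipZl in h1.
  by rewrite -[LHS]mul1r -(fa_inv fr) mulrAC h1 mul0r.
elim/ord2_ind: i => //.
rewrite t2_dphi ipC ipDl !ipZl d0 mulr0 add0r in h2.
by rewrite -[LHS]mul1r -(fc_inv fr) mulrAC h2 mul0r.
Qed.

Let h (i j : 'I_2) := ip (ddphi i j) nu.

Let a := fa fr.
Let b := fb fr.
Let c := fc fr.

Let F1dphi i : map_mx (F1 fr) (dphi i) = a *: ddphi 0 i.
Proof. by apply/rowP => l; rewrite !mxE /F1 /field1 mul0r addr0. Qed.

Let F2dphi i : map_mx (F2 fr) (dphi i) = b *: ddphi 0 i + c *: ddphi 1 i.
Proof. by apply/rowP => l; rewrite !mxE. Qed.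

Lemma second_form_frame :
  [/\ al fr kap = a * a * h 0 0, be' fr kap = a * (b * h 0 0 + c * h 0 1)
    & - al fr kap = b * b * h 0 0 + 2 * b * c * h 0 1 + c * c * h 1 1].
Proof.
have dF1 := derivation_F1 fr; have dF2 := derivation_F2 fr.
rewrite -(F2t2_nu kr minimal) /al /be' t1_dphi t2_dphi (der_mxD _ _ dF2).
rewrite !(der_mxZ _ _ dF1) !(der_mxZ _ _ dF2) !F1dphi !F2dphi (ddphiC 1 0).
rewrite !(ipDl, ipZl) !dphi_nu -!/(h _ _) /a /b /c.
by split; ring.
Qed.

(** The psi components of the second derivatives contribute k^2 times the determinant of the metric,
    the nu components the determinant of h, which is - u times the determinant of the metric. *)
Lemma curvature_sphere :
  curv_lower = (k ^+ 2 - uu fr kap) * (gram 0 0 * gram 1 1 - gram 0 1 * gram 0 1).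
Proof.
have [hal hbe hga] := second_form_frame.
have det := frame_det fr; rewrite -/(gram 0 0) -/(gram 0 1) -/(gram 1 1) -/a -/c in det.
rewrite gauss_equation !nip_frame !ddphi_psi -!/(h _ _).
have -> : h 1 0 = h 0 1 by rewrite /h ddphiC.
rewrite (gramC 1 0) /uu -(betaE kr sphere minimal).
(* One factor al is traded for minus the (t2, t2) entry - al, which turns u into minus a determinant
   of the second fundamental form. *)
have -> : al fr kap ^+ 2 + be' fr kap ^+ 2
    = - (a * a * (c * c)) * (h 0 0 * h 1 1 - h 0 1 * h 0 1).
  rewrite expr2 -{1}[al fr kap]opprK {1}hga hal hbe; ring.
apply: (eq_comb1 (m := - (h 0 0 * h 1 1 - h 0 1 * h 0 1)) det); ring.
Qed.

End GaussSphere.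
End GaussEquation.

(** * The mean curvature vector as the Laplacian of the position *)

Section MeanCurvature.
Context {R : realType} {V : normedModType R} {U : oset V}.
Local Notation A := (smf U).
Variables (e : 'I_2 -> V) (phi : 'rV[A]_4) (fr : frame (e 0) (e 1) phi).
Local Notation dphi := (dphi e phi).
Local Notation ddphi := (ddphi e phi).

Definition nproj (v : 'rV[A]_4) : 'rV[A]_4 :=
  v - ip v (t1 fr) *: t1 fr - ip v (t2 fr) *: t2 fr.

Lemma nprojD v w : nproj (v + w) = nproj v + nproj w.
Proof.
rewrite /nproj !ipDl; move: (t1 fr) (t2 fr) => w1 w2.
by apply/rowP => i; rewrite !mxE; ring.
Qed.

Lemma nprojZ a v : nproj (a *: v) = a *: nproj v.
Proof.
rewrite /nproj !ipZl; move: (t1 fr) (t2 fr) => w1 w2.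
by apply/rowP => i; rewrite !mxE; ring.
Qed.

Lemma nproj_t1 : nproj (t1 fr) = 0.
Proof. by rewrite /nproj ip11 ip12 scale1r scale0r subrr subr0. Qed.

Lemma nproj_t2 : nproj (t2 fr) = 0.
Proof. by rewrite /nproj (ipC (t2 fr)) ip22 ip12 scale1r scale0r subr0 subrr. Qed.

Lemma nproj_dphi i : nproj (dphi i) = 0.
Proof.
have h1 := nproj_t1; have h2 := nproj_t2.
have d0 : nproj (dphi 0) = 0.
  rewrite t1_dphi nprojZ in h1.
  by rewrite -[LHS]scale1r -(fa_inv fr) mulrC -scalerA h1 scaler0.
elim/ord2_ind: i => //.
rewrite t2_dphi nprojD !nprojZ d0 scaler0 add0r in h2.
by rewrite -[LHS]scale1r -(fc_inv fr) mulrC -scalerA h2 scaler0.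
Qed.

(** The Laplacian is normal, so it may be projected; the projection kills all first derivatives of
    phi, and the second derivatives are left with the coefficients of C^T C, the inverse metric. *)
Lemma lap_mean_curvature :
  map_mx (lap fr) phi = \sum_i \sum_j gram_inv fr i j *: nproj (ddphi i j).
Proof.
have dF1 := derivation_F1 fr; have dF2 := derivation_F2 fr.
have [i1 i2] := lap_phi_ip fr.
have {i1 i2} -> : map_mx (lap fr) phi = nproj (map_mx (lap fr) phi).
  by rewrite /nproj i1 i2 !scale0r !subr0.
rewrite map_lapE !nprojD !nprojZ nproj_t1 nproj_t2 !scaler0 !addr0.
have F1dphi i : map_mx (F1 fr) (dphi i) = fa fr *: ddphi 0 i.
  by apply/rowP => l; rewrite !mxE /F1 /field1 mul0r addr0.
have F2dphi i : map_mx (F2 fr) (dphi i) = fb fr *: ddphi 0 i + fc fr *: ddphi 1 i.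
  by apply/rowP => l; rewrite !mxE.
have n1 : nproj (map_mx (F1 fr) (t1 fr)) = (fa fr * fa fr) *: nproj (ddphi 0 0).
  rewrite t1_dphi (der_mxZ _ _ dF1) F1dphi scalerA nprojD 2!nprojZ.
  by rewrite (nproj_dphi 0) scaler0 add0r.
have n2 : nproj (map_mx (F2 fr) (t2 fr)) = (fb fr * fb fr) *: nproj (ddphi 0 0)
    + (2 * fb fr * fc fr) *: nproj (ddphi 0 1) + (fc fr * fc fr) *: nproj (ddphi 1 1).
  rewrite t2_dphi (der_mxD _ _ dF2) 2!(der_mxZ _ _ dF2) 2!F2dphi (ddphiC e phi 1 0).
  have nD := nprojD; have nZ := nprojZ; have nd0 := nproj_dphi 0; have nd1 := nproj_dphi 1.
  move: nproj (dphi 0) (dphi 1) (ddphi 0 0) (ddphi 0 1) (ddphi 1 1) nD nZ nd0 nd1.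
  move=> N d0 d1 d00 d01 d11 nD nZ nd0 nd1.
  rewrite !(nD, nZ) nd0 nd1 !scaler0 !add0r.
  move: (N d00) (N d01) (N d11) => m00 m01 m11; apply/rowP => l; rewrite !mxE.
  ring.
rewrite n1 n2 !sum_ord2 (ddphiC e phi 1 0) /gram_inv !sum_ord2 /frame2 /=.
move: (nproj (ddphi 0 0)) (nproj (ddphi 0 1)) (nproj (ddphi 1 1)) => m00 m01 m11.
apply/rowP => l; rewrite !mxE.
ring.
Qed.

End MeanCurvature.

(** * From pointwise coordinate expressions to the ring of smooth functions *)

Section PlaneCoordinates.
Context {R : realType} (U : oset 'rV[R]_2).
Variables (P : 'rV[R]_2 -> 'rV[R]_4) (sP : smooth_on U P).
Local Notation A := (smf U).

Definition bvec (i : 'I_2) : 'rV[R]_2 := delta_mx 0 i.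

Lemma comp_smooth j : smooth_on U (fun x => P x 0 j).
Proof. by move=> k; apply: Ck_on_coord; [exact: oset_open|exact: sP]. Qed.

Definition pcoord : 'rV[A]_4 := \row_j mk_smf (comp_smooth j).

Lemma pcoordE x j : U x -> pcoord 0 j x = P x 0 j.
Proof. by move=> Ux; rewrite mxE mk_smfE. Qed.

Let nbhsU x : U x -> nbhs x U.
Proof. by move=> Ux; apply: open_nbhs_nbhs; split => //; exact: oset_open. Qed.

Lemma partial_pcoord i x j : U x -> partial i P x 0 j = dphi bvec pcoord i 0 j x.
Proof.
move=> Ux; rewrite /dphi mxE sderiveE// /partial derive_mx; last first.
  by apply: diff_derivable; exact: (sP 1).1.
rewrite mxE; apply: near_eq_derive; near=> y; rewrite pcoordE//; near: y.
exact: nbhsU.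
Unshelve. all: by end_near. Qed.

Lemma jacobian_pcoord i x j : U x -> 'J P x i j = dphi bvec pcoord i 0 j x.
Proof.
move=> Ux; rewrite -partial_pcoord// /partial deriveEjacobian; last exact: (sP 1).1.
by rewrite -rowE [RHS]mxE.
Qed.

Lemma partial2_pcoord i j x l : U x ->
  partial i (partial j P) x 0 l = ddphi bvec pcoord i j 0 l x.
Proof.
move=> Ux; rewrite /ddphi mxE sderiveE// {1}/partial derive_mx; last first.
  by apply: diff_derivable; exact: ((sP 2).2 _).1.
rewrite mxE; apply: near_eq_derive; near=> y; rewrite partial_pcoord//; near: y.
exact: nbhsU.
Unshelve. all: by end_near. Qed.

Variables (G : 'rV[R]_2 -> 'M[R]_2).
Hypothesis GE : forall x, U x -> G x = 'J P x *m ('J P x)^T.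
Hypothesis Gpos : forall x, U x -> forall v : 'rV[R]_2, v != 0 ->
  0 < (v *m G x *m v^T) 0 0.

Lemma metric_gram x i j : U x -> G x i j = gram bvec pcoord i j x.
Proof.
move=> Ux; rewrite GE// mxE /gram /ip smf_sum; apply: eq_bigr => l _.
by rewrite [X in _ * X]mxE smfM !jacobian_pcoord.
Qed.

Lemma quad_form2 (X : 'M[R]_2) (v : 'rV[R]_2) : (v *m X *m v^T) 0 0 =
  v 0 0 * v 0 0 * X 0 0 + v 0 0 * v 0 1 * (X 0 1 + X 1 0) + v 0 1 * v 0 1 * X 1 1.
Proof. by rewrite mxE sum_ord2 !mxE !sum_ord2; ring. Qed.

Lemma pcoord_frame : inhabited (frame (bvec 0) (bvec 1) pcoord).
Proof.
have g00 x : U x -> 0 < gram bvec pcoord 0 0 x.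
  move=> Ux; rewrite -metric_gram//.
  have := Gpos Ux (v := delta_mx 0 0); rewrite quad_form2 !mxE /=.
  rewrite !mulr1 !mulr0 !mul0r !addr0 !mul1r; apply.
  apply/negP => /eqP /matrixP /(_ 0 0); rewrite !mxE /= => /eqP.
  by rewrite oner_eq0.
apply: frame_exists => // x Ux; rewrite smfB !smfM.
rewrite -/(gram bvec pcoord 0 0) -/(gram bvec pcoord 0 1) -/(gram bvec pcoord 1 1).
(* The quadratic form at (- g01, g00) is g00 (g00 g11 - g01^2). *)
have p0 := g00 x Ux; pose v : 'rV[R]_2 := \row_j (if j == 0 then - gram bvec pcoord 0 1 x
  else gram bvec pcoord 0 0 x).
have v0 : v != 0.
  apply/negP => /eqP /matrixP /(_ 0 1); rewrite !mxE /= => h0.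
  by rewrite h0 ltxx in p0.
have := Gpos Ux v0; rewrite quad_form2 !metric_gram// !mxE /= (gramC _ _ 1 0).
move: (gram bvec pcoord 0 0 x) (gram bvec pcoord 0 1 x) (gram bvec pcoord 1 1 x) p0.
move=> s t w s0 h; rewrite -(pmulr_rgt0 _ s0); apply: lt_le_trans h _.
by rewrite le_eqVlt; apply/orP; left; apply/eqP; ring.
Qed.

Variable fr : frame (bvec 0) (bvec 1) pcoord.
Let ev (x : 'rV[R]_2) (f : A) : R := f x.

Lemma metric_inv x i j : U x -> invmx (G x) i j = gram_inv fr i j x.
Proof.
move=> Ux; pose X := \matrix_(i, j) gram bvec pcoord i j.
pose Y := \matrix_(i, j) gram_inv fr i j.
have GX : G x = map_mx (ev x) X by apply/matrixP => k l; rewrite !mxE metric_gram.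
have XY : map_mx (ev x) X *m map_mx (ev x) Y = 1%:M.
  by rewrite -eval_mulmx gram_mul_inv; exact: eval_mx1.
rewrite GX; have [uX _] := mulmx1_unit XY.
have -> : invmx (map_mx (ev x) X) = map_mx (ev x) Y.
  by rewrite -[RHS]mul1mx -(mulVmx uX) -mulmxA XY mulmx1.
by rewrite !mxE.
Qed.

Lemma metric_det x : U x ->
  \det (G x) = (gram bvec pcoord 0 0 * gram bvec pcoord 1 1
                - gram bvec pcoord 0 1 * gram bvec pcoord 0 1) x.
Proof.
move=> Ux; rewrite smfB !smfM -!metric_gram//.
have -> : \det (G x) = G x 0 0 * G x 1 1 - G x 0 1 * G x 1 0.
  rewrite (expand_det_row _ 0) sum_ord2 /cofactor !det_mx11 !mxE /=.
  rewrite expr0 expr1 mul1r mulN1r mulrN.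
  by congr (_ * G x _ _ - _ * G x _ _); exact/val_inj.
by rewrite (metric_gram 1 0 Ux) gramC -metric_gram.
Qed.

End PlaneCoordinates.

Section ExtrinsicQuantities.
Context {R : realType} (U : oset 'rV[R]_2).
Variables (P : 'rV[R]_2 -> 'rV[R]_4) (sP : smooth_on U P).
Local Notation A := (smf U).
Variables (G : 'rV[R]_2 -> 'M[R]_2).
Hypothesis GE : forall x, U x -> G x = 'J P x *m ('J P x)^T.
Local Notation phi := (pcoord sP).
Local Notation bvec := (@bvec R).
Variable fr : frame (bvec 0) (bvec 1) phi.

Let nbhsU x : U x -> nbhs x U.
Proof. by move=> Ux; apply: open_nbhs_nbhs; split => //; exact: oset_open. Qed.

Lemma nproj_gram w l : nproj fr w 0 l =
  w 0 l - \sum_i \sum_j ip w (dphi bvec phi i) * gram_inv fr i j * dphi bvec phi j 0 l.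
Proof.
rewrite /nproj t1_dphi t2_dphi !(ipDr, ipZr).
rewrite !sum_ord2 /gram_inv !sum_ord2 /frame2 /=.
move: (dphi bvec phi 0) (dphi bvec phi 1) => d0 d1.
rewrite !mxE.
ring.
Qed.

Lemma normal_projE x (v : 'rV[R]_4) (w : 'rV[A]_4) l : U x ->
  (forall j, v 0 j = w 0 j x) -> normal_proj ('J P x) v 0 l = nproj fr w 0 l x.
Proof.
move=> Ux vw; rewrite nproj_gram smfB -vw /normal_proj -GE//.
have vJ i : (v *m ('J P x)^T) 0 i = ip w (dphi bvec phi i) x.
  rewrite mxE /ip smf_sum; apply: eq_bigr => j _.
  by rewrite [X in _ * X]mxE vw smfM (jacobian_pcoord sP).
rewrite mxE; congr (_ + _); rewrite mxE; congr (- _).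
rewrite mxE smf_sum !sum_ord2.
rewrite [(_ *m invmx _) 0 0]mxE [(_ *m invmx _) 0 1]mxE !sum_ord2 !vJ.
rewrite !(metric_inv GE fr)// !(jacobian_pcoord sP)//.
by rewrite !(smfD, smfM); ring.
Qed.

Lemma mean_curvatureE x l : U x ->
  (\sum_(i < 2) \sum_(j < 2) invmx (G x) i j *:
     normal_proj ('J P x) (partial i (partial j P) x)) 0 l
  = lap fr (phi 0 l) x.
Proof.
move=> Ux; have := congr1 (fun w : 'rV[A]_4 => w 0 l x) (lap_mean_curvature fr).
rewrite [(map_mx _ _) 0 l]mxE => ->.
rewrite [LHS]summxE [in RHS]summxE smf_sum; apply: eq_bigr => i _.
rewrite [LHS]summxE [in RHS]summxE smf_sum; apply: eq_bigr => j _.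
rewrite [LHS]mxE [in RHS]mxE smfM (metric_inv GE fr)//.
congr (_ * _); apply: normal_projE => // m; exact: partial2_pcoord.
Qed.

(** Each metric derivative is a sum of two products of a second and a first derivative of phi; four
    of the six cancel and two copies of <phi_ij, phi_l> remain. *)
Lemma christoffelE x k i j : U x -> christoffel G k i j x = gamma fr k i j x.
Proof.
move=> Ux; rewrite /christoffel /gamma smf_sum mulr_sumr; apply: eq_bigr => l _.
have dG p q r : partial p (fun y => G y q r) x = sderive (bvec p) (gram bvec phi q r) x.
  rewrite sderiveE// /partial; apply: near_eq_derive; near=> y.
  rewrite (metric_gram sP GE)//; near: y; exact: nbhsU.
rewrite !dG !der_gram smfM !smfD (metric_inv GE fr)//.
rewrite (ddphiC _ _ j i) (ddphiC _ _ l i) (ddphiC _ _ l j).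
move: (ip (ddphi _ _ i j) _ x) (ip (ddphi _ _ i l) _ x) (ip (ddphi _ _ j l) _ x) => a b c.
by field.
Unshelve. all: by end_near. Qed.

Lemma riemann_tensorE x l i j k : U x -> riemann_tensor G l i j k x =
  (sderive (bvec i) (gamma fr l j k) - sderive (bvec j) (gamma fr l i k)
    + \sum_s (gamma fr l i s * gamma fr s j k - gamma fr l j s * gamma fr s i k)) x.
Proof.
move=> Ux; have dC p q r s : partial p (christoffel G q r s) x
    = sderive (bvec p) (gamma fr q r s) x.
  rewrite sderiveE// /partial; apply: near_eq_derive; near=> y.
  rewrite christoffelE//; near: y; exact: nbhsU.
rewrite /riemann_tensor !dC smfD smfB smf_sum; congr (_ + _).
by apply: eq_bigr => s _; rewrite smfB !smfM !christoffelE.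
Unshelve. all: by end_near. Qed.

Lemma gauss_curvatureE x : U x ->
  gauss_curvature_coord G x * \det (G x) = curv_lower fr x.
Proof.
move=> Ux; have dG : \det (G x) != 0.
  rewrite (metric_det sP GE Ux); have := congr1 (fun f : A => f x) (frame_det fr).
  rewrite /= smfM (smf1 Ux); apply: contra_eq_neq => ->.
  by rewrite mulr0 eq_sym oner_eq0.
rewrite /gauss_curvature_coord divfK// /curv_lower smf_sum; apply: eq_bigr => l _.
by rewrite riemann_tensorE// smfM (metric_gram sP GE).
Qed.

End ExtrinsicQuantities.

(** * The strong maximum principle in coordinates of the plane *)

Section PlaneHopf.
Context {R : realType} {U : oset 'rV[R]_2}.
Local Notation A := (smf U).
Local Notation bvec := (@bvec R).

Lemma smooth_coord j : smooth_on U (fun x : 'rV[R]_2 => x 0 j).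
Proof.
move=> k; apply: (@Ck_on_coord _ _ k 2 U id j (oset_open U)).
case: k => [|k]; first by move=> x _; exact: cvg_id.
split=> [x _|v]; first by apply: ex_diff.
have -> : 'D_v id = fun=> v :> 'rV[R]_2 by apply/funext => x; exact: derive_id.
exact: Ck_on_cst.
Qed.

Definition xcoord j : A := mk_smf (smooth_coord j).

Lemma xcoordE j x : U x -> xcoord j x = x 0 j.
Proof. exact: mk_smfE. Qed.

Lemma sderive_xcoord i j : sderive (bvec i) (xcoord j) = (i == j)%:R.
Proof.
apply: smf_eq => x Ux; rewrite sderiveE//.
have -> : ((i == j)%:R : A) x = (i == j)%:R.
  by case: (i == j); rewrite ?smf0// ?mulr1n ?smf1.
have dx : derivable (id : 'rV[R]_2 -> 'rV[R]_2) x (bvec i) by exact: derivable_id.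
have := derive_mx dx; rewrite derive_id => /(congr1 (fun M : 'rV[R]_2 => M 0 j)).
rewrite !mxE eqxx andTb eq_sym => ->; apply: near_eq_derive; near=> y.
rewrite xcoordE//; near: y.
by apply: open_nbhs_nbhs; split => //; exact: oset_open.
Unshelve. all: by end_near. Qed.

Lemma norm_plane (v : 'rV[R]_2) : `|v| = Num.max `|v 0 0| `|v 0 1|.
Proof.
apply/eqP; rewrite eq_le; apply/andP; split.
  rewrite [leLHS]/Num.Def.normr/= mx_normrE; apply: bigmax_le.
    by rewrite le_max normr_ge0.
  move=> [i j] _ /=; rewrite (ord1 i).
  by elim/ord2_ind: j; rewrite le_max lexx ?orbT.
rewrite ge_max; apply/andP; split.
  rewrite [leRHS]/Num.Def.normr/= mx_normrE.
  by apply: (le_trans _ (le_bigmax _ _ (0, 0))).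
rewrite [leRHS]/Num.Def.normr/= mx_normrE.
by apply: (le_trans _ (le_bigmax _ _ (0, 1))).
Qed.

Lemma compact_closed_ball_plane (x : 'rV[R]_2) r : 0 < r -> compact (closed_ball x r).
Proof.
move=> r0; apply: bounded_closed_compact; last exact: closed_ball_closed.
exists (`|x| + r); split; first exact: num_real.
move=> s sr y; rewrite closed_ballE// /closed_ball_ /= => xy.
apply: ltW; apply: le_lt_trans sr; rewrite -[y](subKr x).
by apply: le_trans (ler_normB _ _) _; rewrite lerD2l.
Qed.

Lemma hopf_plane (a b c a' c' f1 f2 f : A) (m : R) (x : 'rV[R]_2) :
  a * a' = 1 -> c * c' = 1 -> U x ->
  (forall z, U z -> f z <= m) -> f x = m ->
  (forall z, U z -> 0 <= elliptic (bvec 0) (bvec 1) a b c f1 f2 f z) ->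
  \forall z \near x, f z = m.
Proof.
move=> aa' cc' Ux fm fx Lf.
have := @hopf_local R _ U (bvec 0) (bvec 1) (fun v => v 0 0) (fun v => v 0 1)
  (xcoord 0) (xcoord 1).
apply => //.
- by move=> y z; rewrite !mxE.
- by move=> y z; rewrite !mxE.
- exact: coord_continuous.
- exact: coord_continuous.
- exact: norm_plane.
- exact: xcoordE.
- exact: xcoordE.
- exact: sderive_xcoord.
- exact: sderive_xcoord.
- exact: sderive_xcoord.
- exact: sderive_xcoord.
- exact: compact_closed_ball_plane.
- exact: aa'.
- exact: cc'.
- exact: Lf.
Qed.

End PlaneHopf.

(** * Functions on the manifold *)

Section GlobalFunctions.
Context {R : realType} {M : topologicalType} {S : smooth_manifold R 2 M}.
Variables (g : riemannian_metric S) (phi : M -> 'rV[R]_4).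
Hypothesis iso : isometric_immersion g phi.
Local Notation bvec := (@bvec R).

Definition cod (c : chart R 2 M) : oset 'rV[R]_2 := OSet (@chart_cod_open R 2 M c).

Lemma param_smooth c (Hc : atlas S c) : smooth_on (cod c) (param phi c).
Proof. exact: (iso Hc).1. Qed.

Definition chart_phi c (Hc : atlas S c) : 'rV[smf (cod c)]_4 :=
  pcoord (param_smooth Hc).

Definition cframe c (Hc : atlas S c) := frame (bvec 0) (bvec 1) (chart_phi Hc).

Lemma metricE c (Hc : atlas S c) x : cod c x ->
  metric_mx g c x = 'J (param phi c) x *m ('J (param phi c) x)^T.
Proof. by move=> Ux; have [_ /(_ x Ux) []] := iso Hc. Qed.

Lemma cframe_exists c (Hc : atlas S c) : inhabited (cframe Hc).
Proof.
apply: (pcoord_frame (param_smooth Hc) (metricE Hc)) => x Ux v v0.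
exact: metric_pos.
Qed.

(* A function on M is represented by a family of functions, one for each chart and each
   choice of frame, subject to compat. *)
Definition locfun := forall c (Hc : atlas S c), cframe Hc -> smf (cod c).
Implicit Types f h : locfun.

Definition compat f := forall c (Hc : atlas S c) (fr : cframe Hc) d (Hd : atlas S d)
  (fr' : cframe Hd) x y, cod c x -> cod d y -> chart_inv c x = chart_inv d y ->
  f c Hc fr x = f d Hd fr' y.

Lemma compatD f h : compat f -> compat h -> compat (fun c Hc fr => f c Hc fr + h c Hc fr).
Proof.
by move=> cf ch c Hc fr d Hd fr' x y Ux Uy xy; rewrite !smfD (cf c Hc fr d Hd fr' x y)//
  (ch c Hc fr d Hd fr' x y).
Qed.

Lemma compatM f h : compat f -> compat h -> compat (fun c Hc fr => f c Hc fr * h c Hc fr).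
Proof.
by move=> cf ch c Hc fr d Hd fr' x y Ux Uy xy; rewrite !smfM (cf c Hc fr d Hd fr' x y)//
  (ch c Hc fr d Hd fr' x y).
Qed.

Lemma compat_cst t : compat (fun c Hc fr => smf_cst (cod c) t).
Proof. by move=> c Hc fr d Hd fr' x y Ux Uy _; rewrite !smf_cstE. Qed.

Lemma compat_sum (n : nat) (F : 'I_n -> locfun) : (forall i, compat (F i)) ->
  compat (fun c Hc fr => \sum_i F i c Hc fr).
Proof.
move=> cF c Hc fr d Hd fr' x y Ux Uy xy; rewrite !smf_sum.
by apply: eq_bigr => i _; apply: cF.
Qed.

Lemma compat_ext f h : (forall c (Hc : atlas S c) fr, f c Hc fr = h c Hc fr) ->
  compat f -> compat h.
Proof. by move=> fh cf c Hc fr d Hd fr' x y Ux Uy xy; rewrite -!fh; exact: cf. Qed.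

Lemma compat_phi a : compat (fun c Hc fr => chart_phi Hc 0 a).
Proof.
move=> c Hc fr d Hd fr' x y Ux Uy xy.
by rewrite /chart_phi !pcoordE// /param /= xy.
Qed.

Section ChainRule.
Variables (c d : chart R 2 M) (Hc : atlas S c) (Hd : atlas S d).
Variables (fr : cframe Hc) (fr' : cframe Hd) (x y : 'rV[R]_2).
Hypotheses (Ux : cod c x) (Uy : cod d y) (xy : chart_inv c x = chart_inv d y).

Let tau := transition c d.

Let tau_x : tau x = y.
Proof. by rewrite /tau /transition /= xy chart_invK. Qed.

Let overlap_nbhs : nbhs x (overlap c d).
Proof.
apply: filterI; first by apply: open_nbhs_nbhs; split => //; exact: chart_cod_open.
apply: (chart_inv_continuous Ux); apply: open_nbhs_nbhs; split.
  exact: chart_dom_open.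
by rewrite xy; exact: chart_inv_fun.
Qed.

Let tau_diff : differentiable tau x.
Proof.
have /(_ 1) [+ _] := atlas_smooth Hc Hd; apply.
exact: nbhs_singleton overlap_nbhs.
Qed.

(** Compatibility means that, near x, the representative in c is the one in d composed with the
    transition map. *)
Lemma chain_rule f : compat f -> forall i,
  sderive (bvec i) (f c Hc fr) x =
  \sum_j 'J tau x i j * sderive (bvec j) (f d Hd fr') y.
Proof.
move=> cf i; rewrite sderiveE//.
have dfy : differentiable (f d Hd fr') (tau x) by rewrite tau_x; exact: smf_diff.
transitivity ('D_(bvec i) (f d Hd fr' \o tau) x).
  apply: near_eq_derive; near=> z.
  have [Uz dz] : overlap c d z by near: z; exact: overlap_nbhs.
  rewrite /=; apply: cf => //; first exact: chart_map_fun.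
  by rewrite /tau /transition /= chart_mapK.
rewrite (deriveE _ (differentiable_comp tau_diff dfy)) diff_comp//=.
rewrite -(deriveE _ tau_diff) (deriveEjacobian _ tau_diff) -rowE (row_sum_delta (row i _)) linear_sum.
apply: eq_bigr => j _; rewrite linearZ /= [row _ _ _ _]mxE tau_x; congr (_ * _).
by rewrite sderiveE// deriveE//; exact: smf_diff.
Unshelve. all: by end_near. Qed.

End ChainRule.

End GlobalFunctions.

(** Both sides are the inverse of G; this is why sums over an orthonormal frame do not depend on the
    frame. *)
Lemma trmx_mul_eq (R : comPzRingType) n (A B G : 'M[R]_n) :
  A *m G *m A^T = 1%:M -> B *m G *m B^T = 1%:M -> A^T *m A = B^T *m B.
Proof.
move=> hA hB; have GA : G *m (A^T *m A) = 1%:M.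
  by rewrite mulmxA; apply: mulmx1C; rewrite mulmxA.
have GB : G *m (B^T *m B) = 1%:M.
  by rewrite mulmxA; apply: mulmx1C; rewrite mulmxA.
by rewrite -[LHS]mul1mx -(mulmx1C GB) -mulmxA GA mulmx1.
Qed.

(** * Frame independence of gradients and the maximum principle on M *)

Section MaximumPrinciple.
Context {R : realType} {M : topologicalType} {S : smooth_manifold R 2 M}.
Variables (g : riemannian_metric S) (phi : M -> 'rV[R]_4).
Hypothesis iso : isometric_immersion g phi.
Local Notation bvec := (@bvec R).
Local Notation locfun := (locfun iso).
Local Notation cframe := (cframe iso).
Local Notation chart_phi := (chart_phi iso).

(** The inner product of the gradients of f and h. *)
Definition Gam (f h : locfun) : locfun := fun c Hc fr =>
  F1 fr (f c Hc fr) * F1 fr (h c Hc fr) + F2 fr (f c Hc fr) * F2 fr (h c Hc fr).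

Arguments Gam f h c Hc fr : clear implicits.

Definition grad (c : chart R 2 M) (u : smf (cod c)) (x : 'rV[R]_2) : 'cV[R]_2 :=
  \col_i sderive (bvec i) u x.

Definition frame_val c (Hc : atlas S c) (fr : cframe Hc) x : 'M[R]_2 :=
  \matrix_(i, j) frame2 (e := bvec) fr i j x.

Definition jac_val c (Hc : atlas S c) x : 'M[R]_(2, 4) :=
  \matrix_(i, a) sderive (bvec i) (chart_phi Hc 0 a) x.

Lemma Gam_val f h c (Hc : atlas S c) (fr : cframe Hc) x : Gam f h c Hc fr x =
  ((frame_val fr x *m grad (f c Hc fr) x)^T *m
   (frame_val fr x *m grad (h c Hc fr) x)) 0 0.
Proof.
have E (u : smf (cod c)) : F1 fr u x = (frame_val fr x *m grad u x) 0 0 /\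
    F2 fr u x = (frame_val fr x *m grad u x) 1 0.
  rewrite /F1 /F2 /field1 /field2 !smfD !smfM smf0.
  by rewrite !mxE !sum_ord2 !mxE /frame2 /= smf0.
rewrite /Gam smfD (smfM (F1 fr _)) (smfM (F2 fr _)) !(E _).1 !(E _).2.
rewrite [RHS]mxE sum_ord2.
by rewrite [(frame_val fr x *m grad (f c Hc fr) x)^T 0 0]mxE
  [(frame_val fr x *m grad (f c Hc fr) x)^T 0 1]mxE.
Qed.

Lemma frame_val_orth c (Hc : atlas S c) (fr : cframe Hc) x : cod c x ->
  frame_val fr x *m (jac_val Hc x *m (jac_val Hc x)^T) *m (frame_val fr x)^T = 1%:M.
Proof.
move=> Ux; have := congr1 (map_mx (fun f : smf (cod c) => f x)) (frame2_orth (e := bvec) fr).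
rewrite (eval_mx1 _ Ux) !eval_mulmx => <-; congr (_ *m _ *m _).
- by apply/matrixP => i j; rewrite !mxE.
- apply/matrixP => i j; rewrite [LHS]mxE [RHS]mxE [in RHS]mxE /gram /ip smf_sum.
  apply: eq_bigr => a _; rewrite smfM; congr (_ * _).
    by rewrite [LHS]mxE [in RHS]mxE.
  by rewrite [LHS]mxE [LHS]mxE [in RHS]mxE.
- by apply/matrixP => i j; rewrite !mxE.
Qed.

(** Gradients and the differential of phi change by the same matrix B, so the frame over c,
    multiplied by B, is orthonormal for the metric over d; [trmx_mul_eq] then compares it with the
    frame chosen there. *)
Lemma compat_Gam (f h : locfun) : compat f -> compat h -> compat (Gam f h).
Proof.
move=> cf ch c Hc fr d Hd fr' x y Ux Uy xy.
set B := 'J (transition c d) x.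
have chain (u : locfun) : compat u -> grad (u c Hc fr) x = B *m grad (u d Hd fr') y.
  move=> cu; apply/colP => i; rewrite [LHS]mxE [RHS]mxE.
  rewrite (chain_rule fr fr' Ux Uy xy cu); apply: eq_bigr => j _.
  by rewrite [X in _ = _ * X]mxE.
have jac : jac_val Hc x = B *m jac_val Hd y.
  apply/matrixP => i a; rewrite [LHS]mxE [RHS]mxE.
  rewrite (chain_rule fr fr' Ux Uy xy (@compat_phi _ _ _ _ _ iso a)); apply: eq_bigr => j _.
  by rewrite [X in _ = _ * X]mxE.
have o1 := frame_val_orth fr Ux; have o2 := frame_val_orth fr' Uy.
rewrite jac in o1.
have {}o1 : (frame_val fr x *m B) *m (jac_val Hd y *m (jac_val Hd y)^T)
    *m (frame_val fr x *m B)^T = 1%:M.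
  by rewrite -o1 !trmx_mul !mulmxA.
rewrite !Gam_val !chain// !trmx_mul.
congr (fun_of_matrix _ 0 0).
have E := trmx_mul_eq o1 o2; rewrite trmx_mul in E.
rewrite !mulmxA -!mulmxA; congr (_ *m _); rewrite !mulmxA; congr (_ *m _).
by rewrite -E !mulmxA.
Qed.

Hypothesis M_nonempty : [set: M] !=set0.
Hypothesis M_connected : connected [set: M].
Hypothesis M_compact : compact [set: M].

(** Every point lies in a chart that carries a frame, and compatibility makes the value independent
    of both; choice collects the values. *)
Lemma compat_global (f : locfun) : compat f -> exists F : M -> R,
  forall c (Hc : atlas S c) (fr : cframe Hc) x, cod c x -> f c Hc fr x = F (chart_inv c x).
Proof.
move=> cf; have : forall p, exists r, forall c (Hc : atlas S c) (fr : cframe Hc) x, cod c x ->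
    chart_inv c x = p -> f c Hc fr x = r.
  move=> p; have [d Hd dp] := atlas_cover S p; have [fr'] := cframe_exists iso Hd.
  exists (f d Hd fr' (chart_map d p)) => c Hc fr x Ux xp.
  apply: cf => //; first exact: chart_map_fun.
  by rewrite xp chart_mapK.
by move=> /choice[F FE]; exists F => c Hc fr x Ux; exact: FE.
Qed.

Lemma compat_chart_nbhs (f : locfun) (F : M -> R) p :
  (forall c (Hc : atlas S c) (fr : cframe Hc) x, cod c x ->
    f c Hc fr x = F (chart_inv c x)) ->
  exists c (Hc : atlas S c) (fr : cframe Hc), [/\ nbhs p (chart_dom c),
    cod c (chart_map c p) & forall q, chart_dom c q -> F q = f c Hc fr (chart_map c q)].
Proof.
move=> FE.
have [c Hc cp] := atlas_cover S p; have [fr] := cframe_exists iso Hc.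
exists c, Hc, fr; split.
- by apply: open_nbhs_nbhs; split => //; exact: chart_dom_open.
- exact: chart_map_fun.
- by move=> q cq; rewrite FE ?chart_mapK//; exact: chart_map_fun.
Qed.

Lemma compat_continuous (f : locfun) (F : M -> R) :
  (forall c (Hc : atlas S c) (fr : cframe Hc) x, cod c x ->
    f c Hc fr x = F (chart_inv c x)) -> continuous F.
Proof.
move=> FE p; have [c [Hc [fr [np Up Fq]]]] := compat_chart_nbhs p FE.
have cp := nbhs_singleton np.
have h : (f c Hc fr \o chart_map c) q @[q --> p] --> f c Hc fr (chart_map c p).
  apply: (@continuous_comp _ _ _ (chart_map c) (f c Hc fr)).
    exact: chart_map_continuous.
  exact: smf_continuous.
change (F @ p --> F p); rewrite (Fq p cp); apply: cvg_trans h.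
by apply: near_eq_cvg; near=> q; rewrite /= -Fq//; near: q.
Unshelve. all: by end_near. Qed.

Lemma continuous_max (F : M -> R) : continuous F -> exists p, forall q, F q <= F p.
Proof.
move=> cF.
have [p0 _ p0max] : exists2 p, p \in [set: M] & forall q, q \in [set: M] -> F q <= F p.
  by apply: compact_EVT_max => //; apply: continuous_subspaceT.
by exists p0 => q; apply: p0max; rewrite inE.
Qed.

Lemma compat_max (f : locfun) : compat f -> exists c (Hc : atlas S c) (fr : cframe Hc) x,
  cod c x /\ forall y, cod c y -> f c Hc fr y <= f c Hc fr x.
Proof.
move=> cf; have [F FE] := compat_global cf.
have [p pmax] := continuous_max (compat_continuous FE).
have [c Hc cp] := atlas_cover S p; have [fr] := cframe_exists iso Hc.
exists c, Hc, fr, (chart_map c p); split; first exact: chart_map_fun.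
by move=> y Uy; rewrite !FE ?chart_mapK//; exact: chart_map_fun.
Qed.

(** The set where the maximum is attained is closed, open by the local principle, and M is
    connected. With zero Laplacian it also serves to show that parallel tensors have constant
    components. *)
Lemma max_principle (f : locfun) : compat f ->
  (forall c (Hc : atlas S c) (fr : cframe Hc) x, cod c x -> 0 <= lap fr (f c Hc fr) x) ->
  exists m, forall c (Hc : atlas S c) (fr : cframe Hc) x, cod c x -> f c Hc fr x = m.
Proof.
move=> cf Lf; have [F FE] := compat_global cf.
have [p0 Fmax] := continuous_max (compat_continuous FE).
exists (F p0) => c Hc fr x Ux; rewrite FE//.
pose Z := F @^-1` [set F p0].
have oZ : open Z.
  rewrite openE => p Zp.
  have [d [Hd [fr' [np Up Fq]]]] := compat_chart_nbhs p FE.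
  have cp := nbhs_singleton np.
  have h : \forall z \near chart_map d p, f d Hd fr' z = F p0.
    apply: (hopf_plane (fa_inv fr') (fc_inv fr') Up).
    - by move=> z Uz; rewrite FE.
    - by rewrite -Fq.
    - exact: Lf.
  have := chart_map_continuous cp h => h'.
  apply: filterS (filterI np h') => q [dq /= fq].
  by rewrite /Z /= Fq.
have cZ : closed Z.
  by apply: closed_comp; [move=> p _; exact: compat_continuous FE _|exact: closed_eq].
have ZT : Z = [set: M].
  apply: M_connected; first by exists p0.
    by exists Z => //; rewrite setTI.
  by exists Z => //; rewrite setTI.
have : Z (chart_inv c x) by rewrite ZT.
by [].
Unshelve. all: by end_near. Qed.

End MaximumPrinciple.

Lemma dot_ip (R : realType) (v w : 'rV[R]_4) : dot v w = ip v w.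
Proof. by rewrite /dot ip_mulmx. Qed.

Lemma ip_ge0 (R : realType) (v : 'rV[R]_4) : 0 <= ip v v.
Proof. by apply: sumr_ge0 => i _; rewrite -expr2 sqr_ge0. Qed.

Lemma ip_eq0 (R : realType) (v : 'rV[R]_4) : (ip v v == 0) = (v == 0).
Proof.
apply/idP/eqP => [|->]; last by rewrite /ip big1// => i _; rewrite mxE mul0r.
rewrite psumr_eq0; last by move=> i _; rewrite -expr2 sqr_ge0.
move=> /allP h; apply/rowP => i; rewrite mxE.
by have := h i (mem_index_enum i); rewrite -expr2 sqrf_eq0 => /eqP.
Qed.

Lemma enorm_sqr (R : realType) (v : 'rV[R]_4) : enorm v ^+ 2 = ip v v.
Proof. by rewrite /enorm dot_ip sqr_sqrtr ?ip_ge0. Qed.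

Lemma eval_ip (R : realType) (V : normedModType R) (U : oset V)
    (v w : 'rV[smf U]_4) (x : V) :
  ip v w x = ip (map_mx (fun f : smf U => f x) v) (map_mx (fun f : smf U => f x) w).
Proof. by rewrite /ip smf_sum; apply: eq_bigr => i _; rewrite smfM !mxE. Qed.

(** * Spherical solitons *)

Section Soliton.
Context {R : realType} {M : topologicalType} {S : smooth_manifold R 2 M}.
Variables (g : riemannian_metric S) (phi : M -> 'rV[R]_4).
Hypothesis iso : isometric_immersion g phi.
Local Notation bvec := (@bvec R).
Local Notation locfun := (locfun iso).
Local Notation cframe := (cframe iso).
Local Notation chart_phi := (chart_phi iso).
Hypothesis M_nonempty : [set: M] !=set0.
Hypothesis M_connected : connected [set: M].
Hypothesis M_compact : compact [set: M].

Lemma compat_sqnorm : compat ((fun c Hc fr => ip (chart_phi Hc) (chart_phi Hc)) : locfun).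
Proof.
apply: (compat_sum (F := fun i => (fun c Hc fr => chart_phi Hc 0 i * chart_phi Hc 0 i) : locfun)).
by move=> i; apply: compatM; exact: compat_phi.
Qed.

Lemma point_exists : exists c (Hc : atlas S c) (fr : cframe Hc) x, cod c x.
Proof.
have [p _] := M_nonempty; have [c Hc cp] := atlas_cover S p.
have [fr] := cframe_exists iso Hc.
by exists c, Hc, fr, (chart_map c p); exact: chart_map_fun.
Qed.

Section Chart.
Variables (c : chart R 2 M) (Hc : atlas S c) (fr : cframe Hc) (x : 'rV[R]_2).
Hypothesis Ux : cod c x.
Local Notation P := (chart_phi Hc).
Local Notation ev := (fun f : smf (cod c) => f x).

Lemma mean_curvature_lap : mean_curvature g phi c x = map_mx ev (map_mx (lap fr) P).
Proof.
by apply/rowP => l; rewrite (mean_curvatureE (metricE iso Hc) fr)// [RHS]mxE [in RHS]mxE.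
Qed.

Lemma normal_proj_eval :
  normal_proj ('J (param phi c) x) (param phi c x) = map_mx ev (nproj fr P).
Proof.
apply/rowP => l; rewrite [RHS]mxE; apply: (normal_projE (metricE iso Hc)) => // j.
by rewrite pcoordE.
Qed.

Lemma ip_nproj (v : 'rV[smf (cod c)]_4) :
  ip (map_mx (lap fr) P) (nproj fr v) = ip (map_mx (lap fr) P) v.
Proof.
have [h1 h2] := lap_phi_ip fr.
rewrite /nproj -!scaleNr !ipDr !ipZr h1 h2 !mulr0 !addr0//.
Qed.

End Chart.

Hypothesis soliton : homothetic_soliton g phi.

Theorem soliton_sphere : exists kap rad : R, [/\ 0 < rad, kap * rad = 1 &
  forall c (Hc : atlas S c) (fr : cframe Hc),
    smf_cst (cod c) kap * smf_cst (cod c) kap * ip (chart_phi Hc) (chart_phi Hc) = 1 /\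
    map_mx (lap fr) (chart_phi Hc) =
      (- 2 * (smf_cst (cod c) kap * smf_cst (cod c) kap)) *: chart_phi Hc].
Proof.
have [H0 [a a0 Ha]] := soliton.
have ipH c (Hc : atlas S c) (fr : cframe Hc) x : cod c x ->
    ip (map_mx (lap fr) (chart_phi Hc)) (chart_phi Hc) x = - a^-1.
  move=> Ux; have := Ha c x Hc Ux; have := H0 c x Hc Ux.
  rewrite (mean_curvature_lap fr Ux) (normal_proj_eval fr Ux) enorm_sqr.
  rewrite -(ip_nproj fr (chart_phi Hc)) eval_ip.
  move: (map_mx _ (map_mx (lap fr) _)) (map_mx _ (nproj _ _)) => H N.
  rewrite -ip_eq0 => Hn0 /(congr1 (ip H)); rewrite -scaleNr !ipZr mulNr mulVf// => E.
  by apply: (mulfI a0); rewrite -E mulrN mulfV.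
have lapE' c (Hc : atlas S c) (fr : cframe Hc) x : cod c x ->
    lap fr (ip (chart_phi Hc) (chart_phi Hc)) x = 4 - 2 / a.
  move=> Ux; rewrite lap_sqnorm smfD [(2 * _)%R]mulr_natl !smfMn (smf1 Ux) ipH//.
  by rewrite mulr2n; field.
have [m mE] : exists m, forall c (Hc : atlas S c) (fr : cframe Hc) x, cod c x ->
    ip (chart_phi Hc) (chart_phi Hc) x = m.
  (* The sign of the constant Laplacian is not known yet, so the principle is applied to |phi|^2 or
     to its opposite. *)
  have [c0|c0] := lerP 0 (4 - 2 / a).
    have [||m mE] := max_principle M_nonempty M_connected M_compact
      (f := (fun c Hc fr => ip (chart_phi Hc) (chart_phi Hc)) : locfun).
    - exact: compat_sqnorm.
    - by move=> c Hc fr x Ux; rewrite lapE'.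
    by exists m.
  have [||m mE] := max_principle M_nonempty M_connected M_compact
    (f := (fun c Hc fr => smf_cst (cod c) (-1) * ip (chart_phi Hc) (chart_phi Hc)) : locfun).
  - by apply: compatM; [exact: compat_cst|exact: compat_sqnorm].
  - move=> c Hc fr x Ux; rewrite /lap elliptic_cstM smfM smf_cstE// -/(lap fr _) lapE'//.
    by rewrite mulN1r oppr_ge0 ltW.
  exists (- m) => c Hc fr x Ux; rewrite -(mE c Hc fr x Ux) smfM smf_cstE//.
  by rewrite mulN1r opprK.
have ipm c (Hc : atlas S c) (fr : cframe Hc) :
    ip (chart_phi Hc) (chart_phi Hc) = smf_cst (cod c) m.
  by apply: smf_eq => x Ux; rewrite (mE c Hc fr)// smf_cstE.
(* The Laplacian of the constant |phi|^2 vanishes, so 4 + 2 <H, phi> = 0; this amounts to a =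
   1/2. *)
have ip2 c (Hc : atlas S c) (fr : cframe Hc) :
    ip (map_mx (lap fr) (chart_phi Hc)) (chart_phi Hc) = - 2.
  have F1m : F1 fr (smf_cst (cod c) m) = 0 by exact: field1_cst.
  have F2m : F2 fr (smf_cst (cod c) m) = 0 by exact: field2_cst.
  have := lap_sqnorm fr; rewrite (ipm c Hc fr) lapE F1m F2m.
  rewrite (der0 (derivation_F1 fr)) (der0 (derivation_F2 fr)) !mulr0 => E.
  apply: smf_eq => x Ux; have := congr1 (fun f : smf (cod c) => f x) E.
  rewrite /= subr0 !addr0 smf0 smfD [(2 * _)%R]mulr_natl !smfMn smfN smfMn !(smf1 Ux).
  by rewrite !mulr2n; lra.
have tang c (Hc : atlas S c) (fr : cframe Hc) : nproj fr (chart_phi Hc) = chart_phi Hc.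
  have h1 : ip (chart_phi Hc) (t1 fr) = 0.
    rewrite ipC; apply: der_unit; first exact: derivation_F1.
    by rewrite (ipm c Hc fr); exact: field1_cst.
  have h2 : ip (chart_phi Hc) (t2 fr) = 0.
    rewrite ipC; apply: der_unit; first exact: derivation_F2.
    by rewrite (ipm c Hc fr); exact: field2_cst.
  by rewrite /nproj h1 h2 !scale0r !subr0.
have HE c (Hc : atlas S c) (fr : cframe Hc) x : cod c x ->
    m != 0 /\ map_mx (fun f : smf (cod c) => f x) (map_mx (lap fr) (chart_phi Hc))
    = (- 2 / m) *: map_mx (fun f : smf (cod c) => f x) (chart_phi Hc).
  move=> Ux; have := Ha c x Hc Ux; have := H0 c x Hc Ux.
  rewrite (mean_curvature_lap fr Ux) (normal_proj_eval fr Ux) enorm_sqr tang.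
  have := congr1 (fun f : smf (cod c) => f x) (ip2 c Hc fr); rewrite /= eval_ip.
  rewrite smfN smfMn (smf1 Ux).
  have := mE c Hc fr x Ux; rewrite eval_ip.
  move: (map_mx _ (map_mx (lap fr) _)) (map_mx _ (chart_phi Hc)) => H N Nm HN.
  rewrite -ip_eq0 => Hn0 E.
  (* As phi is normal, the soliton equation reads - H / |H|^2 = a phi; pairing with phi then turns
     the coefficient into - 2 / m. *)
  have {}E : H = (- (ip H H * a)) *: N.
    rewrite scaleNr -scalerA -E scalerN opprK scalerA mulfV// scale1r//.
  have E2 : - (ip H H * a) * m = - 2 by rewrite -Nm -ipZl -E.
  have m0 : m != 0.
    by apply: contra_eq_neq E2 => ->; rewrite mulr0 eq_sym oppr_eq0 pnatr_eq0.
  by split=> //; rewrite -E2 mulfK.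
have [c1 [Hc1 [fr1 [x1 Ux1]]]] := point_exists.
have [m0 _] := HE c1 Hc1 fr1 x1 Ux1.
have m_gt0 : 0 < m.
  by rewrite lt_neqAle eq_sym m0 -(mE c1 Hc1 fr1 x1 Ux1) eval_ip ip_ge0.
have s0 : 0 < Num.sqrt m by rewrite sqrtr_gt0.
exists (Num.sqrt m)^-1, (Num.sqrt m); split=> //; first by rewrite mulVf// gt_eqF.
have ss : (Num.sqrt m)^-1 * (Num.sqrt m)^-1 = m^-1.
  by rewrite -invfM -expr2 sqr_sqrtr// ltW.
move=> c Hc fr; split.
  by apply: smf_eq => x Ux; rewrite !smfM (mE c Hc fr)// !smf_cstE// ss mulVf//.
apply/rowP => l; apply: smf_eq => x Ux; have [_ E] := HE c Hc fr x Ux.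
have := congr1 (fun v : 'rV[R]_4 => v 0 l) E; rewrite mxE => ->.
rewrite [LHS]mxE [X in _ * X]mxE [in RHS]mxE smfM; congr (_ * _).
by rewrite !mulNr smfN !mulr_natl smfMn smfM !smf_cstE// ss.
Qed.

End Soliton.

Lemma sum_ord4 (A : nmodType) (F : 'I_4 -> A) :
  \sum_i F i = F (inord 0) + F (inord 1) + F (inord 2) + F (inord 3).
Proof.
rewrite !big_ord_recl big_ord0 addr0 !addrA.
by congr (F _ + F _ + F _ + F _); apply/val_inj; rewrite /= inordK.
Qed.

(** The squared Frobenius norm of v n^T + n v^T, which for v = E nu and n = nu is the derivative of
    nu nu^T. *)
Lemma sum_sym_square (A : comPzRingType) (v n : 'rV[A]_4) :
  \sum_i \sum_j (v 0 i * n 0 j + n 0 i * v 0 j) * (v 0 i * n 0 j + n 0 i * v 0 j)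
  = 2 * ip v v * ip n n + 2 * ip v n * ip v n.
Proof. by rewrite !ip4E !sum_ord4; ring. Qed.

(** * Tensors that are even in the normal *)

Section LocalTensors.
Context {R : realType} {V : normedModType R} {U : oset V}.
Local Notation A := (smf U).
Variables (e0 e1 : V) (phi : 'rV[A]_4) (fr : frame e0 e1 phi) (kap rad : R).
Hypothesis kr : kap * rad = 1.
Local Notation k := (smf_cst U kap).
Local Notation k' := (smf_cst U rad).
Hypothesis sphere : k * k * ip phi phi = 1.
Hypothesis minimal : map_mx (lap fr) phi = (- 2 * (k * k)) *: phi.

Local Notation psi := (psi phi kap).
Local Notation nu := (nu fr kap).
Local Notation t1 := (t1 fr).
Local Notation t2 := (t2 fr).
Local Notation F1 := (F1 fr).
Local Notation F2 := (F2 fr).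
Local Notation al := (al fr kap).
Local Notation be := (be fr kap).
Local Notation uu := (uu fr kap).

Let dF1 := derivation_F1 fr.
Let dF2 := derivation_F2 fr.

Let FFE i j : FF fr kap i j = (nth 0 [:: psi; t1; t2; nu] i) 0 j.
Proof. by rewrite mxE. Qed.

Let row_eq (E : A -> A) (X : 'M[A]_4) (i : 'I_4) :
  connection (FF fr kap) E = X ->
  map_mx E (nth 0 [:: psi; t1; t2; nu] i) =
  X i (inord 0) *: psi + X i (inord 1) *: t1 + X i (inord 2) *: t2 + X i (inord 3) *: nu.
Proof.
move=> cX; have := connectionE (FF_orth' fr kr sphere) E; rewrite cX => EF.
apply/rowP => j; have := congr1 (fun W : 'M[A]_4 => W i j) EF; rewrite /= [LHS]mxE FFE.
rewrite [X in _ = X -> _]mxE sum_ord4 !FFE !inordK//= => E2.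
by rewrite mxE E2 !mxE.
Qed.

Lemma frame_expand v :
  v = ip v psi *: psi + ip v t1 *: t1 + ip v t2 *: t2 + ip v nu *: nu.
Proof.
have E i : (v *m (FF fr kap)^T) 0 i = ip v (nth 0 [:: psi; t1; t2; nu] i).
  by rewrite mxE; apply: eq_bigr => l _; rewrite !mxE.
rewrite -[LHS]mulmx1 -(FF_orth' fr kr sphere) mulmxA; apply/rowP => j.
by rewrite mxE sum_ord4 !E !FFE !inordK//= !mxE.
Qed.

Lemma frame_der1 : [/\ map_mx F1 t1 = (- k) *: psi + pp fr *: t2 + al *: nu,
  map_mx F1 t2 = (- pp fr) *: t1 + be *: nu &
  map_mx F1 nu = (- al) *: t1 + (- be) *: t2].
Proof.
have c1 := conn1E fr kr sphere.
have r1 := row_eq (inord 1) c1; have r2 := row_eq (inord 2) c1.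
have r3 := row_eq (inord 3) c1; move: r1 r2 r3.
rewrite !mxE !inordK//= !scale0r !addr0 !add0r => -> -> ->.
by split.
Qed.

Lemma frame_der2 : [/\ map_mx F2 t1 = qq fr *: t2 + be *: nu,
  map_mx F2 t2 = (- k) *: psi + (- qq fr) *: t1 + (- al) *: nu &
  map_mx F2 nu = (- be) *: t1 + al *: t2].
Proof.
have c2 := conn2E kr sphere minimal; rewrite (betaE kr sphere minimal) in c2.
have r1 := row_eq (inord 1) c2; have r2 := row_eq (inord 2) c2.
have r3 := row_eq (inord 3) c2; move: r1 r2 r3.
rewrite !mxE !inordK//= !scale0r !addr0 !add0r => -> -> ->.
by split.
Qed.

(** Completeness of the orthonormal frame. The right side involves only phi and [Gam] of its
    components, so it does not depend on the frame. *)
Lemma nu_nuE a b : nu 0 a * nu 0 b =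
  (a == b)%:R - k * k * (phi 0 a * phi 0 b)
   - (F1 (phi 0 a) * F1 (phi 0 b) + F2 (phi 0 a) * F2 (phi 0 b)).
Proof.
have := congr1 (fun W : 'M[A]_4 => W a b) (FF_orth' fr kr sphere).
rewrite /= [LHS]mxE [RHS]mxE sum_ord4 => <-.
have E i (j : 'I_4) : (FF fr kap)^T i j = FF fr kap j i by rewrite mxE.
rewrite !E !FFE !inordK//= /psi !mxE.
have -> : F1 (phi 0 a) = t1 0 a by rewrite [RHS]mxE.
have -> : F1 (phi 0 b) = t1 0 b by rewrite [RHS]mxE.
have -> : F2 (phi 0 a) = t2 0 a by rewrite [RHS]mxE.
have -> : F2 (phi 0 b) = t2 0 b by rewrite [RHS]mxE.
ring.
Qed.

Let F1nu a : F1 (nu 0 a) = - al * t1 0 a - be * t2 0 a.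
Proof.
have [_ _ /rowP /(_ a)] := frame_der1; rewrite [LHS]mxE => ->.
by rewrite mxE [X in X + _]mxE [X in _ + X]mxE mulNr [X in _ + X]mulNr.
Qed.

Let F2nu a : F2 (nu 0 a) = - be * t1 0 a + al * t2 0 a.
Proof.
have [_ _ /rowP /(_ a)] := frame_der2; rewrite [LHS]mxE => ->.
by rewrite mxE [X in X + _]mxE [X in _ + X]mxE.
Qed.

(** The derivatives of nu are orthogonal to nu and both have squared length u, so each field
    contributes 2 u. *)
Lemma gam_nu_sum :
  \sum_a \sum_b (F1 (nu 0 a * nu 0 b) * F1 (nu 0 a * nu 0 b)
               + F2 (nu 0 a * nu 0 b) * F2 (nu 0 a * nu 0 b)) = 4 * uu.
Proof.
have [_ _ d1] := frame_der1; have [_ _ d2] := frame_der2.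
have n0 := nu_nu fr kr sphere; have n1 := nu_t1 fr kap; have n2 := nu_t2 fr kap.
have E (F : A -> A) : derivation F ->
    \sum_a \sum_b (F (nu 0 a * nu 0 b) * F (nu 0 a * nu 0 b)) =
    2 * ip (map_mx F nu) (map_mx F nu) + 2 * ip (map_mx F nu) nu * ip (map_mx F nu) nu.
  move=> dF; transitivity (2 * ip (map_mx F nu) (map_mx F nu) * ip nu nu
      + 2 * ip (map_mx F nu) nu * ip (map_mx F nu) nu); last by rewrite n0 mulr1.
  rewrite -sum_sym_square.
  by apply: eq_bigr => a _; apply: eq_bigr => b _; rewrite (derM dF) !mxE.
transitivity (\sum_a \sum_b (F1 (nu 0 a * nu 0 b) * F1 (nu 0 a * nu 0 b))
    + \sum_a \sum_b (F2 (nu 0 a * nu 0 b) * F2 (nu 0 a * nu 0 b))).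
  by rewrite -big_split; apply: eq_bigr => a _; rewrite -big_split.
rewrite !E// d1 d2 !(ipDl, ipDr, ipZl, ipZr) (ipC t1 nu) (ipC t2 nu) n1 n2.
rewrite (ipC t2 t1) ip11 ip12 ip22 /uu; ring.
Qed.

(** The second fundamental form as a symmetric tensor on R^4. *)
Let Y a b := al * (t1 0 a * t1 0 b - t2 0 a * t2 0 b)
  + be * (t1 0 a * t2 0 b + t2 0 a * t1 0 b).

Lemma torus_tensorE a b : torus_tensor fr kap rad a b =
  psi 0 a * nu 0 b + nu 0 a * psi 0 b - k' * Y a b.
Proof.
have E i (j : 'I_4) : (FF fr kap)^T i j = FF fr kap j i by rewrite mxE.
rewrite /torus_tensor /torus_mx mxE sum_ord4 !mxE !sum_ord4 !E !FFE !mxE !inordK//=.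
rewrite /Y /psi !mxE.
move: (t1 0 a) (t1 0 b) (t2 0 a) (t2 0 b) (nu 0 a) (nu 0 b) => ? ? ? ? ? ?.
ring.
Qed.

(** T is odd in nu, so T (x) nu is even, and the right side exhibits it in terms of phi, nu nu^T and
    [Gam]: the derivative of nu is - II, and contracting with nu removes the derivative of the
    second factor. *)
Lemma torus_tensor_nu a b d : torus_tensor fr kap rad a b * nu 0 d =
  k * (phi 0 a * (nu 0 b * nu 0 d) + phi 0 b * (nu 0 a * nu 0 d))
  + k' * \sum_c (F1 (phi 0 a) * F1 (nu 0 b * nu 0 c)
               + F2 (phi 0 a) * F2 (nu 0 b * nu 0 c)) * (nu 0 c * nu 0 d).
Proof.
have -> : F1 (phi 0 a) = t1 0 a by rewrite [RHS]mxE.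
have -> : F2 (phi 0 a) = t2 0 a by rewrite [RHS]mxE.
have -> : \sum_c (t1 0 a * F1 (nu 0 b * nu 0 c) + t2 0 a * F2 (nu 0 b * nu 0 c))
     * (nu 0 c * nu 0 d)
   = - (Y a b * nu 0 d * ip nu nu) - nu 0 b * nu 0 d *
     ((al * t1 0 a + be * t2 0 a) * ip nu t1 + (be * t1 0 a - al * t2 0 a) * ip nu t2).
  rewrite /Y !ip4E sum_ord4 !(derM dF1, derM dF2) !F1nu !F2nu.
  move: (t1 0 a) (t2 0 a) (t1 0 b) (t2 0 b) (nu 0 b) (nu 0 d) => ? ? ? ? ? ?.
  ring.
rewrite (nu_nu fr kr sphere) (nu_t1 fr kap) (nu_t2 fr kap) torus_tensorE.
rewrite /psi ![(k *: phi) _ _]mxE.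
ring.
Qed.

End LocalTensors.

(** * Constancy of u and maxima of height functions *)

Section SphericalSoliton.
Context {R : realType} {M : topologicalType} {S : smooth_manifold R 2 M}.
Variables (g : riemannian_metric S) (phi : M -> 'rV[R]_4).
Hypothesis iso : isometric_immersion g phi.
Local Notation bvec := (@bvec R).
Local Notation locfun := (locfun iso).
Local Notation cframe := (cframe iso).
Local Notation chart_phi := (chart_phi iso).
Hypothesis M_nonempty : [set: M] !=set0.
Hypothesis M_connected : connected [set: M].
Hypothesis M_compact : compact [set: M].
Variables (kap rad : R).
Hypothesis kr : kap * rad = 1.
Hypothesis sphere : forall c (Hc : atlas S c),
  smf_cst (cod c) kap * smf_cst (cod c) kap * ip (chart_phi Hc) (chart_phi Hc) = 1.
Hypothesis minimal : forall c (Hc : atlas S c) (fr : cframe Hc),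
  map_mx (lap fr) (chart_phi Hc) =
    (- 2 * (smf_cst (cod c) kap * smf_cst (cod c) kap)) *: chart_phi Hc.

(* nu depends on the orientation of the frame, nu (x) nu does not. *)
Definition nunu (a b : 'I_4) : locfun := fun c Hc fr => nu fr kap 0 a * nu fr kap 0 b.

Lemma compat_nunu a b : compat (nunu a b).
Proof.
apply: (compat_ext (f := (fun c Hc fr => smf_cst (cod c) (a == b)%:R
  + (smf_cst (cod c) (- (kap * kap)) * (chart_phi Hc 0 a * chart_phi Hc 0 b)
  + smf_cst (cod c) (-1) * Gam (fun c Hc fr => chart_phi Hc 0 a)
       (fun c Hc fr => chart_phi Hc 0 b) fr)) : locfun)).
  move=> c Hc fr; rewrite /nunu (nu_nuE fr kr (sphere Hc)) /Gam.
  move: (F1 fr _ * _ + _) => G; apply: smf_eq => x Ux.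
  rewrite !(smfD, smfN, smfM, smf_cstE _ Ux).
  have -> : ((a == b)%:R : smf (cod c)) x = (a == b)%:R.
    by case: (a == b); rewrite ?smf0// ?mulr1n ?smf1.
  ring.
apply: compatD; first exact: compat_cst.
apply: compatD; apply: compatM; try exact: compat_cst.
  by apply: compatM; exact: compat_phi.
by apply: compat_Gam; exact: compat_phi.
Qed.

Definition sff : locfun := fun c Hc fr => uu fr kap.

(* 4 u is the squared norm of the gradient of nu (x) nu. *)
Lemma compat_sff : compat sff.
Proof.
apply: (compat_ext (f := (fun c Hc fr => smf_cst (cod c) (4^-1) *
  \sum_a \sum_b Gam (nunu a b) (nunu a b) fr) : locfun)).
  move=> c Hc fr; rewrite /Gam /nunu (gam_nu_sum kr (sphere Hc) (minimal fr)).
  apply: smf_eq => x Ux; rewrite smfM mulr_natl smfMn smf_cstE// /sff.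
  by move: (uu _ _ _) => u; field.
apply: compatM; first exact: compat_cst.
apply: (compat_sum (F := fun a => (fun c Hc fr => \sum_b Gam (nunu a b) (nunu a b) fr) : locfun)).
move=> a; apply: (compat_sum (F := fun b => (fun c Hc fr => Gam (nunu a b) (nunu a b) fr) : locfun)).
by move=> b; apply: compat_Gam; exact: compat_nunu.
Qed.

Lemma curvature_sff c (Hc : atlas S c) (fr : cframe Hc) x : cod c x ->
  gauss_curvature g c x = kap ^+ 2 - uu fr kap x.
Proof.
move=> Ux; have := gauss_curvatureE (metricE iso Hc) fr Ux.
rewrite (curvature_sphere kr (sphere Hc) (minimal fr)) smfM smfB.
rewrite -(metric_det (param_smooth iso Hc) (metricE iso Hc) Ux) (smfX _ _ Ux) (smf_cstE _ Ux).
apply: mulIf; rewrite (metric_det (param_smooth iso Hc) (metricE iso Hc) Ux).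
have := congr1 (fun f : smf (cod c) => f x) (frame_det fr).
rewrite /= smfM (smf1 Ux); apply: contra_eq_neq => ->.
by rewrite mulr0 eq_sym oner_eq0.
Qed.

Lemma sff_constant : constant_gauss_curvature g \/ nonneg_gauss_curvature g ->
  exists u0, forall c (Hc : atlas S c) (fr : cframe Hc), uu fr kap = smf_cst (cod c) u0.
Proof.
move=> Kh; suff [u0 h] : exists u0, forall c (Hc : atlas S c) (fr : cframe Hc) x,
    cod c x -> uu fr kap x = u0.
  by exists u0 => c Hc fr; apply: smf_eq => x Ux; rewrite h// smf_cstE.
case: Kh => [[K0 KE]|K0].
  exists (kap ^+ 2 - K0) => c Hc fr x Ux.
  by rewrite -(KE c x Hc Ux) (curvature_sff fr Ux) subKr.
(* Simons' identity makes u subharmonic, because u >= 0 and kap^2 - u = K >= 0. *)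
apply: (max_principle M_nonempty M_connected M_compact compat_sff) => c Hc fr x Ux.
have [_ _ ->] := simons_sphere kr (sphere Hc) (minimal fr).
have Kx := K0 c x Hc Ux; rewrite (curvature_sff fr Ux) in Kx.
have ux : 0 <= uu fr kap x by rewrite smfD !smfX// addr_ge0// sqr_ge0.
move: (uu fr kap) ux Kx => u ux Kx.
move: (F1 fr (al fr kap) - _) (F1 fr (be fr kap) + _) => X Y.
rewrite !mulr_natl !(smfD, smfM, smfMn, smfN, smfX _ _ Ux, smf_cstE _ Ux).
apply: addr_ge0; first by rewrite !addr_ge0 ?sqr_ge0.
by apply: mulr_ge0 => //; move: (kap ^+ 2 - u x) Kx => w Kx; rewrite !addr_ge0.
Qed.

(** The Hessian of the height function on s F1 + t F2 at a critical point: the sphere contributes -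
    kap A, the normal B times the trace-free form with entries h1, h2, - h1. *)
Definition hess_le0 (A B h1 h2 : R) := forall s t : R,
  s ^+ 2 * (- (kap * A) + h1 * B) + s * t * (2 * (h2 * B))
  + t ^+ 2 * (- (kap * A) - h1 * B) <= 0.

(** At a maximum of the height the first derivatives <z, t1> and <z, t2> vanish, so only the psi and
    nu components of z survive. It serves to show that a prescribed z is attained by kap phi. *)
Lemma max_point (z : 'rV[R]_4) : ip z z = 1 ->
  exists c (Hc : atlas S c) (fr : cframe Hc) x A B,
  [/\ cod c x, A ^+ 2 + B ^+ 2 = 1,
   z = A *: map_mx (fun f : smf (cod c) => f x) (psi (chart_phi Hc) kap)
       + B *: map_mx (fun f : smf (cod c) => f x) (nu fr kap) &
   hess_le0 A B (al fr kap x) (be fr kap x)].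
Proof.
move=> z1; pose zc (c : chart R 2 M) : 'rV[smf (cod c)]_4 := \row_a smf_cst (cod c) (z 0 a).
have cz : compat ((fun c Hc fr => ip (zc c) (chart_phi Hc)) : locfun).
  apply: (compat_sum (F := fun a => (fun c Hc fr => zc c 0 a * chart_phi Hc 0 a) : locfun)).
  move=> a; apply: compatM; last exact: compat_phi.
  by move=> c Hc fr d Hd fr' x y Ux Uy _; rewrite !mxE !smf_cstE.
have [c [Hc [fr [x [Ux xmax]]]]] := compat_max M_nonempty M_compact cz.
set h := ip (zc c) (chart_phi Hc) in xmax.
have hmax : \forall y \near x, h y <= h x.
  near=> y; apply: xmax; near: y.
  by apply: open_nbhs_nbhs; split => //; exact: oset_open.
have [h1 h2] := field_max_eq0 (bvec 0) (bvec 1) (fa fr) (fb fr) (fc fr) Ux hmax.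
have hess := hessian_max_le0 (bvec 0) (bvec 1) (fa fr) (fb fr) (fc fr) Ux hmax.
have der_z (E : smf (cod c) -> smf (cod c)) v : derivation E ->
    (forall t, E (smf_cst (cod c) t) = 0) -> E (ip (zc c) v) = ip (zc c) (map_mx E v).
  move=> dE Et; rewrite (der_ip _ _ dE) (_ : map_mx E (zc c) = 0).
    by rewrite [X in X + _]big1 ?add0r// => i _; rewrite mxE mul0r.
  by apply/rowP => a; rewrite !mxE Et.
have z1E v : F1 fr (ip (zc c) v) = ip (zc c) (map_mx (F1 fr) v).
  by apply: der_z; [exact: derivation_F1|exact: field1_cst].
have z2E v : F2 fr (ip (zc c) v) = ip (zc c) (map_mx (F2 fr) v).
  by apply: der_z; [exact: derivation_F2|exact: field2_cst].
rewrite -/(F1 fr) -/(F2 fr) in h1 h2 hess.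
rewrite /h !z1E !z2E in h1 h2 hess.
rewrite -/(t1 fr) in h1 hess; rewrite -/(t2 fr) in h2 hess.
have [e11 e12 _] := frame_der1 fr kr (sphere Hc).
have [e21 e22 _] := frame_der2 kr (sphere Hc) (minimal fr).
have expd := frame_expand fr kr (sphere Hc) (zc c).
exists c, Hc, fr, x, (ip (zc c) (psi (chart_phi Hc) kap) x), (ip (zc c) (nu fr kap) x).
move: e11 e12 e21 e22 expd.
move: (psi (chart_phi Hc) kap) (nu fr kap) => ps n e11 e12 e21 e22 expd.
set A := ip (zc c) ps x; set B := ip (zc c) n x; split => //.
- have : ip (zc c) (zc c) x = 1.
    by rewrite eval_ip -[RHS]z1; congr ip; apply/rowP => a; rewrite !mxE smf_cstE.
  rewrite {2}expd !(ipDr, ipZr) !(smfD, smfM) h1 h2 -/A -/B => <-.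
  by rewrite !expr2; ring.
- apply/rowP => a; have := congr1 (fun v : 'rV[smf (cod c)]_4 => v 0 a x) expd.
  rewrite /= [zc c 0 a]mxE (smf_cstE _ Ux) => ->.
  rewrite /A /B; move: (t1 fr) (t2 fr) h1 h2 => u1 u2 h1 h2.
  by rewrite !mxE !(smfD, smfM) h1 h2 !mul0r !addr0.
- move=> s t; have := hess s t; rewrite z1E e11 e12 e21 e22 !(ipDr, ipZr).
  rewrite !(smfD, smfM, smfN, smf_cstE _ Ux) h1 h2 -/A -/B.
  by rewrite !mulr0 !addr0 !add0r; congr (_ <= 0); ring.
Unshelve. all: by end_near. Qed.

End SphericalSoliton.

Lemma isometry_mulmx (R : realType) (W : 'M[R]_4) : W *m W^T = 1%:M ->
  linear_isometry (mulmxr W^T : {linear 'rV[R]_4 -> 'rV[R]_4}).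
Proof.
move=> WW v; rewrite /enorm !dot_ip !ip_mulmx /= trmx_mul trmxK mulmxA -(mulmxA v).
by rewrite (mulmx1C WW) mulmx1.
Qed.

Lemma ip_isometry (R : realType) (W : 'M[R]_4) (v w : 'rV[R]_4) : W *m W^T = 1%:M ->
  ip (v *m W) (w *m W) = ip v w.
Proof. by move=> WW; rewrite !ip_mulmx trmx_mul mulmxA -(mulmxA v) WW mulmx1. Qed.

(** * Great spheres *)

Section Classification.
Context {R : realType} {M : topologicalType} {S : smooth_manifold R 2 M}.
Variables (g : riemannian_metric S) (phi : M -> 'rV[R]_4).
Hypothesis iso : isometric_immersion g phi.
Local Notation bvec := (@bvec R).
Local Notation locfun := (locfun iso).
Local Notation cframe := (cframe iso).
Local Notation chart_phi := (chart_phi iso).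
Hypothesis M_nonempty : [set: M] !=set0.
Hypothesis M_connected : connected [set: M].
Hypothesis M_compact : compact [set: M].
Variables (kap rad : R).
Hypothesis rad0 : 0 < rad.
Hypothesis kr : kap * rad = 1.
Hypothesis sphere : forall c (Hc : atlas S c),
  smf_cst (cod c) kap * smf_cst (cod c) kap * ip (chart_phi Hc) (chart_phi Hc) = 1.
Hypothesis minimal : forall c (Hc : atlas S c) (fr : cframe Hc),
  map_mx (lap fr) (chart_phi Hc) =
    (- 2 * (smf_cst (cod c) kap * smf_cst (cod c) kap)) *: chart_phi Hc.

Let kap0 : 0 < kap.
Proof. by rewrite -(pmulr_lgt0 _ rad0) kr. Qed.

Definition frame_at c (Hc : atlas S c) (fr : cframe Hc) x : 'M[R]_4 :=
  map_mx (fun f : smf (cod c) => f x) (FF fr kap).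

Lemma frame_at_orth c (Hc : atlas S c) (fr : cframe Hc) x : cod c x ->
  frame_at fr x *m (frame_at fr x)^T = 1%:M.
Proof.
move=> Ux; rewrite /frame_at map_trmx -eval_mulmx (FF_orth fr kr (sphere Hc)).
exact: eval_mx1.
Qed.

Lemma chart_point p : exists c (Hc : atlas S c) (fr : cframe Hc) x,
  cod c x /\ chart_inv c x = p.
Proof.
have [c Hc cp] := atlas_cover S p; have [fr] := cframe_exists iso Hc.
exists c, Hc, fr, (chart_map c p); split; first exact: chart_map_fun.
exact: chart_mapK.
Qed.

Lemma psi_at c (Hc : atlas S c) x : cod c x ->
  map_mx (fun f : smf (cod c) => f x) (psi (chart_phi Hc) kap) =
  kap *: phi (chart_inv c x).
Proof.
move=> Ux; apply/rowP => a; rewrite !mxE smfM smf_cstE//.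
by rewrite mk_smfE.
Qed.

Lemma combo_frame c (Hc : atlas S c) (fr : cframe Hc) x (A B : R) :
  A *: map_mx (fun f : smf (cod c) => f x) (psi (chart_phi Hc) kap)
  + B *: map_mx (fun f : smf (cod c) => f x) (nu fr kap) =
  (\row_j nth 0 [:: A; 0; 0; B] j) *m frame_at fr x.
Proof.
rewrite /frame_at /FF; move: (psi _ _) (nu _ _) => ps n.
apply/rowP => a; rewrite [RHS]mxE sum_ord4 !mxE !inordK//=.
by rewrite !mul0r !addr0.
Qed.

Lemma sqnorm_phi p : ip (phi p) (phi p) = rad ^+ 2.
Proof.
have [c [Hc [fr [x [Ux <-]]]]] := chart_point p.
have := psi_psi (sphere Hc) => /(congr1 (fun f : smf (cod c) => f x)).
rewrite /= eval_ip psi_at// ipZl ipZr (smf1 Ux) => E.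
by rewrite -[LHS]mul1r -[1]mul1r -kr -[RHS]mulr1 -E expr2; ring.
Qed.

Section Spherical.
Hypothesis flat0 : forall c (Hc : atlas S c) (fr : cframe Hc), uu fr kap = 0.

Let al0 c (Hc : atlas S c) (fr : cframe Hc) : al fr kap = 0 /\ be fr kap = 0.
Proof.
have h x : cod c x -> al fr kap x = 0 /\ be fr kap x = 0.
  move=> Ux; have := congr1 (fun f : smf (cod c) => f x) (flat0 fr).
  rewrite /uu /= smfD !smfX// smf0 => /eqP; rewrite paddr_eq0 ?sqr_ge0//.
  by rewrite !sqrf_eq0 => /andP[/eqP -> /eqP ->].
by split; apply: smf_eq => x Ux; rewrite smf0; have [] := h x Ux.
Qed.

(** When al = be = 0 both derivatives of nu vanish, so the Laplacian of each product is zero and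
    [max_principle] applies. *)
Lemma nunu_cst : exists m : 'I_4 -> 'I_4 -> R, forall a b c (Hc : atlas S c)
  (fr : cframe Hc) x, cod c x -> nu fr kap 0 a x * nu fr kap 0 b x = m a b.
Proof.
have h a b : exists m, forall c (Hc : atlas S c) (fr : cframe Hc) x, cod c x ->
    nunu kap a b fr x = m.
  apply: (max_principle M_nonempty M_connected M_compact
    (compat_nunu kr sphere a b)) => c Hc fr x Ux.
  have [al_0 be_0] := al0 fr.
  have [_ _ n1] := frame_der1 fr kr (sphere Hc).
  have [_ _ n2] := frame_der2 kr (sphere Hc) (minimal fr).
  rewrite al_0 be_0 oppr0 !scale0r addr0 in n1 n2.
  have F1n i : F1 fr (nu fr kap 0 i) = 0.
    by have := congr1 (fun v : 'rV[smf (cod c)]_4 => v 0 i) n1; rewrite /= !mxE.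
  have F2n i : F2 fr (nu fr kap 0 i) = 0.
    by have := congr1 (fun v : 'rV[smf (cod c)]_4 => v 0 i) n2; rewrite /= !mxE.
  have d1 := derivation_F1 fr; have d2 := derivation_F2 fr.
  rewrite lapE /nunu (derM d1) (derM d2) !F1n !F2n !mul0r !mulr0 !addr0.
  by rewrite (der0 d1) (der0 d2) !mulr0 subr0 !addr0 smf0.
have /choice[m mE] : forall ab : 'I_4 * 'I_4, exists m,
    forall c (Hc : atlas S c) (fr : cframe Hc) x, cod c x ->
    nunu kap ab.1 ab.2 fr x = m by move=> [a b]; exact: h.
exists (fun a b => m (a, b)) => a b c Hc fr x Ux.
by rewrite -(mE (a, b) c Hc fr x Ux) /nunu smfM.
Qed.

Theorem sphere_case : exists L : {linear 'rV[R]_4 -> 'rV[R]_4},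
  linear_isometry L /\ range (fun p => kap *: L (phi p)) = unit_sphere2.
Proof.
have [m mE] := nunu_cst.
have [c0 [Hc0 [fr0 [x0 Ux0]]]] := point_exists iso M_nonempty.
pose W := frame_at fr0 x0; have WW : W *m W^T = 1%:M := frame_at_orth fr0 Ux0.
pose n0 : 'rV[R]_4 := map_mx (fun f : smf (cod c0) => f x0) (nu fr0 kap).
(* In the frame at x0 the last coordinate is the component along n0. *)
have L3 (v : 'rV[R]_4) : (v *m W^T) 0 (inord 3) = ip v n0.
  rewrite mxE; apply: eq_bigr => i _; congr (_ * _).
  by rewrite [RHS]mxE [LHS]mxE [LHS]mxE /FF [frame_mx _ _ _ _ _ _]mxE inordK.
have n0n0 : ip n0 n0 = 1.
  by rewrite -eval_ip (nu_nu fr0 kr (sphere Hc0)) (smf1 Ux0).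
(* Only the square of <v, nu> is the same everywhere, since nu is fixed up to sign. *)
have same c (Hc : atlas S c) (fr : cframe Hc) x (v : 'rV[R]_4) : cod c x ->
    ip v (map_mx (fun f : smf (cod c) => f x) (nu fr kap)) ^+ 2 = ip v n0 ^+ 2.
  move=> Ux; rewrite !expr2 {1 3}/ip !mulr_suml; apply: eq_bigr => a _.
  rewrite /ip !mulr_sumr; apply: eq_bigr => b _.
  rewrite mulrACA [RHS]mulrACA; congr (_ * _); rewrite /n0.
  rewrite 2![map_mx (fun f : smf (cod c) => f x) _ _ _]mxE.
  rewrite 2![map_mx (fun f : smf (cod c0) => f x0) _ _ _]mxE.
  by rewrite (mE a b c Hc fr x Ux) (mE a b c0 Hc0 fr0 x0 Ux0).
have phi_n0 p : ip (phi p) n0 = 0.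
  have [c [Hc [fr [x [Ux <-]]]]] := chart_point p.
  apply/eqP; rewrite -sqrf_eq0 -(same c Hc fr x _ Ux) sqrf_eq0.
  have := congr1 (fun f : smf (cod c) => f x) (nu_psi fr kap).
  rewrite /= smf0 eval_ip psi_at// ipC ipZl => /eqP.
  by rewrite mulf_eq0 (gt_eqF kap0).
exists (mulmxr W^T); split; first exact: isometry_mulmx.
apply/seteqP; split => [_ [p _ <-]|y [y1 y3]].
  split; last by rewrite mxE /= L3 phi_n0 mulr0.
  rewrite /enorm dot_ip ipZl ipZr ip_isometry; last by rewrite trmxK (mulmx1C WW).
  by rewrite sqnorm_phi mulrA expr2 mulrACA kr mulr1 sqrtr1.
have yy : ip y y = 1 by rewrite -enorm_sqr y1 expr1n.
pose z := y *m W; have zz : ip z z = 1 by rewrite ip_isometry.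
have [c [Hc [fr [x [A [B [Ux AB zE hess]]]]]]] :=
  max_point M_nonempty M_compact kr sphere minimal zz.
have [al_0 be_0] := al0 fr.
(* By [same], B^2 = <z, n0>^2, and <z, n0> is the last coordinate of y. *)
have B0 : B = 0.
  have : ip z (map_mx (fun f : smf (cod c) => f x) (nu fr kap)) = B.
    rewrite {1}zE ipDl !ipZl -!eval_ip (ipC (psi _ _)) nu_psi smf0 mulr0 add0r.
    by rewrite (nu_nu fr kr (sphere Hc)) (smf1 Ux) mulr1.
  move=> /(congr1 (fun r => r ^+ 2)); rewrite (same c Hc fr x z Ux) -L3.
  by rewrite /z -mulmxA WW mulmx1 y3 expr0n => /esym/eqP; rewrite sqrf_eq0 => /eqP.
(* A^2 = 1, and the second order condition, which reads - kap A <= 0, excludes A = - 1. *)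
have A1 : A = 1.
  have := hess 1 0; rewrite al_0 be_0 !smf0 B0 !mulr0 !addr0 expr1n mul1r expr0n /= mul0r addr0.
  rewrite oppr_le0 (pmulr_rge0 _ kap0) => A0.
  move: AB; rewrite B0 expr0n /= addr0 => /eqP; rewrite sqrf_eq1 => /orP[/eqP//|/eqP A1].
  by rewrite A1 oppr_ge0 leNgt ltr01 in A0.
exists (chart_inv c x) => //=.
rewrite scalemxAl -(psi_at Hc Ux).
have -> : map_mx (fun f : smf (cod c) => f x) (psi (chart_phi Hc) kap) = z.
  by rewrite zE A1 B0 scale1r scale0r addr0.
by rewrite /z -mulmxA WW mulmx1.
Qed.

End Spherical.
End Classification.

(** * Clifford tori *)

Section QuadraticForm.
Context {A : comPzRingType}.
Implicit Types (T B W : 'M[A]_4) (v w : 'rV[A]_4).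

Definition qform T v : A := (v *m T *m v^T) 0 0.

Lemma qformE T v : qform T v = \sum_a \sum_b v 0 a * v 0 b * T a b.
Proof.
rewrite /qform mxE exchange_big; apply: eq_bigr => b _; rewrite mxE mulr_suml.
by apply: eq_bigr => a _; rewrite !mxE; ring.
Qed.

Lemma qform_congr W B w : W *m W^T = 1%:M ->
  qform (W^T *m B *m W) (w *m W) = qform B w.
Proof.
move=> WW; rewrite /qform trmx_mul -!mulmxA (mulmxA W W^T w^T) WW mul1mx.
by rewrite (mulmxA W W^T) WW mul1mx.
Qed.

Lemma qform_torus_mx (l al be : A) w : qform (torus_mx l al be) w =
  2 * w 0 (inord 0) * w 0 (inord 3)
  - l * al * (w 0 (inord 1) ^+ 2 - w 0 (inord 2) ^+ 2)
  - 2 * (l * be) * (w 0 (inord 1) * w 0 (inord 2)).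
Proof.
rewrite qformE sum_ord4 !sum_ord4 !mxE !inordK//=; ring.
Qed.

Lemma qform_sqr T v : qform T v * qform T v =
  \sum_a \sum_b \sum_c \sum_d v 0 a * v 0 b * (v 0 c * v 0 d) * (T a b * T c d).
Proof.
rewrite {1}qformE mulr_suml; apply: eq_bigr => a _.
rewrite mulr_suml; apply: eq_bigr => b _; rewrite qformE mulr_sumr.
apply: eq_bigr => c _; rewrite mulr_sumr; apply: eq_bigr => d _.
by rewrite mulrACA.
Qed.

End QuadraticForm.

Section TorusNormalForm.
Context {R : realType}.

(** If c and s are the cosine and sine of an angle theta, (v1, v2) is a unit vector at the angle
    (theta + pi) / 2. *)
Lemma half_angle (c s : R) : c ^+ 2 + s ^+ 2 = 1 -> exists v1 v2 : R,
  [/\ v1 ^+ 2 + v2 ^+ 2 = 1, v1 ^+ 2 - v2 ^+ 2 = - c & 2 * (v1 * v2) = - s].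
Proof.
(* For c = 1 the general formula would divide by v1 = 0. *)
move=> cs; have [c1|c1] := eqVneq c 1.
  have s0 : s = 0.
    by apply/eqP; rewrite -sqrf_eq0 -(inj_eq (addrI (c ^+ 2))) cs c1 expr1n addr0.
  by exists 0, 1; split; rewrite ?c1 ?s0; ring.
have cle : c < 1.
  by rewrite lt_neqAle c1 /=; move: cs; rewrite !expr2 => cs; nra.
pose v1 := Num.sqrt ((1 - c) / 2).
have v1E : v1 ^+ 2 = (1 - c) / 2 by rewrite sqr_sqrtr// divr_ge0 // subr_ge0 ltW.
have v10 : v1 != 0 by rewrite sqrtr_eq0 -ltNge divr_gt0 // subr_gt0.
have v2E : (- s / (2 * v1)) ^+ 2 = (1 + c) / 2.
  have -> : (- s / (2 * v1)) ^+ 2 = s ^+ 2 / (4 * v1 ^+ 2) by field.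
  have -> : s ^+ 2 = 1 - c ^+ 2 by rewrite -cs addrC addKr.
  by rewrite v1E; field; rewrite subr_eq0 eq_sym.
exists v1, (- s / (2 * v1)); split.
- by rewrite v1E v2E; field.
- by rewrite v1E v2E; field.
- by field.
Qed.

(** The outer block interchanges two basis vectors, with eigenvectors their sum and difference; the
    inner block is a reflection with axis (v1, v2) given by [half_angle]. The rows of V are unit
    eigenvectors, for the eigenvalues 1, 1, - 1, - 1. *)
Lemma torus_diagonal (l al be : R) : (l * al) ^+ 2 + (l * be) ^+ 2 = 1 ->
  exists V : 'M[R]_4, V *m V^T = 1%:M /\
  forall w, let y := w *m V^T in qform (torus_mx l al be) w =
    y 0 (inord 0) ^+ 2 + y 0 (inord 1) ^+ 2
    - (y 0 (inord 2) ^+ 2 + y 0 (inord 3) ^+ 2).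
Proof.
move=> /half_angle[v1 [v2 [v11 v12 v22]]].
pose h : R := Num.sqrt 2^-1.
have hh : h * h = 2^-1 by rewrite -expr2 sqr_sqrtr// invr_ge0.
have h2 : h * h + h * h = 1 by rewrite hh; field.
exists (mx4 [:: [:: h; 0; 0; h]; [:: 0; v1; v2; 0]; [:: h; 0; 0; - h];
               [:: 0; - v2; v1; 0]]); split.
  rewrite -mx4_1; apply/matrixP => i j; rewrite mxE sum_ord4 !mxE !inordK//=.
  case: i => [[|[|[|[|i]]]] //= i4]; case: j => [[|[|[|[|j]]]] //= j4];
    first [ring | by rewrite -h2; ring | by rewrite -v11; ring].
move=> w; rewrite /= qform_torus_mx !mxE !sum_ord4 !mxE !inordK//=.
rewrite !(mulr0, add0r, addr0).
move: (w 0 (inord 0)) (w 0 (inord 1)) (w 0 (inord 2)) (w 0 (inord 3)) => w0 w1 w2 w3.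
transitivity (4 * (h * h) * w0 * w3 + (v1 ^+ 2 - v2 ^+ 2) * (w1 ^+ 2 - w2 ^+ 2)
  + 2 * (2 * (v1 * v2)) * (w1 * w2)); last by ring.
by rewrite hh v12 v22; field.
Qed.

End TorusNormalForm.

(** * Solitons with nonvanishing second fundamental form *)

Section CliffordTorus.
Context {R : realType} {M : topologicalType} {S : smooth_manifold R 2 M}.
Variables (g : riemannian_metric S) (phi : M -> 'rV[R]_4).
Hypothesis iso : isometric_immersion g phi.
Local Notation bvec := (@bvec R).
Local Notation locfun := (locfun iso).
Local Notation cframe := (cframe iso).
Local Notation chart_phi := (chart_phi iso).
Hypothesis M_nonempty : [set: M] !=set0.
Hypothesis M_connected : connected [set: M].
Hypothesis M_compact : compact [set: M].
Variables (kap rad : R).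
Hypothesis rad0 : 0 < rad.
Hypothesis kr : kap * rad = 1.
Hypothesis sphere : forall c (Hc : atlas S c),
  smf_cst (cod c) kap * smf_cst (cod c) kap * ip (chart_phi Hc) (chart_phi Hc) = 1.
Hypothesis minimal : forall c (Hc : atlas S c) (fr : cframe Hc),
  map_mx (lap fr) (chart_phi Hc) =
    (- 2 * (smf_cst (cod c) kap * smf_cst (cod c) kap)) *: chart_phi Hc.
Variable u0 : R.
Hypothesis u0_neq0 : u0 != 0.
Hypothesis sff_cst : forall c (Hc : atlas S c) (fr : cframe Hc),
  uu fr kap = smf_cst (cod c) u0.

(** Constancy of u makes al X + be Y and al Y - be X vanish, a linear system of determinant - u0, so
    X = Y = 0; Simons' identity then reduces to (kap^2 - u0) u0 = 0. *)
Lemma sff_parallel c (Hc : atlas S c) (fr : cframe Hc) :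
  [/\ uu fr kap = smf_cst (cod c) kap ^+ 2,
      map_mx (F1 fr) (torus_tensor fr kap rad) = 0 &
      map_mx (F2 fr) (torus_tensor fr kap rad) = 0].
Proof.
have [E1 E2 E3] := simons_sphere kr (sphere Hc) (minimal fr).
have F1u : F1 fr (uu fr kap) = 0 by rewrite sff_cst; exact: field1_cst.
have F2u : F2 fr (uu fr kap) = 0 by rewrite sff_cst; exact: field2_cst.
have lu : lap fr (uu fr kap) = 0.
  rewrite lapE !F1u F2u (der0 (derivation_F1 fr)) (der0 (derivation_F2 fr)).
  by rewrite !mulr0 !addr0 subr0.
rewrite F1u in E1; rewrite F2u in E2; rewrite lu in E3.
have T := torus_tensor_cst kr (sphere Hc) (minimal fr).
have uE : uu fr kap = al fr kap ^+ 2 + be fr kap ^+ 2 by [].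
have sc := sff_cst fr.
move: E1 E2 E3 T uE sc; move: (F1 fr (al fr kap) - _) (F1 fr (be fr kap) + _) => X Y.
move: (torus_tensor _ _ _) (uu fr kap) (al fr kap) (be fr kap).
move=> TT u a b E1 E2 E3 T uE sc.
have XY x : cod c x -> X x = 0 /\ Y x = 0.
  move=> Ux; have := congr1 (fun f : smf (cod c) => f x) E1.
  have := congr1 (fun f : smf (cod c) => f x) E2.
  have := congr1 (fun f : smf (cod c) => f x) uE.
  rewrite /= sc !mulr_natl !(smfD, smfM, smfMn, smfN, smfX _ _ Ux, smf_cstE _ Ux, smf0).
  move=> uE' e2 e1.
  (* The identity (al^2 + be^2) (X^2 + Y^2) = (al X + be Y)^2 + (al Y - be X)^2. *)
  have : u0 * (X x ^+ 2 + Y x ^+ 2) = 0.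
    rewrite uE'; transitivity ((a x * X x + b x * Y x) ^+ 2 + (a x * Y x - b x * X x) ^+ 2).
      by ring.
    suff [-> ->] : a x * X x + b x * Y x = 0 /\ a x * Y x - b x * X x = 0 by ring.
    by split; lra.
  move/eqP; rewrite mulf_eq0 (negbTE u0_neq0) paddr_eq0 ?sqr_ge0// !sqrf_eq0.
  by case/andP => /eqP -> /eqP ->.
have X0 : X = 0 by apply: smf_eq => x Ux; rewrite smf0; have [] := XY x Ux.
have Y0 : Y = 0 by apply: smf_eq => x Ux; rewrite smf0; have [] := XY x Ux.
have uk : u = smf_cst (cod c) kap ^+ 2.
  apply: smf_eq => x Ux; have := congr1 (fun f : smf (cod c) => f x) E3.
  rewrite /= sc X0 Y0 expr0n /= !mulr_natl.
  rewrite !(smfD, smfM, smfMn, smfN, smfX _ _ Ux, smf_cstE _ Ux, smf0).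
  move=> e; have : (kap ^+ 2 - u0) * u0 = 0 by lra.
  by move/eqP; rewrite mulf_eq0 (negbTE u0_neq0) orbF subr_eq0 => /eqP.
by have [T1 T2] := T uk X0 Y0; split.
Qed.

Let TT a b (c : chart R 2 M) (Hc : atlas S c) (fr : cframe Hc) : smf (cod c) :=
  torus_tensor fr kap rad a b.

Let Tnu a b d : locfun := fun c Hc fr => TT a b fr * nu fr kap 0 d.

Let compat_Tnu a b d : compat (Tnu a b d).
Proof.
pose ph a : locfun := fun c Hc fr => chart_phi Hc 0 a.
have cph e : compat (ph e) by exact: compat_phi.
have cnn e f : compat (@nunu _ _ _ _ _ iso kap e f) by exact: compat_nunu kr sphere e f.
apply: (compat_ext (f := (fun c Hc fr => smf_cst (cod c) kap *
    (ph a c Hc fr * nunu kap b d fr + ph b c Hc fr * nunu kap a d fr)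
  + smf_cst (cod c) rad *
    \sum_e Gam (ph a) (nunu kap b e) fr * nunu kap e d fr) : locfun)).
  by move=> c Hc fr; rewrite /Tnu /TT (torus_tensor_nu kr (sphere Hc) (minimal fr)).
apply: compatD; apply: compatM; try exact: compat_cst.
  by apply: compatD; exact: compatM.
apply: (compat_sum (F := fun e => (fun c Hc fr =>
  Gam (ph a) (nunu kap b e) fr * nunu kap e d fr) : locfun)) => e.
by apply: compatM => //; exact: compat_Gam.
Qed.

(* The tensor changes sign with nu, hence the products; they are compatible because each
   is the sum over l of the products of T a b * nu l and T d e * nu l. *)
Lemma torus_tensor_sqr_cst : exists m : 'I_4 -> 'I_4 -> 'I_4 -> 'I_4 -> R,
  forall a b d e c (Hc : atlas S c) (fr : cframe Hc) x, cod c x ->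
  torus_tensor fr kap rad a b x * torus_tensor fr kap rad d e x = m a b d e.
Proof.
pose F a b d e : locfun := fun c Hc fr => TT a b fr * TT d e fr.
have h a b d e : exists m, forall c (Hc : atlas S c) (fr : cframe Hc) x, cod c x ->
    F a b d e c Hc fr x = m.
  apply: (max_principle M_nonempty M_connected M_compact).
    apply: (compat_ext (f := (fun c Hc fr => \sum_l Tnu a b l fr * Tnu d e l fr) : locfun)).
      move=> c Hc fr; transitivity (TT a b fr * TT d e fr * ip (nu fr kap) (nu fr kap)).
        by rewrite mulr_sumr; apply: eq_bigr => l _; rewrite /Tnu mulrACA.
      by rewrite (nu_nu fr kr (sphere Hc)) mulr1.
    apply: (compat_sum (F := fun l => (fun c Hc fr => Tnu a b l fr * Tnu d e l fr) : locfun)).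
    by move=> l; exact: compatM.
  move=> c Hc fr x Ux; have [_ T1 T2] := sff_parallel fr.
  have F1T i j : F1 fr (TT i j fr) = 0.
    by have /matrixP/(_ i j) := T1; rewrite mxE [RHS]mxE.
  have F2T i j : F2 fr (TT i j fr) = 0.
    by have /matrixP/(_ i j) := T2; rewrite mxE [RHS]mxE.
  have d1 := derivation_F1 fr; have d2 := derivation_F2 fr.
  rewrite lapE /F (derM d1) (derM d2) !F1T !F2T !mul0r !mulr0 !addr0.
  by rewrite (der0 d1) (der0 d2) !mulr0 subr0 !addr0 smf0.
have /choice[m mE] : forall i : ('I_4 * 'I_4) * ('I_4 * 'I_4), exists m,
    forall c (Hc : atlas S c) (fr : cframe Hc) x, cod c x ->
    F i.1.1 i.1.2 i.2.1 i.2.2 c Hc fr x = m by move=> [[a b] [d e]]; exact: h.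
exists (fun a b d e => m ((a, b), (d, e))) => a b d e c Hc fr x Ux.
by rewrite -(mE ((a, b), (d, e)) c Hc fr x Ux) /F smfM.
Qed.

Definition tensor_at c (Hc : atlas S c) (fr : cframe Hc) x : 'M[R]_4 :=
  map_mx (fun f : smf (cod c) => f x) (torus_tensor fr kap rad).

(** The products of two entries are constant, which leaves the tensor at two points equal up to
    sign; the square of its form does not see the sign. *)
Lemma tensor_at_sqr c (Hc : atlas S c) (fr : cframe Hc) x
    c' (Hc' : atlas S c') (fr' : cframe Hc') x' v : cod c x -> cod c' x' ->
  qform (tensor_at fr x) v ^+ 2 = qform (tensor_at fr' x') v ^+ 2.
Proof.
move=> Ux Ux'; have [m mE] := torus_tensor_sqr_cst.
rewrite !expr2 !qform_sqr; do 4![apply: eq_bigr => ? _]; congr (_ * _).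
rewrite /tensor_at 2![map_mx (fun f : smf (cod c) => f x) _ _ _]mxE.
rewrite 2![map_mx (fun f : smf (cod c') => f x') _ _ _]mxE.
by rewrite (mE _ _ _ _ c Hc fr x Ux) (mE _ _ _ _ c' Hc' fr' x' Ux').
Qed.

Lemma tensor_atE c (Hc : atlas S c) (fr : cframe Hc) x : cod c x ->
  tensor_at fr x = (frame_at kap fr x)^T *m
    torus_mx rad (al fr kap x) (be fr kap x) *m frame_at kap fr x.
Proof.
move=> Ux; rewrite /tensor_at /torus_tensor !eval_mulmx /frame_at map_trmx.
congr (_ *m _ *m _); move: (al _ _) (be _ _) => a b.
apply/matrixP => i j; rewrite !mxE.
case: i => [[|[|[|[|i]]]] //= i4]; case: j => [[|[|[|[|j]]]] //= j4];
  by rewrite !(smfN, smfM, smf0, smf_cstE _ Ux, smf1).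
Qed.

(** On the image of kap phi the two sums of squares agree and add up to 1, so each is 1/2; the
    factor sqrt 2 makes both circles unit circles. *)
Theorem torus_case : exists L : {linear 'rV[R]_4 -> 'rV[R]_4},
  linear_isometry L /\
  range (fun p => Num.sqrt 2 * kap *: L (phi p)) = clifford_torus.
Proof.
have kap0 : 0 < kap by rewrite -(pmulr_lgt0 _ rad0) kr.
have s2 : Num.sqrt 2 ^+ 2 = 2 :> R by rewrite sqr_sqrtr.
have s20 : Num.sqrt 2 != 0 :> R by rewrite gt_eqF// sqrtr_gt0.
have al_be c (Hc : atlas S c) (fr : cframe Hc) x : cod c x ->
    al fr kap x ^+ 2 + be fr kap x ^+ 2 = kap ^+ 2.
  move=> Ux; have [/(congr1 (fun f : smf (cod c) => f x))] := sff_parallel fr.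
  by rewrite /= smfD !smfX// smf_cstE.
have [c0 [Hc0 [fr0 [x0 Ux0]]]] := point_exists iso M_nonempty.
pose W := frame_at kap fr0 x0.
have WW : W *m W^T = 1%:M := frame_at_orth kr sphere fr0 Ux0.
have unit0 : (rad * al fr0 kap x0) ^+ 2 + (rad * be fr0 kap x0) ^+ 2 = 1.
  by rewrite !exprMn -mulrDr al_be// -exprMn mulrC kr expr1n.
have [V [VV VD]] := torus_diagonal unit0.
(* In the frame at x, T interchanges psi and nu, so its form on A psi + B nu is 2 A B. *)
have quad c (Hc : atlas S c) (fr : cframe Hc) x A B : cod c x ->
    qform (tensor_at fr0 x0)
      (A *: map_mx (fun f : smf (cod c) => f x) (psi (chart_phi Hc) kap)
       + B *: map_mx (fun f : smf (cod c) => f x) (nu fr kap)) ^+ 2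
    = (2 * A * B) ^+ 2.
  move=> Ux; rewrite (tensor_at_sqr fr0 fr _ Ux0 Ux) combo_frame tensor_atE//.
  rewrite (qform_congr _ _ (frame_at_orth kr sphere fr Ux)).
  by rewrite qform_torus_mx !mxE !inordK//=; congr (_ ^+ 2); ring.
(* W passes to the frame at x0, V to the eigenvectors of T in that frame. *)
pose P := V *m W.
have PP : P *m P^T = 1%:M by rewrite trmx_mul -mulmxA (mulmxA W) WW mul1mx.
have P'P : P^T *m P = 1%:M := mulmx1C PP.
have normP v : ip (v *m P^T) (v *m P^T) = ip v v.
  by rewrite ip_isometry// trmxK.
have quadP v : qform (tensor_at fr0 x0) v = let y := v *m P^T in
    y 0 (inord 0) ^+ 2 + y 0 (inord 1) ^+ 2
    - (y 0 (inord 2) ^+ 2 + y 0 (inord 3) ^+ 2).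
  rewrite /= -{1}[v]mulmx1 -(mulmx1C WW) mulmxA tensor_atE// qform_congr//.
  by rewrite VD /= trmx_mul mulmxA.
exists (mulmxr P^T); split; first exact: isometry_mulmx.
apply/seteqP; split => [_ [p _ <-]|y [y1 y2]].
  have [c [Hc [fr [x [Ux <-]]]]] := chart_point iso p.
  have Q := quad c Hc fr x 1 0 Ux.
  rewrite scale1r scale0r addr0 mulr0 expr0n psi_at// in Q.
  move/eqP: Q; rewrite sqrf_eq0 quadP /= => /eqP Q.
  have N : ip (kap *: phi (chart_inv c x)) (kap *: phi (chart_inv c x)) = 1.
    by rewrite ipZl ipZr (sqnorm_phi kr sphere) mulrA expr2 mulrACA kr mulr1.
  rewrite -normP ip4E -scalemxAl in N; rewrite -scalemxAl in Q.
  rewrite /= -!scalerA; move: (kap *: _) Q N => z Q N.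
  have e i : (Num.sqrt 2 *: z) 0 i ^+ 2 = 2 * z 0 i ^+ 2 by rewrite mxE exprMn s2.
  by split; rewrite !e; move: Q N; rewrite !expr2; lra.
pose z := ((Num.sqrt 2)^-1 *: y) *m P.
have zP : z *m P^T = (Num.sqrt 2)^-1 *: y by rewrite /z -mulmxA PP mulmx1.
have e i : ((Num.sqrt 2)^-1 *: y) 0 i ^+ 2 = 2^-1 * y 0 i ^+ 2.
  by rewrite mxE exprMn exprVn s2.
have zz : ip z z = 1.
  rewrite -normP zP ip4E -!expr2 !e; move: y1 y2.
  move: (y 0 _ ^+ 2) (y 0 _ ^+ 2) (y 0 _ ^+ 2) (y 0 _ ^+ 2) => a b d f; lra.
have [c [Hc [fr [x [A [B [Ux AB zE hess]]]]]]] :=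
  max_point M_nonempty M_compact kr sphere minimal zz.
have AB0 : A * B = 0.
  have := quad c Hc fr x A B Ux; rewrite -zE quadP /= zP !e -!mulrDr y1 y2 subrr expr0n.
  by move=> /esym/eqP; rewrite sqrf_eq0 -mulrA mulf_eq0 pnatr_eq0 => /eqP.
(* If A = 0, the second order conditions along the axes give al B = 0 and those along the diagonals
   be B = 0, against al^2 + be^2 = kap^2 > 0. *)
have A0 : A != 0.
  apply/eqP => A0; have BB : B ^+ 2 = 1 by rewrite -AB A0 expr0n add0r.
  have B0 : B != 0 by rewrite -sqrf_eq0 BB oner_eq0.
  have h1 := hess 1 0; have h2 := hess 0 1; have h3 := hess 1 1; have h4 := hess 1 (-1).
  rewrite A0 !expr2 in h1 h2 h3 h4.
  have a0 : al fr kap x * B = 0 by lra.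
  have b0 : be fr kap x * B = 0 by lra.
  move/eqP: a0; rewrite mulf_eq0 (negbTE B0) orbF => /eqP a0.
  move/eqP: b0; rewrite mulf_eq0 (negbTE B0) orbF => /eqP b0.
  have := al_be c Hc fr x Ux; rewrite a0 b0 expr0n addr0 => /esym/eqP.
  by rewrite sqrf_eq0 (gt_eqF kap0).
have B0 : B = 0 by move/eqP: AB0; rewrite mulf_eq0 (negbTE A0) => /eqP.
have A1 : A = 1.
  have := hess 1 0; rewrite B0 !mulr0 !addr0 expr1n mul1r expr0n /= mul0r addr0.
  rewrite oppr_le0 (pmulr_rge0 _ kap0) => A_ge0.
  move: AB; rewrite B0 expr0n /= addr0 => /eqP; rewrite sqrf_eq1 => /orP[/eqP//|/eqP A1].
  by rewrite A1 oppr_ge0 leNgt ltr01 in A_ge0.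
exists (chart_inv c x) => //=.
rewrite -scalerA scalemxAl -(psi_at iso kap Hc Ux).
have -> : map_mx (fun f : smf (cod c) => f x) (psi (chart_phi Hc) kap) = z.
  by rewrite zE A1 B0 scale1r scale0r addr0.
by rewrite zP scalerA mulfV// scale1r.
Qed.

End CliffordTorus.

Theorem corollary3p3 (R : realType) (M : topologicalType)
    (S : smooth_manifold R 2 M) (g : riemannian_metric S)
    (phi : M -> 'rV[R]_4)
    (M_nonempty : [set: M] !=set0)
    (M_connected : connected [set: M])
    (M_compact : compact [set: M])
    (phi_isometric : isometric_immersion g phi)
    (phi_soliton : homothetic_soliton g phi)
    (K_cst_or_ge0 : constant_gauss_curvature g \/ nonneg_gauss_curvature g) :
  exists (rho : R) (L : {linear 'rV[R]_4 -> 'rV[R]_4}),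
    0 < rho /\ linear_isometry L /\
    (range (fun p => rho *: L (phi p)) = unit_sphere2 \/
     range (fun p => rho *: L (phi p)) = clifford_torus).
Proof.
have [kap [rad [rad0 kr spherical]]] :=
  soliton_sphere phi_isometric M_nonempty M_connected M_compact phi_soliton.
have sphere c (Hc : atlas S c) : smf_cst (cod c) kap * smf_cst (cod c) kap
    * ip (chart_phi phi_isometric Hc) (chart_phi phi_isometric Hc) = 1.
  have [fr] := cframe_exists phi_isometric Hc.
  by have [] := spherical c Hc fr.
have minimal c (Hc : atlas S c) (fr : cframe phi_isometric Hc) :
    map_mx (lap fr) (chart_phi phi_isometric Hc) =
    (- 2 * (smf_cst (cod c) kap * smf_cst (cod c) kap)) *: chart_phi phi_isometric Hc.
  by have [] := spherical c Hc fr.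
have kap0 : 0 < kap by rewrite -(pmulr_lgt0 _ rad0) kr.
have [u0 u0E] := sff_constant M_nonempty M_connected M_compact kr sphere minimal
  K_cst_or_ge0.
have [u00|u00] := eqVneq u0 0.
  have [c Hc fr|L [isoL rangeL]] := sphere_case M_nonempty M_connected M_compact rad0 kr
    sphere minimal.
    by rewrite u0E u00; apply: smf_eq => x Ux; rewrite smf_cstE// smf0.
  by exists kap, L; split=> //; split=> //; left.
have [L [isoL rangeL]] := torus_case M_nonempty M_connected M_compact rad0 kr sphere
  minimal u00 u0E.
by exists (Num.sqrt 2 * kap), L; split; [rewrite mulr_gt0// sqrtr_gt0|split=> //; right].
Qed.
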